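(* Fix integers $m,n\ge0$. Consider a uniformly random bipolar-oriented planar triangulation with west and east boundary lengths $m+1$ and $n+1$ and with $\ell$ edges, where $\ell+m+n\equiv1\pmod 3$, and let $v$ be a uniformly random vertex of it. As $\ell\to\infty$ with $\ell+m+n\equiv 1\pmod 3$, the limiting in-degree and out-degree distributions of $v$ are independent and geometrically distributed (starting at $1$) with mean $3$; that is, for all $i,j\ge1$, $$\Pr[\text{in-degree}(v)=i,\ \text{out-degree}(v)=j]\ \longrightarrow\ \tfrac13\left(\tfrac23\right)^{i-1}\cdot\tfrac13\left(\tfrac23\right)^{j-1}.$$
   Context: A planar map here is a finite connected planar graph without self-loops (multiple edges allowed), with two distinguished vertices, the south pole $S$ and the north pole $N$, incident to the same face, embedded in a closed disk with $S$ at the bottom and $N$ at the top of the boundary circle and all other vertices in the interior; maps are considered up to orientation-preserving homeomorphism. Within the disk there are two boundary faces, the western face $W$ and the eastern face $E$; all other faces are interior faces. A bipolar orientation is an acyclic orientation of the edges whose only source (vertex with no incoming edges) is $S$ and whose only sink (vertex with no outgoing edges) is $N$. The west (east) boundary of the map is the directed path from $S$ to $N$ bounding $W$ (bounding $E$), and its length is its number of edges. A bipolar-oriented triangulation is a bipolar-oriented planar map all of whose interior faces have exactly $3$ edges. The in-degree (out-degree) of a vertex is its number of incoming (outgoing) edges. *)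

(* Defs.v *)
From HB Require Import structures.
From mathcomp Require Import all_boot all_order all_fingroup all_algebra.

Set Implicit Arguments.
Unset Strict Implicit.
Unset Printing Implicit Defensive.

Import GRing.Theory.
Local Open Scope quotient_scope.

(* Maps are encoded by rotation systems.  Each of the l oriented edges e is
   split into two darts: (e, false) is its tail end, attached to the vertex e
   leaves, and (e, true) is its head end, attached to the vertex e enters. *)
Definition dart (l : nat) := ('I_l * bool)%type.

Definition oppd l (d : dart l) : dart l := (d.1, ~~ d.2).

Lemma oppdK l : involutive (@oppd l).
Proof. by case=> e b; rewrite /oppd /= negbK. Qed.

Definition oppd_perm l : {perm dart l} := perm (inv_inj (@oppdK l)).

(* An oriented map drawn in a disk, with edge set 'I_l.  The permutation [cw]
   sends a dart to the next dart clockwise around the same vertex.  At each of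
   the two vertices on the boundary circle, one corner contains the circle;
   it is recorded by the first dart met clockwise after the circle, which is
   the westmost dart [south] at S and the eastmost dart [north] at N. *)
Record dmap (l : nat) := DMap {
  cw : {perm dart l};
  south : dart l;
  north : dart l }.

Section DMapFinType.
Variable l : nat.

Definition dmap_pair (M : dmap l) := (cw M, south M, north M).
Definition pair_dmap (p : {perm dart l} * dart l * dart l) :=
  DMap p.1.1 p.1.2 p.2.

Lemma dmap_pairK : cancel dmap_pair pair_dmap.
Proof. by case. Qed.

HB.instance Definition _ := Finite.copy (dmap l) (can_type dmap_pairK).
End DMapFinType.

Section DMapTheory.
Variables (l : nat) (M : dmap l).

(* [face] goes along the edge of a dart and then takes the next dart clockwise,
   so its orbits are the boundary walks of the faces, each dart being in the
   orbit of the face on its left. *)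
Definition face : {perm dart l} := (oppd_perm l * cw M)%g.

Definition vertices : {set {set dart l}} := porbits (cw M).

Definition edge_tail (e : 'I_l) : {set dart l} := porbit (cw M) (e, false).
Definition edge_head (e : 'I_l) : {set dart l} := porbit (cw M) (e, true).

Definition indeg (v : {set dart l}) : nat := #|[set e | edge_head e == v]|.
Definition outdeg (v : {set dart l}) : nat := #|[set e | edge_tail e == v]|.

Definition southpole : {set dart l} := porbit (cw M) (south M).
Definition northpole : {set dart l} := porbit (cw M) (north M).

(* The face of the underlying map that the boundary circle cuts into the
   western and the eastern face. *)
Definition outer_face : {set dart l} := porbit face (south M).

Definition connected_map : bool :=
  [forall d, forall d',
    connect [rel x y | (y == cw M x) || (y == oppd x)] d d'].

(* Euler's formula #V + #F = #E + 2, for a connected map. *)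
Definition planar : bool := #|vertices| + #|porbits face| == l + 2.

Definition loopless : bool := [forall e, edge_tail e != edge_head e].

Definition planar_map : bool :=
  [&& connected_map, planar, loopless,
      southpole != northpole & north M \in outer_face].

Definition adj : rel {set dart l} :=
  [rel u v | [exists e, (edge_tail e == u) && (edge_head e == v)]].

Definition acyclic : bool := [forall e, ~~ connect adj (edge_head e) (edge_tail e)].

Definition bipolar : bool :=
  acyclic && [forall v in vertices,
    ((indeg v == 0) == (v == southpole)) &&
    ((outdeg v == 0) == (v == northpole))].

(* The boundary walk of the outer face, starting at [south M], first follows
   the boundary of the western face from S to N, then, from [north M] on, the
   boundary of the eastern face from N back to S. *)
Definition west_length : nat := findex face (south M) (north M).
Definition east_length : nat := findex face (north M) (south M).

Definition triangulated : bool :=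
  [forall f in porbits face, (f != outer_face) ==> (#|f| == 3)].

Definition bipolar_triangulation (m n : nat) : bool :=
  [&& planar_map, bipolar, triangulated,
      west_length == m.+1 & east_length == n.+1].

End DMapTheory.

(* Orientation-preserving homeomorphism of the disk, fixing S and N: a
   relabelling of the edges that respects all the structure. *)
Definition relabel l (p : {perm 'I_l}) (d : dart l) : dart l := (p d.1, d.2).

Definition dmap_iso l : rel (dmap l) := fun M M' =>
  [exists p : {perm 'I_l},
    [&& [forall d, relabel p (cw M d) == cw M' (relabel p d)],
        relabel p (south M) == south M' &
        relabel p (north M) == north M']].

Lemma dmap_iso_refl l : reflexive (@dmap_iso l).
Proof.
have id1 d : relabel (1%g : {perm 'I_l}) d = d.
  by case: d => e b; rewrite /relabel perm1.
move=> M; apply/existsP; exists 1%g.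
by rewrite !id1 !eqxx !andbT; apply/forallP=> d; rewrite !id1.
Qed.

Lemma dmap_iso_sym l : symmetric (@dmap_iso l).
Proof.
suff imp M M' : dmap_iso M M' -> @dmap_iso l M' M.
  by move=> M M'; apply/idP/idP; apply: imp.
case/existsP=> p /and3P[/forallP rotP /eqP sP /eqP nP].
have pK d : relabel p^-1 (relabel p d) = d.
  by case: d => e b; rewrite /relabel permK.
have pVK d : relabel p (relabel p^-1 d) = d.
  by case: d => e b; rewrite /relabel permKV.
apply/existsP; exists p^-1%g; rewrite -sP -nP !pK !eqxx !andbT.
by apply/forallP=> d; rewrite -{1}(pVK d) -(eqP (rotP _)) pK.
Qed.

Lemma dmap_iso_trans l : transitive (@dmap_iso l).
Proof.
move=> M2 M1 M3 /existsP[p /and3P[/forallP rp /eqP sp /eqP np]].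
case/existsP=> q /and3P[/forallP rq /eqP sq /eqP nq].
have pq d : relabel (p * q)%g d = relabel q (relabel p d).
  by case: d => e b; rewrite /relabel permM.
apply/existsP; exists (p * q)%g; rewrite !pq sp np sq nq !eqxx !andbT.
by apply/forallP=> d; rewrite !pq (eqP (rp d)) (eqP (rq _)).
Qed.

Canonical dmap_iso_equiv l :=
  EquivRel (@dmap_iso l) (@dmap_iso_refl l) (@dmap_iso_sym l)
    (@dmap_iso_trans l).

HB.instance Definition _ (T : finType) (e : equiv_rel T) :=
  Finite.copy {eq_quot e} (can_type EquivQuot.ereprK).

Definition dmap_class l := {eq_quot (@dmap_iso_equiv l)}.

Definition triangulations (m n l : nat) : {set dmap_class l} :=
  [set \pi_(dmap_class l) M | M : dmap l & bipolar_triangulation M m n].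

Local Open Scope ring_scope.

(* The probability that a uniformly random vertex of M has in-degree i and
   out-degree j; it only depends on the isomorphism class of M. *)
Definition vertex_prob (R : fieldType) l (M : dmap l) (i j : nat) : R :=
  #|[set v in vertices M | (indeg M v == i) && (outdeg M v == j)]|%:R
    / #|vertices M|%:R.

(* The same for a uniformly random vertex of a uniformly random triangulation
   up to isomorphism. *)
Definition degree_prob (R : fieldType) (m n l i j : nat) : R :=
  (\sum_(C in triangulations m n l) vertex_prob R (generic_quotient.repr C) i j)
    / #|triangulations m n l|%:R.

(* Main.v *)
(* Kenyon, Miller, Sheffield and Wilson encode a bipolar-oriented triangulation
   with l edges by a walk of length l - 1 in the quadrant, from (0,m) to (n,0),
   with steps (1,-1), (-1,0) and (0,1).  The edges are explored in the order
   given by the times 0, ..., l - 1: from an edge e one goes to the westmost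
   edge leaving the head of e if e is the eastmost edge entering it (step
   (1,-1)), and otherwise across the triangle on the right of e.  Two edges have
   the same tail iff their abscissas agree and the abscissa does not go below in
   between, and the heads are described likewise by the ordinates; this
   describes the map explicitly in terms of the walk.

   Hence the out-degree of an inner vertex, created by a step (1,-1), is the
   number of visits of the abscissa to its level before it first goes below, and
   the in-degree is the same for the reversed walk.  For uniform steps these are
   independent and geometric.  The proportion of vertices with given degrees is
   exponentially concentrated for uniformly random words, whereas admissible
   walks have a probability that decays subexponentially, so that the
   concentration survives conditioning.  It is enough to bound the proportions
   from below, since both they and the claimed limits sum to 1. *)
Require Import Defs.
From HB Require Import structures.
From mathcomp Require Import all_boot all_order all_fingroup all_algebra.
From mathcomp Require Import zify.
Set Implicit Arguments.
Unset Strict Implicit.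
Unset Printing Implicit Defensive.
Import Order.TTheory GRing.Theory Num.Theory.

(** * Walks *)

(** Going from words to maps, the rotation is given by closed formulas, and Euler's formula becomes
    a count: each time is the representative of a vertex or of a triangle, according to the step
    leading to it. Going from maps to words, the step relation between edges is deterministic and
    the north edge is terminal, so it is enough to reach every edge from the south edge: all these
    walks are prefixes of a single one. The local structure that this requires (incoming edges
    consecutive around each vertex, one source and one sink per face) is forced by equality in
    Euler's formula.

    On the probabilistic side, the number of vertices depends only on the length and the endpoints,
    so the average over vertices is an expectation divided by a constant. A degree may depend on an
    arbitrarily long stretch of the walk; truncating to [K] letters on each side can only lose
    vertices, and for large [K] loses few. Disjoint windows are independent, which gives an
    exponential tail. The lower bound on the probability of admissible words relies on pigeonhole
    for letter counts instead of a local limit theorem. *)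

Definition nextp (L : nat) (P : pred nat) (e : nat) : nat :=
  e.+1 + find P (iota e.+1 (L - e)).

Lemma nextpP L P e : e <= L ->
  [/\ e < nextp L P e <= L.+1, forall t, e < t < nextp L P e -> ~~ P t
    & nextp L P e <= L -> P (nextp L P e)].
Proof.
rewrite /nextp => eL; have := find_size P (iota e.+1 (L - e)).
rewrite size_iota => fs; split; first by lia.
  move=> t tb; have ft : t - e.+1 < find P (iota e.+1 (L - e)) by lia.
  have := before_find 0 ft; rewrite nth_iota; last by lia.
  by rewrite (_ : e.+1 + (t - e.+1) = t); [move=> -> | lia].
move=> fL; have hP : has P (iota e.+1 (L - e)) by rewrite has_find size_iota; lia.
have := nth_find 0 hP; rewrite nth_iota //; lia.
Qed.

(** The successor makes the value 0 mean that no earlier time satisfies [P]; otherwise the value is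
    the time just after the last one that does. *)
Definition prevp (P : pred nat) (e : nat) : nat := \max_(t < e | P t) t.+1.

Lemma prevpP P e :
  [/\ prevp P e <= e, forall t, prevp P e <= t < e -> ~~ P t
    & 0 < prevp P e -> P (prevp P e).-1].
Proof.
split.
- by apply/bigmax_leqP => i _; apply: ltn_ord.
- move=> t /andP[pt te]; apply/negP => Pt; move: pt; rewrite leqNgt => /negP[].
  exact: (leq_bigmax_cond (F := fun i : 'I_e => i.+1) (Ordinal te)).
rewrite /prevp; elim/big_ind: _ => // x y hx hy.
by rewrite /maxn; case: ifP.
Qed.

(* [None], [Some false] and [Some true] stand for the steps (1,-1), (-1,0) and
   (0,1).  Only abscissas are manipulated: the ordinates of a walk are the
   abscissas of the reversed walk with coordinates exchanged, which is [rs]. *)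
Definition letter := option bool.
Definition dx (c : letter) : int :=
  match c with None => 1 | Some false => -1 | Some true => 0 end%R.
Definition swap (c : letter) : letter := omap negb c.
Definition rs (v : seq letter) : seq letter := rev (map swap v).
Definition height (v : seq letter) : int := (\sum_(c <- v) dx c)%R.
Definition X (w : seq letter) (t : nat) : int := height (take t w).

Lemma swapK : involutive swap. Proof. by case=> [[]|]. Qed.

Lemma rsK : involutive rs.
Proof. by move=> v; rewrite /rs map_rev revK mapK //; apply: swapK. Qed.

Lemma size_rs v : size (rs v) = size v.
Proof. by rewrite size_rev size_map. Qed.

Lemma nth_rs v t : t < size v -> nth None (rs v) t = swap (nth None v (size v - t.+1)).
Proof.
move=> tv; have lt : size v - t.+1 < size v by lia.
by rewrite /rs nth_rev ?size_map // (nth_map None).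
Qed.

Lemma height_cat u v : height (u ++ v) = (height u + height v)%R.
Proof. exact: big_cat. Qed.

Lemma X0 w : X w 0 = 0%R. Proof. by rewrite /X take0 /height big_nil. Qed.

Lemma XS w t : t < size w -> X w t.+1 = (X w t + dx (nth None w t))%R.
Proof.
by move=> tw; rewrite /X (take_nth None) // -cats1 height_cat /height big_seq1.
Qed.

Lemma X_up w t : t < size w -> nth None w t = None -> X w t.+1 = (X w t + 1)%R.
Proof. by move=> tw E; rewrite XS // E. Qed.
Lemma X_down w t : t < size w -> nth None w t = Some false -> X w t.+1 = (X w t - 1)%R.
Proof. by move=> tw E; rewrite XS // E. Qed.
Lemma X_flat w t : t < size w -> nth None w t = Some true -> X w t.+1 = X w t.
Proof. by move=> tw E; rewrite XS // E addr0. Qed.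

Lemma X_lip w t : t < size w -> (X w t - 1 <= X w t.+1 <= X w t + 1)%R.
Proof. by move=> tw; rewrite XS //; case: (nth _ _ _) => [[]|] /=; lia. Qed.

Lemma X_upE w t : t < size w -> (X w t < X w t.+1)%R = (nth None w t == None).
Proof. by move=> tw; rewrite XS //; case: (nth _ _ _) => [[]|] /=; apply/idP/eqP => //;
  lia. Qed.

(* The vertices of the map of a word of length [L] are numbered from 0 (the
   south pole) to [L.+1] (the north pole), [a] in between standing for the up
   step leading to time [a]. *)
Definition tl (w : seq letter) (e : nat) : nat :=
  prevp (fun t => (X w t < X w e)%R) e.
(** Read through the reversal, this is the first time after [e] at which the ordinate is below its
    value at [e], and the north pole [(size w).+1] if there is none. *)
Definition hd (w : seq letter) (e : nat) : nat :=
  (size w).+1 - tl (rs w) (size w - e).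
Definition ret (w : seq letter) (e : nat) : nat :=
  nextp (size w) (fun t => (X w t <= X w e)%R) e.

Lemma tlP w e : [/\ tl w e <= e, forall t, tl w e <= t < e -> (X w e <= X w t)%R
   & 0 < tl w e -> (X w (tl w e).-1 < X w e)%R].
Proof.
have [a b c] := prevpP (fun t => (X w t < X w e)%R) e; split=> // t /b.
by rewrite -leNgt.
Qed.

Lemma tl_uniq w e a : a <= e -> (forall t, a <= t < e -> (X w e <= X w t)%R) ->
  (0 < a -> (X w a.-1 < X w e)%R) -> tl w e = a.
Proof.
move=> ae h1 h2; have [b1 b2 b3] := tlP w e.
case: (ltngtP (tl w e) a) => // lt.
  by have := b2 a.-1; have := h2; lia.
by have := h1 (tl w e).-1; have := b3; lia.
Qed.

Lemma tl_le w e : tl w e <= e. Proof. by case: (tlP w e). Qed.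

Lemma tl_val w e : e <= size w -> 0 < tl w e -> X w (tl w e) = X w e.
Proof.
move=> ew a0; have [b1 b2 b3] := tlP w e.
have := b3 a0; have := @X_lip w (tl w e).-1; rewrite prednK // => h1 h2.
have := b2 (tl w e); case: (ltngtP (tl w e) e) b1 => //; last by move->.
by move=> lt _ /(_ _); have := h1 _; lia.
Qed.

Lemma tl_idem w e : e <= size w -> tl w (tl w e) = tl w e.
Proof.
move=> ew; have [b1 b2 b3] := tlP w e.
case: (posnP (tl w e)) => [->|a0]; first by have := tl_le w 0; lia.
by apply: tl_uniq => //; rewrite ?tl_val //; lia.
Qed.

Lemma tl_fix w a : a < size w -> (tl w a.+1 == a.+1) = (nth None w a == None).
Proof.
move=> aw; rewrite -X_upE //; have [b1 b2 b3] := tlP w a.+1.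
apply/eqP/idP => h; first by have := b3; rewrite h; apply.
by apply: tl_uniq => //; lia.
Qed.

Lemma tl_up w e : e <= size w -> 0 < tl w e -> nth None w (tl w e).-1 = None.
Proof.
move=> ew a0; apply/eqP; have := tl_le w e => le.
rewrite -tl_fix ?prednK ?tl_idem //; lia.
Qed.

Definition nonneg (w : seq letter) : Prop := forall t, (0 <= X w t)%R.

(** When the common [tl] is positive, both abscissas equal the one at that time. When it is 0, both
    are at most the initial abscissa 0, and nonnegativity makes them equal. *)
Lemma tl_eq_val w e f : nonneg w -> e <= f <= size w -> tl w e = tl w f ->
  X w e = X w f /\ forall t, e <= t <= f -> (X w e <= X w t)%R.
Proof.
move=> w0 ef E.
have [b1 b2 b3] := tlP w e; have [c1 c2 c3] := tlP w f.
have EX : X w e = X w f.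
  case: (posnP (tl w e)) => a0; last by rewrite -tl_val ?E ?tl_val //; lia.
  have [e0|e0] := posnP e; have [f0|f0] := posnP f; try by rewrite e0 f0.
  + by have := c2 0; have := w0 f; rewrite -E a0 e0 X0 f0; lia.
  + by lia.
  by have := c2 0; have := w0 f; have := b2 0; have := w0 e; rewrite -E a0 X0 f0 e0; lia.
split=> // t; have [->//|ne tb] := eqVneq t f; first by rewrite EX.
by rewrite EX; apply: c2; lia.
Qed.

Lemma retP w e : e <= size w ->
  [/\ e < ret w e <= (size w).+1,
      forall t, e < t < ret w e -> (X w e < X w t)%R
    & ret w e <= size w -> (X w (ret w e) <= X w e)%R].
Proof.
move=> ew; have [a b c] := nextpP (fun t => (X w t <= X w e)%R) ew.
by split=> // t /b; rewrite -ltNge.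
Qed.

(** Clockwise, the edges leaving a vertex come from west to east, in order of time. After the last
    one comes the eastmost edge entering the vertex, explored just before the up step that created
    it; at the south pole there is none, and the rotation crosses the circle back to edge 0. *)
Definition cw_out (w : seq letter) (e : nat) : nat * bool :=
  let f := ret w e in
  if (f <= size w) && (X w f == X w e) then (f, false)
  else if tl w e == 0 then (0, false) else ((tl w e).-1, true).

(* Rotating the disk by 180 degrees and reversing all edges. *)
Definition turn (L : nat) (d : nat * bool) : nat * bool := (L - d.1, ~~ d.2).

Definition cw_word (w : seq letter) (d : nat * bool) : nat * bool :=
  if d.2 then turn (size w) (cw_out (rs w) (size w - d.1)) else cw_out w d.1.

Definition lab (w : seq letter) (d : nat * bool) : nat :=
  if d.2 then hd w d.1 else tl w d.1.

Lemma turnK L d : d.1 <= L -> turn L (turn L d) = d.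
Proof. by case: d => e b /= eL; rewrite /turn /= negbK subKn. Qed.

Lemma hd_rs w e : e <= size w -> hd (rs w) (size w - e) = (size w).+1 - tl w e.
Proof. by move=> ew; rewrite /hd rsK size_rs subKn. Qed.

Lemma hd_gt w e : e <= size w -> e < hd w e <= (size w).+1.
Proof. by move=> ew; rewrite /hd; have := tl_le (rs w) (size w - e); lia. Qed.

Lemma lab_turn w d : d.1 <= size w -> lab (rs w) (turn (size w) d) = (size w).+1 - lab
  w d.
Proof.
case: d => e [] /= ew; rewrite /lab /= ?hd_rs //.
by rewrite /hd subKn //; have := tl_le (rs w) (size w - e); lia.
Qed.

Lemma lab_le w d : d.1 <= size w -> lab w d <= (size w).+1.
Proof.
case: d => e [] /= ew; rewrite /lab /=; first by have := hd_gt ew; lia.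
by have := tl_le w e; lia.
Qed.

Lemma cw_word_turn w d : d.1 <= size w ->
  cw_word (rs w) (turn (size w) d) = turn (size w) (cw_word w d).
Proof.
case: d => e b /= ew; rewrite /cw_word /= size_rs; case: b => /=.
  rewrite turnK // /cw_out.
  have ew' : size w - e <= size (rs w) by rewrite size_rs; lia.
  have := tl_le (rs w) (size w - e).
  by case: ifP => [/andP[]|_]; rewrite ?size_rs //; case: ifP => _ //=; lia.
by rewrite rsK subKn.
Qed.

Lemma cw_outP w e : nonneg w -> e <= size w ->
  (exists f, [/\ cw_out w e = (f, false), e < f <= size w, tl w f = tl w e
     & forall t, e < t < f -> tl w t != tl w e]) \/
  (cw_out w e = (if tl w e == 0 then (0, false) else ((tl w e).-1, true)) /\
   forall f, e < f <= size w -> tl w f != tl w e).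
Proof.
move=> w0 ew; have [r1 r2 r3] := retP ew; have [a1 a2 a3] := tlP w e.
rewrite /cw_out; case: ifP => [/andP[h1 /eqP h2]|h]; [left|right].
  exists (ret w e); split; rewrite ?h1 //.
  - by lia.
  - apply: tl_uniq; [lia| |by rewrite h2].
    move=> t tb; rewrite h2; case: (ltngtP t e) => [te|et|->//]; first by apply: a2; lia.
    by apply/ltW/r2; lia.
  - move=> t tb; apply/eqP => E; have [] := @tl_eq_val w e t; rewrite ?E //; first lia.
    by have := r2 t tb; lia.
split=> // f fb; apply/eqP => E; have efb : e <= f <= size w by lia.
have [Ef Eb] := tl_eq_val w0 efb (esym E).
move/negP: h; apply; case: (ltnP f (ret w e)) => fr.
  by have := r2 f; rewrite fr Ef; lia.
have rL : ret w e <= size w by lia.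
rewrite rL /=; have := r3 rL; have := Eb (ret w e); lia.
Qed.

Lemma hd_tl w e : e <= size w -> 0 < tl w e -> hd w (tl w e).-1 = tl w e.
Proof.
move=> ew a0; have al := tl_up ew a0; have le := tl_le w e.
set a := tl w e in le a0 al *.
have E : tl (rs w) (size w - a.-1) = (size w - a.-1).
  have -> : size w - a.-1 = (size w - a).+1 by lia.
  apply/eqP; rewrite tl_fix ?nth_rs ?size_rs; [|lia..].
  by rewrite (_ : size w - (size w - a).+1 = a.-1) ?al //; lia.
by rewrite /hd E; lia.
Qed.

Lemma cw_out_lab w e : nonneg w -> e <= size w ->
  (cw_out w e).1 <= size w /\ lab w (cw_out w e) = tl w e.
Proof.
move=> w0 ew; case: (cw_outP w0 ew) => [[f [-> fb E _]]|[-> h]].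
  by rewrite /lab /= E; lia.
have le := tl_le w e.
case: eqP => [->|/eqP]; first by rewrite /lab /=; have := tl_le w 0; lia.
rewrite -lt0n => a0; split; first by rewrite /=; lia.
by rewrite /lab /= hd_tl.
Qed.

Lemma cw_word_lab w d : nonneg w -> nonneg (rs w) -> d.1 <= size w ->
  (cw_word w d).1 <= size w /\ lab w (cw_word w d) = lab w d.
Proof.
move=> w0 w0'; case: d => e [] /= ew; rewrite /cw_word /=; last exact: cw_out_lab.
have ew' : size w - e <= size (rs w) by rewrite size_rs leq_subr.
have [h1 h2] := cw_out_lab w0' ew'.
split; first by rewrite /= leq_subr.
rewrite size_rs in h1; have := lab_turn (w := rs w); rewrite rsK size_rs => -> //.
by rewrite h2 /lab /hd /=.
Qed.

Lemma cw_word_inj w d d' : nonneg w -> nonneg (rs w) -> d.1 <= size w -> d'.1 <= size w ->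
  cw_word w d = cw_word w d' -> d = d'.
Proof.
have out_inj v e e' : nonneg v -> e <= size v -> e' <= size v -> cw_out v e = cw_out v
  e' -> e = e'.
  wlog lt : e e' / e < e'.
    move=> H v0 ev ev' E; case: (ltngtP e e') => // lt; first exact: H E.
    by rewrite (H e' e).
  move=> v0 ev ev' E; have := (cw_out_lab v0 ev).2; rewrite E (cw_out_lab v0 ev').2 => El.
  case: (cw_outP v0 ev) => [[f [Ef fb tf nf]]|[_ nf]]; last by have := nf e';
    rewrite El eqxx; lia.
  case: (cw_outP v0 ev') => [[f' [Ef' fb' tf' nf']]|[Ef' nf']].
    by move: E; rewrite Ef Ef' => -[ff']; have := nf e'; rewrite El eqxx; lia.
  by move: E; rewrite Ef Ef'; case: ifP => // _ [f0]; lia.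
(* By [cw_word_lab] both darts would sit at one vertex, numbered [tl w e = hd w e'], which lies
   after [e'] and not after [e]. A tail dart goes to a later tail or to the last head, a head dart
   to an earlier head or to the first tail, so the images differ. *)
have cross e e' : nonneg w -> nonneg (rs w) -> e <= size w -> e' <= size w ->
    cw_word w (e, false) = cw_word w (e', true) -> False.
  move=> w0 w0' ew ew' E; have [_ l1] := @cw_word_lab w (e, false) w0 w0' ew.
  have [_ l2] := @cw_word_lab w (e', true) w0 w0' ew'.
  move: l1; rewrite E l2 /lab /= => El.
  have := hd_gt ew'; have := tl_le w e => le1 le2.
  have ew'2 : size w - e' <= size (rs w) by rewrite size_rs leq_subr.
  move: E; rewrite /cw_word /=.
  have Eh : tl (rs w) (size w - e') = (size w).+1 - hd w e'.
    by rewrite /hd subKn //; have := tl_le (rs w) (size w - e'); lia.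
  case: (cw_outP w0 ew) => [[f [-> fb tf nf]]|[-> nf]];
  case: (cw_outP w0' ew'2) => [[f' [-> fb' tf' nf']]|[-> nf']]; rewrite ?Eh;
    try rewrite size_rs in fb'.
  - by move=> [].
  - by case: eqP => // /eqP h [] h2; lia.
  - by case: eqP => // /eqP h [] h2; lia.
  - by do 2!case: eqP => // ?; case; lia.
move=> w0 w0'; case: d d' => [e [|]] [e' [|]] /= ew ew' E.
- move: E; rewrite /cw_word /= => /(congr1 (turn (size w))).
  rewrite !turnK; first last.
  + by rewrite -[X in _ <= X]size_rs; apply: (cw_out_lab w0' _).1;
    rewrite size_rs leq_subr.
  + by rewrite -[X in _ <= X]size_rs; apply: (cw_out_lab w0' _).1;
    rewrite size_rs leq_subr.
  by move/out_inj; rewrite !size_rs => H; congr pair;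
    have := H w0' (leq_subr _ _) (leq_subr _ _); lia.
- by case: (cross e' e).
- by case: (cross e e').
- by congr pair; apply: out_inj E.
Qed.

Lemma cw_word_rs w d : d.1 <= size w ->
  cw_word w d = turn (size w) (cw_word (rs w) (turn (size w) d)).
Proof.
by move=> dw; have := @cw_word_turn (rs w) (turn (size w) d);
  rewrite size_rs rsK turnK //= leq_subr => ->.
Qed.

Lemma hd_eq w e f : e <= size w -> f <= size w ->
  (hd w e == hd w f) = (tl (rs w) (size w - e) == tl (rs w) (size w - f)).
Proof.
move=> ew fw; have := tl_le (rs w) (size w - e); have := tl_le (rs w) (size w - f).
by rewrite /hd; lia.
Qed.

Lemma cw_inP w e : nonneg (rs w) -> e <= size w ->
  (exists f, [/\ cw_word w (e, true) = (f, true), f < e, hd w f = hd w e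
     & forall t, f < t < e -> hd w t != hd w e]) \/
  (cw_word w (e, true) =
     (if hd w e == (size w).+1 then (size w, true) else (hd w e, false)) /\
   forall f, f < e -> hd w f != hd w e).
Proof.
move=> w0 ew; have ew' : size w - e <= size (rs w) by rewrite size_rs leq_subr.
rewrite /cw_word /=; case: (cw_outP w0 ew') => [[f [-> fb tf nf]]|[-> nf]]; [left|right].
  rewrite size_rs in fb.
  exists (size w - f); split=> //; first by lia.
    by apply/eqP; rewrite hd_eq ?subKn ?leq_subr //; [apply/eqP | lia].
  by move=> t tb; rewrite hd_eq //; [apply: nf | ]; lia.
split.
  have := tl_le (rs w) (size w - e); rewrite /hd => le.
  case: eqP => h0; case: eqP => h1; try lia; rewrite /turn /=; congr (_, _); lia.
by move=> f fe; rewrite hd_eq //; [apply: nf; rewrite size_rs |]; lia.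
Qed.

Lemma tl_eq0 w e : nonneg w -> e <= size w -> (tl w e == 0) = (X w e == 0%R).
Proof.
move=> w0 ew; have [a1 a2 a3] := tlP w e; apply/eqP/eqP => h.
  have [->|e0] := posnP e; first exact: X0.
  by have := a2 0; rewrite h e0 X0; have := w0 e; lia.
by apply/eqP; rewrite -leqn0 leqNgt; apply/negP => /a3; have := w0 (tl w e).-1; lia.
Qed.

Lemma cw_word_out w d : d.2 = false -> cw_word w d = cw_out w d.1.
Proof. by rewrite /cw_word => ->. Qed.

Lemma cw_out_next w e f : nonneg w -> e < f <= size w -> tl w f = tl w e ->
  (forall t, e < t < f -> tl w t != tl w e) -> cw_word w (e, false) = (f, false).
Proof.
move=> w0 ef E nf; rewrite cw_word_out //=.
have ew : e <= size w by lia.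
case: (cw_outP w0 ew) => [[g [-> gb tg ng]]|[_ ng]]; last by have := ng f ef;
  rewrite E eqxx.
congr pair; case: (ltngtP f g) => // lt.
  by have := ng f; rewrite E eqxx; lia.
by have := nf g; rewrite tg eqxx; lia.
Qed.

Lemma flat_out w t : nonneg w -> t < size w -> nth None w t = Some true ->
  cw_word w (t, false) = (t.+1, false).
Proof.
move=> w0 tw E; apply: cw_out_next => //; [lia| |lia].
have [a1 a2 a3] := tlP w t; apply: tl_uniq; rewrite ?X_flat //; [lia|].
by move=> t' tb; case: (ltngtP t' t) => [lt|lt|->//]; [apply: a2|]; lia.
Qed.

(** The edges [t], [g] and [t.+1] bound the triangle crossed by the step, where [g] is explored just
    before the tail of [t] is created. The step brings the abscissa back to its value at [g], for
    the first time since then, so [t.+1] follows [g] around its tail. *)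
Lemma down_out w t : nonneg w -> t < size w -> nth None w t = Some false ->
  exists g, [/\ g < t, nth None w g = None, cw_word w (t, false) = (g, true)
    & cw_word w (g, false) = (t.+1, false)].
Proof.
move=> w0 tw E; have Xt := X_down tw E; have := w0 t.+1 => Xp.
have tw' : t <= size w by lia.
have a0 : 0 < tl w t by rewrite lt0n tl_eq0 //; lia.
have [a1 a2 a3] := tlP w t.
have gw : (tl w t).-1 < size w by lia.
have ag := tl_up tw' a0; have Xg := X_up gw ag.
rewrite prednK // tl_val // in Xg.
exists (tl w t).-1; split=> //; first by lia.
  rewrite cw_word_out //=; case: (cw_outP w0 tw') => [[f [_ fb tf nf]]|[-> nf]].
    have tfb : t <= f <= size w by lia.
    by have [_ /(_ t.+1)] := tl_eq_val w0 tfb (esym tf); lia.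
  by case: eqP a0 => // ->.
have [b1 b2 b3] := tlP w (tl w t).-1.
apply: cw_out_next => //; first by lia.
  apply: tl_uniq => //; [lia| |by rewrite Xt; lia].
  move=> t' tb; have [lt|le] := ltnP t' (tl w t).-1; first by have := b2 t'; lia.
  have [->|ne] := eqVneq t' (tl w t).-1; first by lia.
  have [->|ne'] := eqVneq t' t; first by lia.
  by have := a2 t'; lia.
move=> t' tb; apply/eqP => Et.
have tb' : (tl w t).-1 <= t' <= size w by lia.
have [Ex _] := tl_eq_val w0 tb' (esym Et).
have [E'|ne] := eqVneq t' t; first by rewrite E' in Ex; lia.
by have := a2 t'; lia.
Qed.

Lemma nth_rs' w t : t < size w -> nth None (rs w) (size w - t.+1) = swap (nth None w t).
Proof. by move=> tw; rewrite nth_rs; [congr (swap (nth _ _ _)) |]; lia. Qed.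

Lemma down_in w t : nonneg (rs w) -> t < size w -> nth None w t = Some false ->
  cw_word w (t.+1, true) = (t, true).
Proof.
move=> w0 tw E; rewrite cw_word_rs //= /turn /= flat_out ?size_rs ?nth_rs' ?E //;
  last by lia.
by rewrite /turn /=; congr (_, _); lia.
Qed.

(** Mirror image of [down_out]: in [rs w] the step becomes [Some false] and the time [k] becomes
    [size w - k]. *)
Lemma flat_in w t : nonneg (rs w) -> t < size w -> nth None w t = Some true ->
  exists k, [/\ t.+1 < k <= size w, nth None w k.-1 = None,
    cw_word w (t.+1, true) = (k, false) & cw_word w (k, true) = (t, true)].
Proof.
move=> w0 tw E; have := @down_out (rs w) (size w - t.+1) w0.
rewrite size_rs nth_rs' // E => /(_ _ erefl) []; first by lia.
move=> g [gt ag c1 c2]; exists (size w - g); split; first by lia.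
- have gw : (size w - g).-1 < size w by lia.
  by apply: (inv_inj swapK); rewrite -nth_rs' // -[RHS]ag; congr nth; lia.
- by rewrite cw_word_rs //= {1}/turn /= c1 /turn.
have -> : (size w - g, true) = turn (size w) (g, false) by [].
rewrite cw_word_rs ?turnK ?c2 /turn /= ?leq_subr //; last by lia.
by congr (_, _); lia.
Qed.

(** * The map of a word *)

Lemma tl_hd w e : e <= size w -> hd w e <= size w -> tl w (hd w e) = hd w e.
Proof.
move=> ew; have := hd_gt ew => hb hL; have [//|h0] := eqVneq (tl w (hd w e)) (hd w e).
have E : (hd w e).-1.+1 = hd w e by rewrite prednK //; lia.
have hw : (hd w e).-1 < size w by lia.
apply/eqP; rewrite -E tl_fix //; apply/eqP.
apply: (inv_inj swapK); rewrite -nth_rs' // E.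
have := tl_le (rs w) (size w - e).
have := @tl_up (rs w) (size w - e); rewrite size_rs leq_subr.
have -> : tl (rs w) (size w - e) = (size w).+1 - hd w e.
  by rewrite /hd subKn //; have := tl_le (rs w) (size w - e); lia.
move=> /(_ isT) h _; rewrite -[RHS]h; [congr nth|]; lia.
Qed.

Lemma porbit_inv (T : finType) (A : Type) (s : {perm T}) (f : T -> A) x y :
  (forall z, f (s z) = f z) -> y \in porbit s x -> f y = f x.
Proof.
move=> fs /porbitP[i ->]; elim: i => [|i IH]; first by rewrite expg0 perm1.
by rewrite expgSr permM fs.
Qed.

Lemma porbit_next (T : finType) (s : {perm T}) x : porbit s (s x) = porbit s x.
Proof. by have := porbit_perm s 1 x; rewrite expg1. Qed.

(** The identity is a dummy value: it allows [word_map] to be defined on all words, before its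
    rotation is known to be injective. *)
Definition perm_of (T : finType) (f : T -> T) : {perm T} :=
  if @idP (injectiveb f) is ReflectT h then perm (injectiveP _ h) else 1%g.

Lemma perm_ofE (T : finType) (f : T -> T) : injective f -> perm_of f =1 f.
Proof.
move=> /injectiveP fi x; rewrite /perm_of; case: {-}_ / idP => [h|//].
by rewrite permE.
Qed.

Definition ndart L (d : dart L.+1) : nat * bool := (val d.1, d.2).
Definition odart L (p : nat * bool) : dart L.+1 := (inord p.1, p.2).

Lemma ndartK L : cancel (@ndart L) (@odart L).
Proof. by case=> e b; rewrite /odart /= inord_val. Qed.

Lemma odartK L p : p.1 <= L -> ndart (odart L p) = p.
Proof. by case: p => e b /= eL; rewrite /ndart /= inordK. Qed.

Lemma ndart_le L (d : dart L.+1) : (ndart d).1 <= L.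
Proof. by rewrite -ltnS ltn_ord. Qed.

Definition word_map L (w : seq letter) : dmap L.+1 :=
  DMap (perm_of (fun d : dart L.+1 => odart L (cw_word w (ndart d))))
    (odart L (0, false)) (odart L (L, true)).

Definition admissible (m n : nat) (w : seq letter) : Prop :=
  [/\ nonneg w, nonneg (rs w), height w = n & height (rs w) = m].

Section WordMap.
Variables (L m n : nat) (w : seq letter).
Hypotheses (sw : size w = L) (aw : admissible m n w).

Let w0 : nonneg w. Proof. by case: aw. Qed.
Let w0' : nonneg (rs w). Proof. by case: aw. Qed.
Let M := word_map L w.
Let O p := porbit (cw M) (odart L p).
Let F p := porbit (face M) (odart L p).

Lemma word_le p : p.1 <= L -> (cw_word w p).1 <= L.
Proof. by rewrite -sw => /(cw_word_lab w0 w0')[]. Qed.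

Lemma word_cwE p : p.1 <= L -> cw M (odart L p) = odart L (cw_word w p).
Proof.
move=> pL; rewrite perm_ofE ?odartK // => d d' /(congr1 (@ndart L)).
by rewrite !odartK ?word_le ?ndart_le // => /cw_word_inj E;
  rewrite -(ndartK d) -(ndartK d') E // sw ndart_le.
Qed.

Lemma word_faceE p : p.1 <= L -> face M (odart L p) = odart L (cw_word w (p.1, ~~ p.2)).
Proof. by move=> pL; rewrite /face permM [oppd_perm _ _]permE -word_cwE. Qed.

Lemma orb_cw p : p.1 <= L -> O (cw_word w p) = O p.
Proof. by move=> pL; rewrite /O -word_cwE // porbit_next. Qed.

Lemma fac_cw p : p.1 <= L -> F (cw_word w (p.1, ~~ p.2)) = F p.
Proof. by move=> pL; rewrite /F -word_faceE // porbit_next. Qed.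

Lemma orb_tail e f : e <= f <= L -> tl w e = tl w f -> O (e, false) = O (f, false).
Proof.
have [k] := ubnP (f - e); elim: k e => // k IH e fek ef E.
have [->//|ne] := eqVneq e f; have eL : e <= size w by lia.
case: (cw_outP w0 eL) => [[g [Eg gb tg ng]]|[_ ng]]; last by have := ng f;
  rewrite E eqxx; lia.
have gf : g <= f by case: (leqP g f) => // lt; have := ng f; rewrite E eqxx; lia.
by rewrite -(IH g) ?tg // -?(@orb_cw (e, false)) ?cw_word_out //= ?Eg //; lia.
Qed.

Lemma orb_head e f : f <= e <= L -> hd w e = hd w f -> O (e, true) = O (f, true).
Proof.
have [k] := ubnP (e - f); elim: k e => // k IH e fek ef E.
have [->//|ne] := eqVneq e f; have eL : e <= size w by lia.
case: (cw_inP w0' eL) => [[g [Eg gb tg ng]]|[_ ng]]; last by have := ng f;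
  rewrite E eqxx; lia.
have gf : f <= g by case: (leqP f g) => // lt; have := ng f; rewrite E eqxx; lia.
by rewrite -(IH g) ?tg // -?(@orb_cw (e, true)) ?Eg //=; lia.
Qed.

Lemma orb_tail_head e : e <= L -> 0 < tl w e -> O (e, false) = O ((tl w e).-1, true).
Proof.
have [k] := ubnP (L - e); elim: k e => // k IH e Lek eL a0.
rewrite -sw in eL; case: (cw_outP w0 eL) => [[g [Eg gb tg ng]]|[Eg ng]]; rewrite sw in eL.
  by rewrite -tg -IH ?tg // -?(@orb_cw (e, false)) ?cw_word_out //= ?Eg //; lia.
by rewrite -orb_cw //= cw_word_out //= Eg; case: eqP a0 => // ->.
Qed.

(** Labels are invariant under the rotation by [cw_word_lab]. Conversely, the rotation moves from
    each edge to the next one with the same label, hence runs through all outgoing edges and then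
    all incoming ones. *)
Lemma orb_lab p q : p.1 <= L -> q.1 <= L -> (O p == O q) = (lab w p == lab w q).
Proof.
move=> pL qL; apply/eqP/eqP => [E|].
  have /(porbit_inv (f := fun d =>
    lab w (ndart d))) : odart L p \in O q by rewrite -E porbit_id.
  rewrite !odartK //; apply => z; rewrite -{1}(ndartK z) word_cwE ?ndart_le //.
  rewrite odartK ?word_le ?ndart_le //.
  by have [] := @cw_word_lab w (ndart z) w0 w0'; rewrite ?sw ?ndart_le.
have mix e f : e <= L -> f <= L -> tl w e = hd w f -> O (e, false) = O (f, true).
  move=> eL fL E; have fL' : f <= size w by lia.
  have hf := hd_gt fL'; have a0 : 0 < tl w e by lia.
  have eL' : e <= size w by lia.
  rewrite orb_tail_head //; have := tl_le w e => le.
  by case: (leqP f (tl w e).-1) => lt; [|apply/esym]; apply: orb_head;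
    rewrite ?hd_tl //; lia.
case: p q pL qL => [e [|]] [f [|]] /= eL fL E.
- by case: (leqP e f) => lt; [apply/esym|]; apply: orb_head => //; lia.
- by apply/esym/mix.
- exact: mix.
- by case: (leqP e f) => lt; [|apply/esym]; apply: orb_tail => //; lia.
Qed.

Lemma orb_uniq p q : p.1 <= L -> q.1 <= L -> O p = O q -> lab w p = lab w q.
Proof. by move=> pL qL /eqP; rewrite orb_lab // => /eqP. Qed.

(* Representatives of the vertices and of the faces.  Up to the north pole and
   the outer face they split the edges, which gives Euler's formula. *)
Definition vrep : {set dart L.+1} :=
  odart L (L, true) |: [set odart L (val e, false) | e : 'I_L.+1 & tl w e == e].
Definition frep : {set dart L.+1} :=
  odart L (0, false) |: [set odart L (val e, false) | e : 'I_L.+1 & tl w e != e].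

Lemma card_reps : #|vrep| + #|frep| = L.+3.
Proof.
have inj : injective (fun e : 'I_L.+1 => odart L (val e, false)).
  by move=> e f []; rewrite !inord_val.
rewrite !cardsU1 !card_imset //.
have -> : odart L (L, true) \notin [set odart L (val e,
  false) | e : 'I_L.+1 & tl w e == e].
  by apply/imsetP => -[e _ []].
have -> : odart L (0, false) \notin [set odart L (val e,
  false) | e : 'I_L.+1 & tl w e != e].
  apply/imsetP => -[e]; rewrite inE => te [] /(congr1 (@nat_of_ord _)).
  rewrite !inordK // => e0; move/negP: te; apply; rewrite -e0.
  by have := tl_le w 0; rewrite leqn0.
have := cardsC [set e : 'I_L.+1 | tl w e == e]; rewrite card_ord.
rewrite (_ : ~: _ = [set e : 'I_L.+1 | tl w e != e]); first by rewrite !cardsE; lia.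
by apply/setP => e; rewrite !inE.
Qed.

Lemma vrep_inj : {in vrep &, injective (porbit (cw M))}.
Proof.
suff H p q : odart L p \in vrep -> odart L q \in vrep -> p.1 <= L -> q.1 <= L -> O p =
  O q -> odart L p = odart L q.
  by move=> d d' h h' E; rewrite -(ndartK d) -(ndartK d'); apply: H;
    rewrite ?ndartK ?ndart_le // /O !ndartK.
have labr p' : p'.1 <= L -> odart L p' \in vrep -> (p' = (L,
  true)) \/ [/\ p'.2 = false & lab w p' = p'.1].
  move=> pL; rewrite !inE => /orP[/eqP E|/imsetP[e]].
    by left; rewrite -(odartK pL) E odartK.
  rewrite inE => /eqP te E; right; rewrite -(odartK pL) E odartK /= /lab /=;
    last by rewrite -ltnS.
  by split.
have labN : lab w (L, true) = L.+1 by rewrite /lab /=; have := @hd_gt w L; lia.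
move=> hp hq pL qL /orb_uniq-/(_ pL qL) E; congr odart.
have [Ep|[p2 Ep]] := labr _ pL hp; have [Eq|[q2 Eq]] := labr _ qL hq.
- by rewrite Ep Eq.
- by move: E; rewrite Ep labN Eq; lia.
- by move: E; rewrite Eq labN Ep; lia.
by move: E p2 q2; rewrite Ep Eq; case: (p) (q) => [? ?] [? ?] /= -> -> ->.
Qed.

Lemma vrep_cover d : exists2 r, r \in vrep & porbit (cw M) d = porbit (cw M) r.
Proof.
rewrite -(ndartK d); have := ndart_le d; move: (ndart d) => p pL {d}.
have : lab w p <= L.+1 by rewrite -sw lab_le ?sw.
rewrite leq_eqVlt => /orP[/eqP E|lt].
  exists (odart L (L, true)); first by rewrite !inE eqxx.
  apply/eqP; rewrite [_ == _](@orb_lab p (L, true)) // E /lab /=.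
  by have := @hd_gt w L; lia.
have tE : tl w (lab w p) = lab w p.
  rewrite ltnS in lt; case: p pL lt => e [|] /= eL; rewrite /lab /= => lt.
    by apply: tl_hd; rewrite sw.
  by apply: tl_idem; rewrite sw.
exists (odart L (lab w p, false)).
  rewrite !inE; apply/orP; right; apply/imsetP; exists (Ordinal lt) => //.
  by rewrite inE /= tE.
by apply/eqP; rewrite [_ == _](@orb_lab p (lab w p, false)) // eq_sym /lab /= tE.
Qed.

Lemma word_vertices : vertices M = [set porbit (cw M) r | r in vrep].
Proof.
apply/setP => v; apply/imsetP/imsetP => [[d _ ->]|[r _ ->]]; last by exists r.
by have [r rr ->] := vrep_cover d; exists r.
Qed.

Lemma word_indeg p : p.1 <= L -> indeg M (O p) = #|[set e : 'I_L.+1 | hd w e == lab w p]|.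
Proof.
move=> pL; rewrite /indeg; apply: eq_card => e; rewrite !inE.
have eL : (e : nat) <= L by rewrite -ltnS.
by rewrite /edge_head -[RHS](@orb_lab (val e, true) p) // /O /odart /= inord_val.
Qed.

Lemma word_outdeg p : p.1 <= L -> outdeg M (O p) = #|[set e : 'I_L.+1 | tl w e == lab w
  p]|.
Proof.
move=> pL; rewrite /outdeg; apply: eq_card => e; rewrite !inE.
have eL : (e : nat) <= L by rewrite -ltnS.
by rewrite /edge_tail -[RHS](@orb_lab (val e, false) p) // /O /odart /= inord_val.
Qed.

End WordMap.

(** * Faces of the map of a word, and planarity *)

Lemma findex_iter_first (T : finType) (f : T -> T) x y k :
  iter k f x = y -> (forall i, i < k -> iter i f x != y) -> findex f x y = k.
Proof.
move=> E nE; have c : fconnect f x y by rewrite -E fconnect_iter.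
have lt := findex_max c; have Ei := iter_findex c.
case: (ltngtP (findex f x y) k) => // [/nE|lk]; first by rewrite Ei eqxx.
by rewrite -E findex_iter //; apply: ltn_trans lk lt.
Qed.

Lemma porbit_cycle3 (T : finType) (s : {perm T}) x : s (s (s x)) = x ->
  porbit s x = [set x; s x; s (s x)].
Proof.
move=> E; apply/setP => y; rewrite !inE; apply/idP/idP.
  move=> /porbitP[i ->]; elim: i => [|i]; first by rewrite expg0 perm1 eqxx.
  rewrite expgSr permM => /orP[/orP[]|] /eqP ->; by rewrite ?E eqxx ?orbT.
have h1 : s x \in porbit s x by rewrite -(porbit_next s x) porbit_id.
have h2 : s (s x) \in porbit s x
  by rewrite -(porbit_next s x) -(porbit_next s (s x)) porbit_id.
by move=> /orP[/orP[]|] /eqP ->; rewrite ?porbit_id.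
Qed.

Lemma tl_fixN w t : t < size w -> (tl w t.+1 != t.+1) = (nth None w t != None).
Proof. by move=> tw; rewrite tl_fix. Qed.

Section WordFaces.
Variables (L m n : nat) (w : seq letter).
Hypotheses (sw : size w = L) (aw : admissible m n w).

Let w0 : nonneg w. Proof. by case: aw. Qed.
Let w0' : nonneg (rs w). Proof. by case: aw. Qed.
Let M := word_map L w.
Let F p := porbit (face M) (odart L p).
Let faceE := word_faceE sw aw.
Let cwE := word_cwE sw aw.

Definition nonrep (p : nat * bool) : bool :=
  (p.1 <= L) && (p.2 || (0 < p.1) && (tl w p.1 == p.1)).

Lemma nonrepP p : nonrep p -> odart L p \notin frep L w.
Proof.
case: p => e [] /andP[/= eL H]; apply/negP; rewrite !inE.
  by case/orP=> [/eqP[]|/imsetP[f _ []]].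
case/andP: H => e0 te; case/orP => [/eqP []|/imsetP[f]].
  by move/(congr1 (@nat_of_ord _)); rewrite !inordK //; lia.
rewrite inE => /negP tf [] /(congr1 (@nat_of_ord _)); rewrite !inordK // => ef.
by apply: tf; rewrite -ef.
Qed.

(** This is the triangle crossed by the step leading to time [e]. Its two other darts are not
    representatives, so that distinct representatives lie in distinct faces. *)
Lemma word_triangle e : e <= L -> tl w e != e ->
  exists p q, [/\ nonrep p, nonrep q & p != q] /\
   [/\ face M (odart L (e, false)) = odart L p,
    face M (odart L p) = odart L q & face M (odart L q) = odart L (e, false)].
Proof.
move=> eL te; have e0 : 0 < e by case: e te {eL} => //; have := tl_le w 0; lia.
case: e e0 eL te => // t _ tL te; have tw : t < size w by rewrite sw.
rewrite tl_fixN // in te; case E : (nth None w t) te => [[|]|] // _.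
  have [k [kb ak c1 c2]] := flat_in w0' tw E; have c3 := flat_out w0 tw E.
  exists (k, false), (t, true); rewrite /nonrep /= !faceE /= ?c1 ?c2 ?c3; try lia.
  have kw : k.-1 < size w by lia.
  have := tl_fix kw; rewrite ak prednK ?eqxx => [->|]; last lia.
  by rewrite xpair_eqE andbF; split; split=> //; lia.
have [g [gb ag c1 c2]] := down_out w0 tw E; have c3 := down_in w0' tw E.
exists (t, true), (g, true); rewrite /nonrep /= !faceE /= ?c1 ?c2 ?c3; try lia.
by split; split=> //; try lia; apply/eqP => -[]; lia.
Qed.

Lemma fac_tail e : e <= L -> exists2 r, r \in frep L w & F (e, false) = porbit (face M) r.
Proof.
have [k] := ubnP e; elim: k e => // k IH e ek eL.
have [te|te] := eqVneq (tl w e) e; last first.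
  exists (odart L (e, false)) => //; rewrite !inE; apply/orP; right.
  by apply/imsetP; exists (Ordinal (eL : e < L.+1)) => //; rewrite inE.
have [->|e0] := posnP e; first by exists (odart L (0, false)); rewrite // !inE eqxx.
(* The edge [e] is the westmost one leaving the vertex it creates, so the preceding dart is the head
   of some [h] with [hd w h = e]. The same face then contains the tail of [h], and [h < e] allows
   the induction. *)
pose d := (cw M)^-1%g (odart L (e, false)).
have Ed : cw_word w (ndart d) = (e, false).
  by rewrite -(@odartK L (e,
    false)) // -(@odartK L (cw_word w _)) ?(word_le sw aw) ?ndart_le // -cwE ?ndart_le
    // ndartK permKV.
have := ndart_le d; move: (ndart d) Ed => [h b] Ed /= hL.
have hw : h <= size w by rewrite sw.
have [_ l] := @cw_word_lab w (h, b) w0 w0' hw; rewrite Ed {1}/lab /= te in l.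
case: b Ed l; rewrite /lab /= => Ed l.
  have := hd_gt hw => hb; have [||r rr Er] := IH h; try lia.
  by exists r => //; rewrite -Er /F -(fac_cw sw aw (p := (h, false))) //= Ed.
rewrite cw_word_out //= in Ed; have := tl_le w h.
case: (cw_outP w0 hw) => [[f [Ef fb tf nf]]|[Ef nf]]; rewrite Ed in Ef.
  by case: Ef => Ef; rewrite -Ef in tf fb; lia.
by case: eqP Ef => // _ [] E; lia.
Qed.

Lemma fac_head e : e <= L -> exists2 r, r \in frep L w & F (e, true) = porbit (face M) r.
Proof.
have [k] := ubnP e; elim: k e => // k IH e ek eL.
have ew : e <= size w by rewrite sw.
have := fac_cw sw aw (p := (e, true)) eL; rewrite -/F /= cw_word_out //= /F => <-.
have le := tl_le w e.
case: (cw_outP w0 ew) => [[f [-> fb tf nf]]|[-> nf]]; first by apply: fac_tail; lia.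
case: eqP => [_|t0]; first exact: fac_tail.
by apply: IH; lia.
Qed.

Lemma fac_cover d : exists2 r, r \in frep L w & porbit (face M) d = porbit (face M) r.
Proof.
rewrite -(ndartK d); have := ndart_le d.
by case: (ndart d) => e [] /=; [apply: fac_head|apply: fac_tail].
Qed.

Lemma frepP r : r \in frep L w -> r = odart L (0, false) \/
  exists e, [/\ e <= L, tl w e != e & r = odart L (e, false)].
Proof.
rewrite !inE => /orP[/eqP ->|/imsetP[e]]; first by left.
by rewrite inE => te ->; right; exists (val e); split=> //; apply: (ltn_ord e).
Qed.

Lemma fac_tri r : r \in frep L w -> r != odart L (0, false) ->
  #|porbit (face M) r| = 3 /\ forall r',
    r' \in frep L w -> r' \in porbit (face M) r -> r' = r.
Proof.
move=> /frepP[->|[e [eL te ->]]] ne; first by rewrite eqxx in ne.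
have [p [q [[np nq pq] [f1 f2 f3]]]] := word_triangle eL te.
have rE : odart L (e, false) \in frep L w.
  rewrite !inE; apply/orP; right; apply/imsetP; exists (Ordinal (eL : e < L.+1)) => //.
  by rewrite inE.
have hp := nonrepP np; have hq := nonrepP nq.
have neq x : x \notin frep L w -> (odart L (e, false) == x) = false.
  by move=> hx; apply/eqP => E; rewrite -E rE in hx.
rewrite porbit_cycle3 f1 f2 ?f3 //; split.
  rewrite -setUA cardsU1 cards2 !inE !neq //.
  have -> // : odart L p != odart L q.
  have [pL _] := andP np; have [qL _] := andP nq.
  apply/negP => /eqP /(congr1 (@ndart L)); rewrite !odartK //.
  by move=> E; rewrite E eqxx in pq.
move=> r' hr'; rewrite !inE => /orP[/orP[]|] /eqP E //;
  rewrite E ?(negPf hp) ?(negPf hq) // in hr'.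
Qed.

Lemma frep_inj : {in frep L w &, injective (porbit (face M))}.
Proof.
move=> r r' hr hr' E.
have [E0|ne] := eqVneq r (odart L (0, false)).
  have [E0'|ne'] := eqVneq r' (odart L (0, false)); first by rewrite E0 E0'.
  by have [_ H] := fac_tri hr' ne'; apply: H => //; rewrite -E porbit_id.
by have [_ H] := fac_tri hr ne; apply/esym/H; rewrite // E porbit_id.
Qed.

Lemma word_faces : porbits (face M) = [set porbit (face M) r | r in frep L w].
Proof.
apply/setP => v; apply/imsetP/imsetP => [[d _ ->]|[r _ ->]]; last by exists r.
by have [r rr ->] := fac_cover d; exists r.
Qed.

Lemma word_planar : planar M.
Proof.
rewrite /planar (word_vertices sw aw) word_faces !card_in_imset;
  first by rewrite card_reps // addn2.
  exact: frep_inj.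
exact: (vrep_inj sw aw).
Qed.

Lemma word_triangulated : triangulated M.
Proof.
apply/forallP => f; apply/implyP => hf; apply/implyP.
rewrite word_faces in hf; case/imsetP: hf => r hr -> ne.
have [E|ne'] := eqVneq r (odart L (0, false)); last by rewrite (fac_tri hr ne').1.
by rewrite E /outer_face eqxx in ne.
Qed.
End WordFaces.

(** * Boundary lengths, connectedness and orientation of the map of a word *)

Definition face_word (w : seq letter) (p : nat * bool) : nat * bool :=
  cw_word w (p.1, ~~ p.2).

Lemma X_size w : X w (size w) = height w. Proof. by rewrite /X take_size. Qed.

(** After [i] steps the boundary walk is at the time of the last visit to the abscissa [n - i]. That
    edge is the last one leaving its tail, so the walk continues with the eastmost edge entering
    this tail, one level lower. *)
Lemma east_path w n i : nonneg w -> height w = Posz n -> i <= n ->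
  exists c, [/\ iter i (face_word w) (size w, true) = (c, true), c <= size w,
    X w c = Posz (n - i) & forall t, c < t <= size w -> (X w c < X w t)%R].
Proof.
move=> w0 hn; elim: i => [|i IH] iln.
  exists (size w); rewrite leqnn X_size hn subn0; split=> // t tb; lia.
have [c [E cw Xc rec]] := IH (ltnW iln).
have [a1 a2 a3] := tlP w c.
have t0 : tl w c != 0 by rewrite tl_eq0 // Xc; lia.
have gw : (tl w c).-1 < size w by lia.
have al := tl_up cw (_ : 0 < tl w c); rewrite lt0n t0 in al.
have Xg := X_up gw (al isT); rewrite prednK ?lt0n // tl_val ?lt0n // in Xg.
exists (tl w c).-1; split; first 1 last.
- by lia.
- by lia.
- move=> t tb; have [->|ne] := eqVneq t c; first lia.
  by case: (ltnP t c) => tc; [have := a2 t|have := rec t]; lia.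
rewrite iterS E /face_word /= cw_word_out //=.
case: (cw_outP w0 cw) => [[f [_ fb tf _]]|[-> _]]; last by rewrite (negPf t0).
have cf : c <= f <= size w by lia.
by have [] := tl_eq_val w0 cf (esym tf); have := rec f; lia.
Qed.

Lemma east_path_end w n : nonneg w -> height w = Posz n ->
  iter n.+1 (face_word w) (size w, true) = (0, false).
Proof.
move=> w0 hn; have [c [E cw Xc rec]] := east_path w0 hn (leqnn n).
rewrite subnn in Xc; rewrite iterS E /face_word /= cw_word_out //=.
have t0 : tl w c == 0 by rewrite tl_eq0 // Xc.
case: (cw_outP w0 cw) => [[f [_ fb tf _]]|[-> _]]; last by rewrite t0.
have cf : c <= f <= size w by lia.
by have [] := tl_eq_val w0 cf (esym tf); have := rec f; lia.
Qed.

Lemma face_word_le w p : nonneg w -> nonneg (rs w) -> p.1 <= size w -> (face_word w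
  p).1 <= size w.
Proof. by move=> w0 w0' pw; have [] := @cw_word_lab w (p.1, ~~ p.2) w0 w0' pw. Qed.

(** The half-turn exchanges the two boundaries, so the western length of [w] is the eastern length
    of [rs w]. *)
Lemma iter_face_word_turn w p i : nonneg w -> nonneg (rs w) -> p.1 <= size w ->
  iter i (face_word w) p = turn (size w) (iter i (face_word (rs w)) (turn (size w) p)) /\
  (iter i (face_word w) p).1 <= size w.
Proof.
move=> w0 w0' pw; elim: i => [|i [IH1 IH2]]; first by rewrite /= turnK.
rewrite !iterS; split; last exact: face_word_le.
set q := iter i (face_word w) p in IH1 IH2 *.
rewrite /face_word cw_word_rs //; congr (turn _ (cw_word _ _)).
have -> : iter i (face_word (rs w)) (turn (size w) p) = turn (size w) q.
  rewrite IH1 turnK //; elim: i {IH1 IH2 q} => [|i IH]; first exact: leq_subr.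
  rewrite iterS -[X in _ <= X]size_rs; apply: face_word_le; rewrite ?rsK ?size_rs //.
by [].
Qed.

Section WordTriangulation.
Variables (L m n : nat) (w : seq letter).
Hypotheses (sw : size w = L) (aw : admissible m n w).

Let w0 : nonneg w. Proof. by case: aw. Qed.
Let w0' : nonneg (rs w). Proof. by case: aw. Qed.
Let M := word_map L w.
Let O p := porbit (cw M) (odart L p).

Lemma iter_faceE p i : p.1 <= L -> iter i (face M) (odart L p) = odart L (iter i
  (face_word w) p).
Proof.
move=> pL; elim: i => // i IH; rewrite !iterS IH (word_faceE sw aw) //.
by rewrite -sw; apply: (iter_face_word_turn i w0 w0' _).2; rewrite sw.
Qed.

Lemma word_east : east_length M = n.+1.
Proof.
have hn : height w = Posz n by case: aw.
have LE : (L, true) = (size w, true) by rewrite sw.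
apply: findex_iter_first => [|i iln]; rewrite iter_faceE // LE.
  by rewrite east_path_end.
by have [c [-> _ _ _]] := east_path w0 hn (iln : i <= n); apply/eqP => -[].
Qed.

Lemma word_west : west_length M = m.+1.
Proof.
have hm : height (rs w) = Posz m by case: aw.
have E i : iter i (face_word w) (0,
  false) = turn L (iter i (face_word (rs w)) (size (rs w), true)).
  by have [-> _] := @iter_face_word_turn w (0, false) i w0 w0' isT;
    rewrite /turn sw size_rs sw subn0.
apply: findex_iter_first => [|i iln]; rewrite iter_faceE // E.
  by rewrite east_path_end // /turn subn0.
by have [c [-> _ _ _]] := east_path w0' hm (iln : i <= m); apply/eqP => -[].
Qed.

Lemma word_outer : north M \in outer_face M.
Proof.
rewrite /outer_face -[north M](@iter_findex _ (face M) (south M)) //; last first.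
  have := word_west; rewrite /west_length.
  have hm : height (rs w) = Posz m by case: aw.
  have := @iter_face_word_turn w (0, false) m.+1 w0 w0' isT.
  rewrite (_ : turn (size w) (0, false) = (size (rs w), true));
    last by rewrite /turn size_rs subn0.
  rewrite east_path_end // => -[E _] _.
  have <- : iter m.+1 (face M) (south M) = north M.
    by rewrite iter_faceE // E /turn subn0 sw.
  exact: fconnect_iter.
by elim: (findex _ _ _) => [|k IH];
  rewrite ?porbit_id // iterS -(eqP (_ : porbit (face M) (iter k (face M) (south M)) ==
  porbit (face M) (south M))) ?eq_porbit_mem // -porbit_next porbit_id.
Qed.

Let R : rel (dart L.+1) := [rel x y | (y == cw M x) || (y == oppd x)].

Lemma orbit_connect x y : porbit (cw M) x = porbit (cw M) y -> connect R x y.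
Proof.
move=> E; have : y \in porbit (cw M) x by rewrite E porbit_id.
case/porbitP=> i ->; elim: i => [|i IH]; first by rewrite expg0 perm1 connect0.
by apply: connect_trans IH _; apply: connect1; rewrite expgSr permM; apply/orP; left;
  apply: eqxx.
Qed.

Lemma word_connected : connected_map M.
Proof.
suff H d : connect R d (south M) && connect R (south M) d.
  apply/forallP => d; apply/forallP => d'.
  by apply: (connect_trans (proj1 (andP (H d))) (proj2 (andP (H d')))).
have opp x : connect R x (oppd x) by apply: connect1; apply/orP; right; apply: eqxx.
have T e : e <= L -> connect R (odart L (e,
  false)) (south M) && connect R (south M) (odart L (e, false)).
  have [k] := ubnP e; elim: k e => // k IH e ek eL.
  have [t0|t0] := posnP (tl w e).
    have E : O (e, false) = O (0, false).
      apply/eqP; rewrite [_ == _](orb_lab sw aw) // /lab /= t0 eq_sym.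
      by have := tl_le w 0; rewrite leqn0.
    by rewrite !orbit_connect.
  have le := tl_le w e.
  have E := orb_tail_head sw aw eL t0.
  have [||h1 h2] := andP (IH (tl w e).-1 _ _); try lia.
  have h3 : connect R (odart L ((tl w e).-1, false)) (odart L ((tl w e).-1,
    true)) := opp _.
  have h4 : connect R (odart L ((tl w e).-1, true)) (odart L ((tl w e).-1,
    false)) := opp _.
  apply/andP; split.
    exact: connect_trans (orbit_connect E) (connect_trans h4 h1).
  exact: connect_trans h2 (connect_trans h3 (orbit_connect (esym E))).
rewrite -(ndartK d); have := ndart_le d; case: (ndart d) => e [] /= eL; last exact: T.
have [h1 h2] := andP (T e eL); apply/andP; split.
  exact: connect_trans (opp (odart L (e, true))) h1.
exact: connect_trans h2 (opp (odart L (e, false))).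
Qed.

Let Lab (d : dart L.+1) := lab w (ndart d).

Lemma word_orbE x y : (porbit (cw M) x == porbit (cw M) y) = (Lab x == Lab y).
Proof.
by rewrite /Lab -(orb_lab sw aw) ?ndart_le // !ndartK.
Qed.

Lemma Lab_edge (e : 'I_L.+1) : Lab (e, false) < Lab (e, true).
Proof.
have eL : (e : nat) <= size w by rewrite sw -ltnS.
by rewrite /Lab /lab /=; have := tl_le w e; have := hd_gt eL; lia.
Qed.

(** Vertex numbers increase along edges, because [tl w e <= e < hd w e]. *)
Lemma word_acyclic : acyclic M.
Proof.
apply/forallP => e; apply/negP.
suff H u v : connect (adj M) u v -> forall x y,
  u = porbit (cw M) x -> v = porbit (cw M) y -> Lab x <= Lab y.
  by move=> /H /(_ (e, true) (e, false) erefl erefl); rewrite leqNgt Lab_edge.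
case/connectP => p; elim: p u => [|u' p IH] u /=.
  by move=> _ -> x y -> /eqP; rewrite word_orbE => /eqP ->.
move=> /andP[/existsP[f /andP[/eqP ft /eqP fh]] pp] lp x y ux vy.
move: ux; rewrite -ft => /eqP; rewrite word_orbE => /eqP <-.
exact: leq_trans (ltnW (Lab_edge f)) (IH u' pp lp (f, true) y (esym fh) vy).
Qed.

Lemma word_loopless : loopless M.
Proof. by apply/forallP => e; rewrite [_ == _]word_orbE neq_ltn Lab_edge. Qed.

Lemma lab_south : lab w (0, false) = 0.
Proof. by rewrite /lab /=; have := tl_le w 0; rewrite leqn0 => /eqP. Qed.

Lemma lab_north : lab w (L, true) = L.+1.
Proof. by rewrite /lab /=; have := @hd_gt w L; lia. Qed.

Lemma word_bipolar : bipolar M.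
Proof.
rewrite /bipolar word_acyclic; apply/forallP => v; apply/implyP.
case/imsetP=> d _ ->; rewrite -(ndartK d); have := ndart_le d;
  move: (ndart d) => p pL {d}.
rewrite (word_indeg sw aw) // (word_outdeg sw aw) // /southpole /northpole.
rewrite !(orb_lab sw aw) // lab_south lab_north.
have lL : lab w p <= L.+1 by rewrite -sw lab_le ?sw.
apply/andP; split; apply/eqP; apply/idP/idP.
- rewrite cards_eq0 => /eqP E0; apply/negPn/negP => l0.
  have [e eL he] : exists2 e, e <= L & hd w e = lab w p.
    case: p pL l0 {lL E0} => e [] eL; rewrite /lab /= => l0; first by exists e.
    exists (tl w e).-1; rewrite ?hd_tl ?lt0n ?sw //.
    by have := tl_le w e; rewrite /= in eL; lia.
  by have : Ordinal (eL : e < L.+1) \in set0; [rewrite -E0 inE /= he | rewrite inE].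
- move=> /eqP ->; rewrite cards_eq0; apply/eqP/setP => e; rewrite !inE; apply/negbTE.
  have eL : (e : nat) <= size w by rewrite sw -ltnS.
  by have := hd_gt eL; lia.
- rewrite cards_eq0 => /eqP E0; apply/negPn/negP => l0.
  have [e eL he] : exists2 e, e <= L & tl w e = lab w p.
    case: p pL l0 lL {E0} => e [] eL; rewrite /lab /= => l0 lL; last by exists e.
    by exists (hd w e); [lia | apply: tl_hd; rewrite sw //; lia].
  by have : Ordinal (eL : e < L.+1) \in set0; [rewrite -E0 inE /= he | rewrite inE].
- move=> /eqP ->; rewrite cards_eq0; apply/eqP/setP => e; rewrite !inE; apply/negbTE.
  have eL : (e : nat) <= L by rewrite -ltnS.
  by have := tl_le w e; lia.
Qed.

Lemma word_bipolar_triangulation : bipolar_triangulation M m n.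
Proof.
apply/and5P; split; rewrite ?word_west ?word_east //.
- apply/and5P; split;
  [exact: word_connected|exact: (word_planar sw aw)|exact: word_loopless| |exact:
  word_outer].
  by rewrite [_ == _](orb_lab sw aw) // lab_south lab_north.
- exact: word_bipolar.
- exact: (word_triangulated sw aw).
Qed.

Lemma word_card_vertices : #|vertices M| = #|[set e : 'I_L.+1 | tl w e == e]|.+1.
Proof.
rewrite (word_vertices sw aw) card_in_imset; last exact: (vrep_inj sw aw).
have inj : injective (fun e : 'I_L.+1 => odart L (val e, false)).
  by move=> e f []; rewrite !inord_val.
rewrite cardsU1 card_imset //.
have -> : odart L (L, true) \notin [set odart L (val e,
  false) | e : 'I_L.+1 & tl w e == e].
  by apply/imsetP => -[e _ []].
by rewrite cardsE.
Qed.

(** A positive out-degree excludes the north pole, whose number [L.+1] is out of range on the right;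
    it also forces [tl w a = a], so that each [a] counted is the number of one vertex. *)
Lemma word_good_vertices i j : 0 < i -> 0 < j ->
  #|[set v in vertices M | (indeg M v == i) && (outdeg M v == j)]| =
  #|[set a : 'I_L.+1 | (#|[set e : 'I_L.+1 | hd w e == a]| == i) &&
                       (#|[set e : 'I_L.+1 | tl w e == a]| == j)]|.
Proof.
move=> i0 j0; set A := RHS;
  have -> : A = #|[set O (val a, false) | a in [set a : 'I_L.+1 |
   (#|[set e : 'I_L.+1 | hd w e == a]| == i) && (#|[set e : 'I_L.+1 | tl w e == a]| ==
     j)]]|.
  rewrite card_in_imset // => a b; rewrite !inE => /andP[_ ha] /andP[_ hb] E.
  have fix_of (c : 'I_L.+1) : #|[set e : 'I_L.+1 | tl w e == c]| == j -> tl w c = c.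
    move=> /eqP hc; have : 0 < #|[set e : 'I_L.+1 | tl w e == c]| by rewrite hc.
    case/card_gt0P => e; rewrite inE => /eqP <-; apply: tl_idem.
    by rewrite sw -ltnS.
  have [aL bL] : (a : nat) <= L /\ (b : nat) <= L by split; rewrite -ltnS.
  have := orb_uniq sw aw (p := (val a, false)) (q := (val b, false)) aL bL E.
  by rewrite /lab /= !fix_of // => /val_inj.
apply: eq_card => v; rewrite !inE; apply/idP/imsetP.
  case/andP => /imsetP[d _ ->]; rewrite -(ndartK d); have := ndart_le d;
    move: (ndart d) => p pL {d}.
  rewrite (word_indeg sw aw) // (word_outdeg sw aw) // => /andP[hi hj].
  have lL : lab w p < L.+1.
    have : 0 < #|[set e : 'I_L.+1 | tl w e == lab w p]| by rewrite (eqP hj).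
    by case/card_gt0P => e; rewrite inE => /eqP <-;
      apply: leq_ltn_trans (tl_le w e) (ltn_ord e).
  exists (Ordinal lL); rewrite ?inE /= ?hi //.
  have : 0 < #|[set e : 'I_L.+1 | tl w e == lab w p]| by rewrite (eqP hj).
  case/card_gt0P => e; rewrite inE => /eqP te.
  apply/eqP; rewrite [_ == _](orb_lab sw aw) //.
  by change (lab w p == tl w (lab w p)); rewrite -te tl_idem // sw -ltnS.
move=> [a]; rewrite inE => /andP[hi hj] ->.
have aL : (a : nat) <= L by rewrite -ltnS.
have ta : tl w a = a.
  have : 0 < #|[set e : 'I_L.+1 | tl w e == a]| by rewrite (eqP hj).
  by case/card_gt0P => e; rewrite inE => /eqP <-; apply: tl_idem; rewrite sw -ltnS.
rewrite imset_f //= (word_indeg sw aw) // (word_outdeg sw aw) // /lab /= ta.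
by rewrite hi hj.
Qed.

End WordTriangulation.

(** * Bipolar triangulations *)

Section PermColor.
Variables (T : finType) (s : {perm T}).

Lemma card_porbits_sum (P : pred T) :
  \sum_(v in porbits s) #|[set d in v | P d]| = #|[set d | P d]|.
Proof.
rewrite -[RHS]sum1_card (partition_big (porbit s) (mem (porbits s))) /=; last first.
  by move=> d _; apply: imset_f.
apply: eq_bigr => v /imsetP[x _ ->]; rewrite -sum1_card; apply: eq_bigl => d.
by rewrite !inE eq_porbit_mem andbC.
Qed.

Lemma porbit_switch (b : pred T) x y : y \in porbit s x -> b x -> ~~ b y ->
  exists2 z, z \in porbit s x & b z && ~~ b (s z).
Proof.
case/porbitP=> i ->; elim: i => [|i IH] bx; first by rewrite expg0 perm1 bx.
case: (boolP (b ((s ^+ i)%g x))) => [h|h]; last by move=> _; apply: IH.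
rewrite expgSr permM => h'; exists ((s ^+ i)%g x); first exact: mem_porbit.
by rewrite h h'.
Qed.

Lemma porbit_switch2 (b : pred T) x y z : x \in porbit s z -> y \in porbit s z ->
  b x -> ~~ b y -> exists2 t, t \in porbit s z & b t && ~~ b (s t).
Proof.
move=> xz yz; have E : porbit s x = porbit s z by apply/eqP; rewrite eq_porbit_mem.
by rewrite -E in yz *; apply: porbit_switch.
Qed.

Lemma porbit_not_increasing (r : T -> nat) x :
  (forall y, y \in porbit s x -> r y < r (s y)) -> False.
Proof.
move=> H; have L i : r x + i <= r (iter i s x).
  elim: i => [|i IH]; first by rewrite addn0.
  rewrite iterS addnS; apply: leq_ltn_trans IH _; apply: H.
  by rewrite -permX mem_porbit.
have := L #|porbit s x|; rewrite iter_porbit.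
by have := card_porbit_neq0 s x; lia.
Qed.

End PermColor.

(** * Local structure of a bipolar triangulation *)

Section Good.
Variables (l : nat).

(** What the exploration uses: a rank increasing along edges, one block of incoming and one of
    outgoing edges around a vertex, a single source and sink on the outer face, and triangles
    elsewhere. Unlike Euler's formula these are local statements, easily transported by [flip]. *)
Record good (M : dmap l) : Prop := Good {
  good_rank : exists rk : dart l -> nat,
    (forall d, rk (cw M d) = rk d) /\ (forall e, rk (e, false) < rk (e, true));
  good_south : forall d, d \in southpole M -> d.2 = false;
  good_north : forall d, d \in northpole M -> d.2 = true;
  good_head : forall d, d.2 = false -> d \in southpole M \/
    exists2 d', d' \in porbit (cw M) d & d'.2 = true;
  good_tail : forall d, d.2 = true -> d \in northpole M \/
    exists2 d', d' \in porbit (cw M) d & d'.2 = false;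
  good_switch : forall d d', d' \in porbit (cw M) d -> d.2 = d'.2 ->
    (cw M d).2 = ~~ d.2 -> (cw M d').2 = ~~ d'.2 -> d = d';
  good_min : forall d, d.2 = true -> (face M d).2 = false ->
    face M d \in outer_face M -> face M d = south M;
  good_max : forall d, d.2 = false -> (face M d).2 = true ->
    face M d \in outer_face M -> face M d = north M;
  good_outer : north M \in outer_face M;
  good_triangle : forall d, d \notin outer_face M -> face M (face M (face M d)) = d }.

Lemma faceE (M : dmap l) d : face M d = cw M (oppd d).
Proof. by rewrite permM permE. Qed.

Variables (m n : nat) (M : dmap l).
Hypothesis bt : bipolar_triangulation M m n.

Let rkv (v : {set dart l}) := #|[set u | connect (adj M) u v]|.

(** The rank counts the vertices from which a vertex can be reached; acyclicity makes the inclusion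
    strict along an edge. *)
Lemma bipolar_rank (e : 'I_l) : rkv (edge_tail M e) < rkv (edge_head M e).
Proof.
have /andP[/forallP ac _] : bipolar M by case/and5P: bt.
have a : connect (adj M) (edge_tail M e) (edge_head M e).
  by apply: connect1; apply/existsP; exists e; rewrite !eqxx.
apply: proper_card; apply/properP; split.
  by apply/subsetP => u; rewrite !inE => h; apply: connect_trans h a.
by exists (edge_head M e); rewrite !inE ?connect0 //; apply: ac.
Qed.

Let rk d := rkv (porbit (cw M) d).

Lemma rk_cw d : rk (cw M d) = rk d. Proof. by rewrite /rk porbit_next. Qed.

Lemma rk_edge e : rk (e, false) < rk (e, true). Proof. exact: bipolar_rank. Qed.

Lemma pole_deg v : v \in vertices M ->
  (indeg M v == 0) = (v == southpole M) /\ (outdeg M v == 0) = (v == northpole M).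
Proof.
have /andP[_ /forallP H] : bipolar M by case/and5P: bt.
by move=> vM; have := H v; rewrite vM => /andP[/eqP-> /eqP->].
Qed.

Lemma deg_dart (b : bool) d :
  reflect (exists2 d', d' \in porbit (cw M) d & d'.2 = b)
    ((if b then indeg else outdeg) l M (porbit (cw M) d) != 0).
Proof.
have -> : (if b then indeg else outdeg) l M (porbit (cw M) d) =
    #|[set e | porbit (cw M) (e, b) == porbit (cw M) d]| by case: b.
rewrite cards_eq0; apply: (iffP (set0Pn _)) => [[e]|[[e b'] h /= E]].
  by rewrite inE eq_porbit_mem => h; exists (e, b).
by exists e; rewrite inE eq_porbit_mem -E.
Qed.

Lemma porbit_vertex d : porbit (cw M) d \in vertices M.
Proof. exact: imset_f. Qed.

Lemma card_darts (b : bool) : #|[set d : dart l | d.2 == b]| = l.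
Proof.
rewrite -[RHS]card_ord -(card_imset (f := fun e : 'I_l => (e, b))); last by move=> e f [].
apply: eq_card => -[e b']; rewrite inE /=; apply/eqP/imsetP => [->|[f _ [_ ->]]] //.
by exists e.
Qed.

(** A face whose darts all had the same direction would give a cycle on which the rank is strictly
    monotone. *)
Lemma face_colors d (b : bool) : exists2 d', d' \in porbit (face M) d & d'.2 = b.
Proof.
have [/exists_inP[x xd /eqP xb]|nH] := boolP [exists x in porbit (face M) d, x.2 == b].
  by exists x.
have H d' : d' \in porbit (face M) d -> d'.2 = ~~ b.
  by move=> h; case: (eqVneq d'.2 (~~ b)) => // E; case/negP: nH; apply/exists_inP;
    exists d' => //; move: E; case: d'.2; case: (b).
case: b H {nH} => H.
  exfalso; apply: (@porbit_not_increasing _ (face M) rk d) => -[e b'] /H /= ->.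
  by rewrite faceE rk_cw rk_edge.
pose r (d' : dart l) := \max_(x : dart l) rk x - rk d'.
exfalso; apply: (@porbit_not_increasing _ (face M) r d) => -[e b'] /H /= ->.
rewrite /r faceE rk_cw /=; have := rk_edge e.
have := leq_bigmax (F := rk) (e, true); rewrite /oppd /=.
by move: (rk (e, true)) (rk (e, false)) (\max_x rk x) => a c k; lia.
Qed.

(* There are [l] corners starting at a dart of direction [b].  Every inner vertex
   sees at least one of those where the direction changes, and every face at
   least one of the others; by Euler's formula there are no more. *)
Lemma switch_tight (b : bool) :
  (forall v, v \in vertices M ->
     #|[set d in v | (d.2 == b) && ((cw M d).2 == ~~ b)]|
       = (v \notin [set southpole M; northpole M])) /\
  (forall f, f \in porbits (face M) ->
     #|[set d in f | (d.2 == ~~ b) && ((face M d).2 == b)]| = 1).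
Proof.
have [/and5P[_ /eqP pl _ SN _] _ _ _] : [/\ planar_map M, bipolar M,
  triangulated M & true].
  by case/and5P: bt.
set P := fun d : dart l => (d.2 == b) && ((cw M d).2 == ~~ b).
set Q := fun d : dart l => (d.2 == ~~ b) && ((face M d).2 == b).
(* At a dart of direction [b], either the next dart around the vertex has the other direction, which
   is [P], or it has the same one, and then the opposite dart satisfies [Q]. *)
have PQ : #|[set d | P d]| + #|[set d | Q d]| = l.
  apply: etrans (card_darts b); rewrite -(card_imset [set d | Q d] (inv_inj (@oppdK l))).
  rewrite -cardsUI (_ : _ :&: _ = set0) ?cards0 ?addn0.
    apply: eq_card => d; rewrite !inE /P; apply/orP/idP => [[/andP[]//|]|db].
      by case/imsetP => x; rewrite inE /Q => /andP[/eqP xb _] ->; rewrite /= xb negbK.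
    case: (boolP ((cw M d).2 == b)) => [h|h]; [right|left].
      apply/imsetP; exists (oppd d); rewrite ?oppdK // inE /Q faceE oppdK h andbT /=.
      by rewrite (eqP db).
    by rewrite db /=; case: (cw M d).2 h => [] /=; case: (b).
  apply/setP => d; rewrite !inE /P; apply/negP => /andP[/andP[_ /eqP h]].
  case/imsetP => x; rewrite inE /Q faceE => /andP[_ /eqP h'] E.
  by move: h'; rewrite -E h; case: (b).
have lowP v : v \in vertices M -> (v \notin [set southpole M;
  northpole M]) <= #|[set d in v | P d]| ?= iff
    ((v \notin [set southpole M; northpole M]) == #|[set d in v | P d]| :> nat).
  move=> vM; split=> //; rewrite !inE; have [hs hn] := pole_deg vM.
  rewrite -hs -hn negb_or; case: andP => // -[hi ho]; rewrite card_gt0; apply/set0Pn.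
  case/imsetP: (vM) hi ho => d _ ->.
  move=> /(deg_dart true)[x xd xt] /(deg_dart false)[y yd yf].
  have [z zd] : exists2 z, z \in porbit (cw M) d & (z.2 == b) && ~~ ((cw M z).2 == b).
    by case: (b); [apply: (@porbit_switch2 _ _ _ x y)|apply: (@porbit_switch2 _ _ _ y
      x)]; rewrite ?xt ?yf.
  move=> hz; exists z; rewrite inE zd /P.
  by move: hz; case: z.2; case: (cw M z).2; case: (b).
have lowQ f : f \in porbits (face M) -> 1 <= #|[set d in f | Q d]| ?= iff (1 == #|[set
  d in f | Q d]|).
  case/imsetP=> d _ ->; split=> //; rewrite card_gt0; apply/set0Pn.
  have [x xd xb] := face_colors d (~~ b); have [y yd yb] := face_colors d b.
  have [||z zd hz] := @porbit_switch2 _ (face M) (fun d => d.2 == ~~ b) x y d xd yd.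
  - by rewrite xb eqxx.
  - by rewrite yb; case: (b).
  exists z; rewrite inE zd /Q.
  by move: hz; case: z.2; case: (face M z).2; case: (b).
have sP := leqif_sum lowP; have sQ := leqif_sum lowQ.
rewrite !card_porbits_sum in sP sQ.
have cV : \sum_(v in vertices M) (v \notin [set southpole M;
  northpole M]) + 2 = #|vertices M|.
  rewrite -big_mkcondr /= sum1_card -(cardsID [set southpole M;
    northpole M] (vertices M)) addnC.
  congr (_ + _); last by apply: eq_card => v; rewrite in_setD andbC.
  rewrite (setIidPr _) ?cards2 ?SN //.
  by apply/subsetP => v; rewrite !inE => /orP[] /eqP ->; apply: porbit_vertex.
have cF : \sum_(f in porbits (face M)) 1 = #|porbits (face M)| by rewrite sum1_card.
have [leP eqP'] := sP; have [leQ eqQ'] := sQ.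
(* The lower bounds sum to the number of vertices minus 2 plus the number of faces, which is [l]:
   both sums are tight, hence so is each term, by the equality case of [leqif_sum]. *)
have tight a b' c d V F : a <= c -> b' <= d -> a + 2 = V -> b' = F ->
  V + F = l + 2 -> c + d = l -> a == c /\ b' == d by lia.
have [EP EQ] := tight _ _ _ _ _ _ leP leQ cV cF pl PQ.
rewrite EP in eqP'; rewrite EQ in eqQ'.
by split=> [v /(forall_inP (esym eqP'))/eqP <-|f /(forall_inP (esym eqQ'))/eqP <-].
Qed.

Lemma switch_uniq d d' : d' \in porbit (cw M) d -> d.2 = d'.2 ->
  (cw M d).2 = ~~ d.2 -> (cw M d').2 = ~~ d'.2 -> d = d'.
Proof.
move=> dd' E h h'; have [H _] := switch_tight d.2.
have := H _ (porbit_vertex d); set A := [set _ in _ | _] => cA.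
have : #|A| <= 1 by rewrite cA; case: (_ \notin _).
by move/card_le1_eqP; apply; rewrite inE ?porbit_id ?dd' -?E ?h ?h' -?E !eqxx.
Qed.

Lemma face_switch_uniq d d' : d' \in porbit (face M) d -> d.2 = d'.2 ->
  (face M d).2 = ~~ d.2 -> (face M d').2 = ~~ d'.2 -> d = d'.
Proof.
move=> dd' E h h'; have [_ H] := switch_tight (~~ d.2).
have := H (porbit (face M) d) (imset_f _ isT); set A := [set _ in _ | _] => cA.
have : #|A| <= 1 by rewrite cA.
by move/card_le1_eqP; apply; rewrite inE ?porbit_id ?dd' -?E ?h ?h' -?E ?negbK !eqxx.
Qed.

Lemma bipolar_triangulation_good : good M.
Proof.
have [pm bip tri _] : [/\ planar_map M, bipolar M, triangulated M & true]
  by case/and5P: bt.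
have [_ _ _ SN nO] := and5P pm.
have sd d : d \in southpole M -> d.2 = false.
  move=> dS; case E : d.2 => //.
  have [h _] := pole_deg (porbit_vertex (south M)).
  have : indeg M (southpole M) != 0 by apply/(deg_dart true); exists d.
  by rewrite h eqxx.
have nd d : d \in northpole M -> d.2 = true.
  move=> dS; case E : d.2 => //.
  have [_ h] := pole_deg (porbit_vertex (north M)).
  have : outdeg M (northpole M) != 0 by apply/(deg_dart false); exists d.
  by rewrite h eqxx.
have pre d : face M (oppd ((cw M)^-1%g d)) = d by rewrite faceE oppdK permKV.
have preP d x : d \in porbit (cw M) x -> (cw M)^-1%g d \in porbit (cw M) x.
  by move=> h; rewrite -eq_porbit_mem -porbit_next permKV eq_porbit_mem.
split=> //.
- by exists rk; split; [apply: rk_cw|apply: rk_edge].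
- move=> d d2; have [h _] := pole_deg (porbit_vertex d).
  case: (boolP (d \in southpole M)) => dS; [by left|right].
  by apply/(deg_dart true); rewrite h eq_porbit_mem.
- move=> d d2; have [_ h] := pole_deg (porbit_vertex d).
  case: (boolP (d \in northpole M)) => dS; [by left|right].
  by apply/(deg_dart false); rewrite h eq_porbit_mem.
- exact: switch_uniq.
- move=> d d2 fd fO; rewrite -[RHS]pre; congr (face M _).
  have h := sd _ (preP _ _ (porbit_id (cw M) (south M))).
  apply: face_switch_uniq; rewrite ?pre ?d2 ?fd //= ?h //.
    by rewrite -eq_porbit_mem -porbit_next pre -(porbit_next _ d) eq_porbit_mem
      porbit_sym.
  by rewrite sd ?porbit_id.
- move=> d d2 fd fO; rewrite -[RHS]pre; congr (face M _).
  have h := nd _ (preP _ _ (porbit_id (cw M) (north M))).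
  apply: face_switch_uniq; rewrite ?pre ?d2 ?fd //= ?h //.
    rewrite -eq_porbit_mem -porbit_next pre -(porbit_next _ d).
    by move: nO fO; rewrite -!eq_porbit_mem => /eqP -> /eqP ->.
  by rewrite nd ?porbit_id.
move=> d dO; have /forallP/(_ (porbit (face M) d)) := tri.
rewrite imset_f //= => /implyP H.
have /eqP c3 : #|porbit (face M) d| == 3 by apply: H; rewrite eq_porbit_mem.
by have := iter_porbit (face M) d; rewrite c3.
Qed.

End Good.

(** * The half-turn of a map, and the step relation of the exploration *)

Section Flip.
Variable l : nat.
Implicit Types (M : dmap l) (e f g k : 'I_l).

Definition flip M : dmap l :=
  DMap (oppd_perm l * cw M * oppd_perm l)%g (oppd (north M)) (oppd (south M)).

Lemma cw_flip M d : cw (flip M) d = oppd (cw M (oppd d)).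
Proof. by rewrite /= !permM !permE. Qed.

Lemma face_flip M d : face (flip M) d = oppd (face M (oppd d)).
Proof. by rewrite !faceE cw_flip. Qed.

Lemma porbit_conj (T : finType) (h : T -> T) (s s' : {perm T}) x y :
  involutive h -> (forall z, s' z = h (s (h z))) ->
  (y \in porbit s' x) = (h y \in porbit s (h x)).
Proof.
move=> hK ss'.
have E i z : ((s' ^+ i)%g z) = h ((s ^+ i)%g (h z)).
  elim: i => [|i IH]; first by rewrite !expg0 !perm1 hK.
  by rewrite !expgSr !permM ss' IH hK.
apply/porbitP/porbitP => -[i]; first by move=> ->; exists i; rewrite E hK.
by move=> /(congr1 h); rewrite hK -E => ->; exists i.
Qed.

Lemma orbit_flip M x y : (y \in porbit (cw (flip M)) x) = (oppd y \in porbit (cw M)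
  (oppd x)).
Proof. by apply: porbit_conj => [|z]; [apply: oppdK|rewrite cw_flip]. Qed.

Lemma good_flip M : good M -> good (flip M).
Proof.
case=> -[rk [rk1 rk2]] gs gn gh gt gsw gmin gmax go gtri.
have out d : (d \in outer_face (flip M)) = (oppd d \in outer_face M).
  rewrite /outer_face (@porbit_conj _ (@oppd l) (face M)); last exact: face_flip.
    by rewrite oppdK -!eq_porbit_mem; move: go; rewrite -eq_porbit_mem => /eqP->.
  exact: oppdK.
have opp2 (d : dart l) : (oppd d).2 = ~~ d.2 by [].
split.
- exists (fun d => \max_x rk x - rk (oppd d)); split=> [d|e].
    by rewrite cw_flip oppdK rk1.
  have := rk2 e; have := leq_bigmax (F := rk) (e, true); rewrite /oppd /=.
  by move: (rk (e, true)) (rk (e, false)) (\max_x rk x) => a c k; lia.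
- by move=> d; rewrite /southpole orbit_flip oppdK => /gn /=; case: d.2.
- by move=> d; rewrite /northpole orbit_flip oppdK => /gs /=; case: d.2.
- move=> d d2; rewrite /southpole orbit_flip oppdK.
  have [|h|[d' h1 h2]] := gt (oppd d); rewrite ?opp2 ?d2 //; first by left.
  by right; exists (oppd d'); rewrite ?orbit_flip ?oppdK //= h2.
- move=> d d2; rewrite /northpole orbit_flip oppdK.
  have [|h|[d' h1 h2]] := gh (oppd d); rewrite ?opp2 ?d2 //; first by left.
  by right; exists (oppd d'); rewrite ?orbit_flip ?oppdK //= h2.
- move=> d d'; rewrite orbit_flip !cw_flip !opp2 => dd' E /negb_inj h /negb_inj h'.
  apply: (inv_inj (@oppdK l)); apply: gsw; rewrite ?opp2 ?E ?negbK //.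
    by rewrite h E.
- move=> d; rewrite out face_flip opp2 oppdK => h1 /negbFE h2 h3.
  by rewrite gmax // opp2 h1.
- move=> d; rewrite out face_flip opp2 oppdK => h1 /negbTE h2 h3.
  by rewrite gmin // opp2 h1.
- by rewrite out oppdK porbit_id.
by move=> d; rewrite out => /gtri E; rewrite !face_flip !oppdK E oppdK.
Qed.

(** For [None], [e] is the eastmost edge entering its head and [f] the westmost one leaving it.
    Otherwise the three rotations describe the triangle to the right of [e], where [f] shares the
    tail of [e] for [Some true] and its head for [Some false]; the inequalities exclude the corners
    containing the boundary circle. *)
Definition step M e (c : letter) f : Prop :=
  match c with
  | None => [/\ exists h, cw M (h, false) = (e, true),
      exists h, cw M (h, true) = (f, false) & (f, false) \in porbit (cw M) (e, true)]
  | Some true => [/\ (f, false) <> south M, (e, true) <> north M & exists k,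
      [/\ cw M (e, false) = (f, false), cw M (f, true) = (k, false)
        & cw M (k, true) = (e, true)]]
  | Some false => [/\ (f, false) <> south M, (e, true) <> north M & exists g,
      [/\ cw M (f, true) = (e, true), cw M (e, false) = (g, true)
        & cw M (g, false) = (f, false)]]
  end.

Lemma step_flip M e c f : step M e c f -> step (flip M) f (swap c) e.
Proof.
case: c => [[]|] /= [h1 h2].
- case=> k [h3 h4 h5]; split.
  + by move=> E; apply: h2; apply: (inv_inj (@oppdK l)).
  + by move=> E; apply: h1; apply: (inv_inj (@oppdK l)).
  by exists k; split; rewrite -[LHS]/(cw (flip M) _) cw_flip /oppd /= ?h3 ?h4 ?h5.
- case=> k [h3 h4 h5]; split.
  + by move=> E; apply: h2; apply: (inv_inj (@oppdK l)).
  + by move=> E; apply: h1; apply: (inv_inj (@oppdK l)).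
  by exists k; split; rewrite -[LHS]/(cw (flip M) _) cw_flip /oppd /= ?h3 ?h4 ?h5.
move=> h3; case: h1 => x h1; case: h2 => y h2; split.
- by exists y; rewrite -[LHS]/(cw (flip M) _) cw_flip /oppd /= h2.
- by exists x; rewrite -[LHS]/(cw (flip M) _) cw_flip /oppd /= h1.
by rewrite -[X in _ \in porbit X _]/(cw (flip M)) orbit_flip /oppd /= porbit_sym.
Qed.

(** The dart before [(e, true)] is a tail only for [None]; the two other letters differ in the
    direction of the dart after [(e, false)]. For two up steps, [good_switch] gives a single place
    around the vertex where a head is followed by a tail. *)
Lemma step_fun M e c f c' f' : good M -> step M e c f -> step M e c' f' -> c = c' /\ f
  = f'.
Proof.
move=> gM; have inj d d' : cw M d = cw M d' -> d = d' by apply: perm_inj.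
case: c c' => [[]|] [[]|] //=.
- by move=> [_ _ [k [h1 _ _]]] [_ _ [k' [h1' _ _]]]; move: h1'; rewrite h1 => -[].
- by move=> [_ _ [k [h1 _ _]]] [_ _ [k' [_ h1' _]]]; move: h1'; rewrite h1 => -[].
- by move=> [_ _ [k [_ _ h1]]] [[h h1'] _ _]; move: h1'; rewrite -h1 => /inj [].
- by move=> [_ _ [k [_ h1 _]]] [_ _ [k' [h1' _ _]]]; move: h1'; rewrite h1 => -[].
- by move=> [_ _ [k [h1 _ _]]] [_ _ [k' [h1' _ _]]]; move: h1'; rewrite -h1 => /inj [->].
- by move=> [_ _ [k [h1 _ _]]] [[h h1'] _ _]; move: h1'; rewrite -h1 => /inj [].
- by move=> [[h h1] _ _] [_ _ [k [_ _ h1']]]; move: h1'; rewrite -h1 => /inj [].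
- by move=> [[h h1] _ _] [_ _ [k [h1' _ _]]]; move: h1'; rewrite -h1 => /inj [].
move=> [_ [h h1] o1] [_ [h' h1'] o2]; split=> //.
have E : (h, true) = (h', true).
  apply: (good_switch gM) => //=; rewrite ?h1 ?h1' //.
  rewrite -eq_porbit_mem -porbit_next h1' -(porbit_next _ (h, true)) h1.
  by move: o1 o2; rewrite -!eq_porbit_mem => /eqP -> /eqP ->.
by move: h1; rewrite E h1' => -[].
Qed.

Fixpoint walk M e (v : seq letter) f : Prop :=
  if v is c :: v' then exists2 e', step M e c e' & walk M e' v' f else e = f.

Lemma walk_cat M e u x v f : walk M e u x -> walk M x v f -> walk M e (u ++ v) f.
Proof.
elim: u e => [|c u IH] e /=; first by move=> ->.
by move=> [e' s w] w'; exists e' => //; apply: IH.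
Qed.

Lemma walk1 M e c f : step M e c f -> walk M e [:: c] f.
Proof. by exists f. Qed.

(** Determinism makes two walks with the same start agree as long as both last, and nothing extends
    a walk ending at a terminal edge. Exploring the map thus reduces to reaching each edge
    separately. *)
Lemma walk_prefix M e v f w z : good M -> (forall c x, ~ step M z c x) ->
  walk M e v f -> walk M e w z -> exists2 u, w = v ++ u & walk M f u z.
Proof.
move=> gM tz; elim: v e w => [|c v IH] e w /=; first by move=> <- h; exists w.
case: w => [|c' w] /= [e' s w1]; first by move=> E; rewrite E in s; case: (tz _ _ s).
move=> [e'' s' w2]; have [<- E] := step_fun gM s s'; rewrite -E in w2.
by have [u -> h] := IH _ _ w1 w2; exists u.
Qed.

Lemma north_terminal M c x : good M -> ~ step M (north M).1 c x.
Proof.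
move=> gM; have nE : north M = ((north M).1, true).
  by case E : (north M) (good_north gM (porbit_id (cw M) (north M))) => [a b] /= ->.
case: c => [[]|] /= []; rewrite -?nE //.
move=> [h h1] _ _; suff : (h, false).2 = true by [].
apply: (good_north gM); rewrite /northpole -h1.
by rewrite -eq_porbit_mem porbit_next.
Qed.

Lemma south_tail M : good M -> south M = ((south M).1, false).
Proof.
by move=> gM; case E : (south M) (good_south gM (porbit_id (cw M) (south M))) =>
  [a b] /= ->.
Qed.

End Flip.

(** * Excursions of the abscissa *)

Definition excursion (v : seq letter) : Prop := nonneg v /\ height v = 0%R.
Definition strict_excursion (v : seq letter) : Prop :=
  [/\ v != [::], height v = 0%R & forall t, 0 < t < size v -> (0 < X v t)%R].

Lemma X_cat u v t : X (u ++ v) t = if t <= size u then X u t else (height u + X v (t -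
  size u))%R.
Proof.
rewrite /X take_cat; case: (ltngtP t (size u)) => // [lt|->].
  by rewrite height_cat.
by rewrite subnn take0 cats0 take_size.
Qed.

Lemma X_over v t : size v <= t -> X v t = height v.
Proof. by move=> h; rewrite /X take_oversize. Qed.

Lemma strictW v : strict_excursion v -> excursion v.
Proof.
move=> [_ h0 hs]; split=> // t; have [->|t0] := posnP t; first by rewrite X0.
by case: (leqP (size v) t) => h; [rewrite X_over // h0|rewrite ltW // hs // t0].
Qed.

Lemma excursion_nil : excursion [::].
Proof. by split=> [t|]; rewrite ?X_over /height ?big_nil. Qed.

Lemma nonneg_cat u v : nonneg u -> nonneg v -> nonneg (u ++ v).
Proof.
move=> u0 v0 t; rewrite X_cat; case: ifP => // _.
by have := u0 (size u); have := v0 (t - size u); rewrite (@X_over u) //; lia.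
Qed.

Lemma excursion_cat u v : excursion u -> excursion v -> excursion (u ++ v).
Proof. by move=> [u0 hu] [v0 hv]; split;
  [apply: nonneg_cat | rewrite height_cat hu hv]. Qed.

Lemma strict_excursion_lift v : excursion v -> strict_excursion (None :: rcons v (Some
  false)).
Proof.
move=> [v0 hv]; have -> : None :: rcons v (Some false) = [:: None] ++ v ++ [:: Some
  false].
  by rewrite cats1.
split=> //; first by rewrite !height_cat hv /height !big_seq1.
move=> t tb; have {}tb : 0 < t < (size v).+2 by move: tb; rewrite !size_cat /=; lia.
rewrite X_cat; case: ifP => /= h; first by have -> : t = 1;
  [lia | rewrite (XS (t := 0)) // X0].
rewrite X_cat; case: ifP => /= h'; first by rewrite /height big_seq1 /=;
  have := v0 (t - 1); lia.
lia.
Qed.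

Lemma strict_excursion_flat : strict_excursion [:: Some true].
Proof. by split=> //; [rewrite /height big_seq1 | case=> [|[]]]. Qed.

(** * Exploration of a triangulation *)

Lemma nat_switch (P : pred nat) j i : j <= i -> P j -> ~~ P i ->
  exists p, [/\ j <= p < i, P p & ~~ P p.+1].
Proof.
elim: i => [|i IH] ji Pj nP; first by case/negP: nP; rewrite leqn0 in ji;
  rewrite -(eqP ji).
have ji' : j <= i by move: ji; rewrite leq_eqVlt => /orP[/eqP E|//]; rewrite -E Pj in nP.
case: (boolP (P i)) => [Pi|nPi]; first by exists i; rewrite ji' leqnn.
by have [p [pb Pp nPp]] := IH ji' Pj nPi; exists p; split=> //; lia.
Qed.

Section Explore.
Variables (l : nat) (M : dmap l).
Hypothesis gM : good M.
Implicit Types (e f g o h : 'I_l).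

Let c d := cw M d.

(* Meeting [south M] again would mean crossing the boundary circle. *)
Definition fan (o g : 'I_l) : Prop := exists i,
  [/\ forall j, j <= i -> (iter j c (o, false)).2 = false,
      forall j, 0 < j <= i -> iter j c (o, false) <> south M
    & iter i c (o, false) = (g, false)].

Lemma iter_cw_orbit i d : iter i c d \in porbit (cw M) d.
Proof. by rewrite /c -permX mem_porbit. Qed.

Lemma no_head_south d d' : d' \in porbit (cw M) d -> d'.2 = true -> d \notin southpole M.
Proof.
move=> dd' t; apply/negP; rewrite /southpole -eq_porbit_mem => /eqP E.
by move: dd'; rewrite E => /(good_south gM); rewrite t.
Qed.

(** If the rotation from the westmost outgoing edge [o] meets a head before [e], then by
    [good_switch] it later leaves the heads through [h] and is back at [o]; cutting this turn off
    shortens the path. The south pole is excluded since an edge enters the vertex. *)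
Lemma fan_inner e d : d \in porbit (cw M) (e, false) -> d.2 = true ->
  exists h o, [/\ cw M (h, true) = (o, false), (o, false) \in porbit (cw M) (e,
    false) & fan o e].
Proof.
move=> de dt.
have [[h []] zd /andP[] //= _] := porbit_switch2 (b := fun d =>
  d.2) de (porbit_id _ _) dt isT.
case E : (cw M (h, true)) => [o []] //= _.
have oe : (o, false) \in porbit (cw M) (e, false).
  by rewrite -E -eq_porbit_mem porbit_next eq_porbit_mem.
exists h, o; split=> //.
have /porbitP[i Ei] : (e, false) \in porbit (cw M) (o, false) by rewrite porbit_sym.
rewrite permX in Ei; have [k] := ubnP i; elim: k i Ei => // k IH i Ei ik.
have [tails|nt] := altP (@allP _ (fun j => ~~ (iter j c (o, false)).2) (iota 0 i.+1)).
  exists i; split=> //.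
    by move=> j ji; apply/negbTE/tails; rewrite mem_iota; lia.
  move=> j _ Es; have := no_head_south de dt; case/negP.
  rewrite /southpole -Es -eq_porbit_mem.
  have := iter_cw_orbit j (o, false); rewrite -eq_porbit_mem => /eqP ->.
  by rewrite eq_sym eq_porbit_mem.
have [j ji jt] : exists2 j, j <= i & (iter j c (o, false)).2.
  by case/allPn: nt => j; rewrite mem_iota negbK => jb jt; exists j => //; lia.
have [p [jp pi pt pn]] : exists p, [/\ j <= p, p < i, (iter p c (o,
  false)).2 & ~~ (iter p.+1 c (o, false)).2].
  have ni : ~~ (iter i c (o, false)).2 by rewrite -[iter i c _]/(iter i (cw M) _) -Ei.
  by have [p [/andP[jp pi] pt pn]] := nat_switch (P := fun p =>
    (iter p c (o, false)).2) ji jt ni; exists p.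
have Ep : iter p c (o, false) = (h, true).
  apply/esym/(good_switch gM).
  - rewrite -eq_porbit_mem -[X in _ == X]porbit_next E eq_porbit_mem;
    exact: iter_cw_orbit.
  - by rewrite pt.
  - by rewrite E.
  by rewrite pt; apply/negbTE.
apply: (IH (i - p.+1)); last by lia.
rewrite Ei -{1}(subnK (_ : p.+1 <= i)) // iterD; congr iter.
by rewrite iterS -[iter p _ _]/(iter p c (o, false)) Ep E.
Qed.

Lemma fan_south e : (e, false) \in southpole M -> fan (south M).1 e.
Proof.
move=> eS; have /porbitP[i Ei] := eS; rewrite permX in Ei.
have tails j : (iter j c ((south M).1, false)).2 = false.
  apply: (good_south gM); rewrite -south_tail //; exact: iter_cw_orbit.
rewrite (south_tail gM) in Ei.
have [k] := ubnP i; elim: k i Ei => // k IH i Ei ik.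
case: (boolP (has (fun j => iter j c ((south M).1, false) == south M) (iota 1 i))) =>
  [/hasP[j]|no].
  rewrite mem_iota => jb /eqP Ej; apply: (IH (i - j)); last by lia.
  by rewrite Ei -{1}(subnK (_ : j <= i)) ?iterD -?[iter j _ _]/(iter j c _) ?Ej
    -?south_tail //; lia.
exists i; split=> // j jb E; case/negP: no; apply/hasP; exists j; rewrite ?E //.
by rewrite mem_iota; lia.
Qed.

Definition linked e f := exists2 v, excursion v & walk M e v f.

Lemma fan_linked o g : fan o g ->
  (forall e f, (e, false) \in porbit (cw M) (o, false) -> cw M (e, false) = (f, false) ->
     (f, false) <> south M -> exists2 v, strict_excursion v & walk M e v f) ->
  linked o g.
Proof.
case=> i [h1 h2 h3] H; elim: i g h1 h2 h3 => [|i IH] g h1 h2 /=.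
  by case=> <-; exists [::]; first exact: excursion_nil.
have := h1 i (leqnSn i); case E : (iter i c (o, false)) => [x []] //= _ h3.
have [||v ev wv] := IH x _ _ E.
- by move=> j ji; apply: h1; lia.
- by move=> j ji; apply: h2; lia.
have [||v' ev' wv'] := H x g _ h3.
- by rewrite -E iter_cw_orbit.
- by move=> Es; apply: (h2 i.+1); rewrite ?ltnS ?leqnn //= E h3.
exists (v ++ v'); first by apply: excursion_cat => //; apply: strictW.
exact: walk_cat wv wv'.
Qed.

Lemma step_up e o h h' : cw M (h', false) = (e, true) -> cw M (h, true) = (o, false) ->
  (o, false) \in porbit (cw M) (e, true) -> step M e None o.
Proof. by move=> h1 h2 h3; split=> //; [exists h'|exists h]. Qed.

(* By induction on the head of [e], from the north pole down: in the triangle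
   between [e] and [f], either [f] is explored right after [e], or first all the
   edges leaving the head of [e] are explored, from west to east. *)
Lemma next_out_walk e f : cw M (e, false) = (f, false) -> (f, false) <> south M ->
  exists2 v, strict_excursion v & walk M e v f.
Proof.
have [rk [rk1 rk2]] := good_rank gM.
have rko d d' : d' \in porbit (cw M) d -> rk d' = rk d by apply: porbit_inv.
pose N := \max_d rk d; have leN d : rk d <= N by apply: leq_bigmax.
have [k] := ubnP (N - rk (e, true)); elim: k e f => // k IH e f ek cf fs.
have fE : face M (e, true) = (f, false) by rewrite faceE.
have fO : (f, false) \notin outer_face M.
  by apply/negP => fO; apply: fs; rewrite -fE; apply: (good_min gM); rewrite ?fE.
have orb d : face M d \in outer_face M = (d \in outer_face M).
  by rewrite /outer_face -!eq_porbit_mem porbit_next.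
have nO d : d \notin outer_face M -> d <> north M.
  by move=> h E; rewrite E (good_outer gM) in h.
have E3 : face M (face M (f, false)) = (e, true).
  by apply: (@perm_inj _ (face M)); rewrite (good_triangle gM) ?fE.
have eO : (e, true) \notin outer_face M by rewrite -orb fE.
case Ez : (face M (f, false)) => [g b]; rewrite Ez in E3.
have gO : (g, b) \notin outer_face M by rewrite -orb E3.
rewrite !faceE /oppd /= in Ez E3.
case: b Ez E3 gO => Ez E3 gO; last first.
  exists [:: Some true]; first exact: strict_excursion_flat.
  by apply: walk1; split=> //; [apply: nO | exists g].
have eg : (e, true) \in porbit (cw M) (g, false).
  by rewrite -E3 -eq_porbit_mem porbit_next.
have [h [o [E og fo]]] := fan_inner eg (erefl true).
have oe : (o, false) \in porbit (cw M) (e, true).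
  by move: og eg; rewrite -!eq_porbit_mem => /eqP -> /eqP ->.
have [v ev wv] : linked o g.
  apply: fan_linked fo _ => x y xo; apply: IH.
  have : rk (e, true) < rk (x, true); last by have := leN (x, true); lia.
  by rewrite -(rko _ _ oe) -(rko _ _ xo).
exists (None :: rcons v (Some false)); first exact: strict_excursion_lift.
exists o; first exact: step_up E3 E oe.
rewrite -cats1; apply: walk_cat wv _; apply: walk1; split=> //; first exact: nO.
by exists e.
Qed.

(** By induction on the rank of the tail of [e]: reach the eastmost edge [y] entering this tail, go
    up to the westmost edge leaving it, and follow the fan to [e]. At the south pole the fan alone
    is enough, whence the zero height. *)
Lemma reach e : exists v, [/\ nonneg v, walk M (south M).1 v e &
  (e, false) \in southpole M -> height v = 0%R].
Proof.
have [rk [rk1 rk2]] := good_rank gM.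
have rko d d' : d' \in porbit (cw M) d -> rk d' = rk d by apply: porbit_inv.
have [k] := ubnP (rk (e, false)); elim: k e => // k IH e ek.
have [eS|[d de dt]] := good_head gM (erefl : (e, false).2 = false).
  have [v [v0 hv] wv] := fan_linked (fan_south eS) (fun e f _ => @next_out_walk e f).
  by exists v.
have [h [o [E oe fo]]] := fan_inner de dt.
have ndt : ~~ ~~ d.2 by rewrite dt.
have [[x []] xd /andP[] //= _] := porbit_switch2 (b := fun d =>
  ~~ d.2) (porbit_id _ _) de isT ndt.
case E' : (cw M (x, false)) => [y []] //= _.
have ye : (y, true) \in porbit (cw M) (e, false).
  by rewrite -E' -eq_porbit_mem porbit_next eq_porbit_mem.
have [v [v0 wv _]] : exists v, [/\ nonneg v, walk M (south M).1 v y &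
  (y, false) \in southpole M -> height v = 0%R].
  by apply: IH; have := rk2 y; rewrite (rko _ _ ye); lia.
have [v' [v'0 hv'] wv'] := fan_linked fo (fun e f _ => @next_out_walk e f).
exists (v ++ None :: v'); split.
- apply: nonneg_cat => //; rewrite -cat1s; apply: nonneg_cat => // t.
  by case: t => [|t]; rewrite ?X0 // X_over // /height big_seq1.
- apply: walk_cat wv _; exists o => //; apply: step_up E' E _.
  by move: oe ye; rewrite -!eq_porbit_mem => /eqP -> /eqP ->.
by move=> eS; have := no_head_south de dt; rewrite eS.
Qed.

End Explore.

(** * The word of a triangulation, and the uniqueness of the encoding *)

Record explored l (M : dmap l) (w : seq letter) (g : nat -> 'I_l) : Prop := Explored {
  expl_good : good M;
  expl_south : g 0 = (south M).1;
  expl_north : g (size w) = (north M).1;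
  expl_step : forall t, t < size w -> step M (g t) (nth None w t) (g t.+1);
  expl_surj : forall e, exists2 t, t <= size w & g t = e;
  expl_inj : forall a b, a <= size w -> b <= size w -> g a = g b -> a = b }.

Section Explored.
Variables (l : nat) (M : dmap l).

Lemma walk_trace e v f : walk M e v f -> exists g : nat -> 'I_l,
  [/\ g 0 = e, g (size v) = f & forall t,
    t < size v -> step M (g t) (nth None v t) (g t.+1)].
Proof.
elim: v e => [|c v IH] e /=; first by move=> <-; exists (fun _ => e).
move=> [e' s /IH [g [g0 gs gt]]]; exists (fun t => if t is t'.+1 then g t' else e);
  split=> //.
by case=> [|t] h; [rewrite g0 | apply: gt].
Qed.

Lemma trace_walk (g : nat -> 'I_l) w a : a <= size w ->
  (forall t, t < size w -> step M (g t) (nth None w t) (g t.+1)) ->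
  walk M (g a) (drop a w) (g (size w)).
Proof.
move=> aw st; rewrite -(subKn aw); have : size w - a <= size w by apply: leq_subr.
elim: (size w - a) => [|k IH] kw; first by rewrite subn0 drop_size.
rewrite (drop_nth None); last by lia.
exists (g (size w - k.+1).+1); first by apply: st; lia.
by rewrite (_ : (size w - k.+1).+1 = size w - k); [apply: IH|]; lia.
Qed.

Hypothesis gM : good M.

(** The walk to the north edge extends the walk to any other edge, hence visits every edge. It
    visits none twice, because the current edge determines the rest of the walk and so its
    length. *)
Lemma explore : exists w g, explored M w g.
Proof.
have [w [_ ww _]] := reach gM (north M).1.
have [g [g0 gL gs]] := walk_trace ww.
have nt c x : ~ step M (north M).1 c x by apply: north_terminal.
have gw a : a <= size w -> walk M (g a) (drop a w) (north M).1.
  by move=> aw; rewrite -gL; apply: trace_walk.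
exists w, g; split=> //.
  move=> e; have [v [_ wv _]] := reach gM e.
  have [u E wu] := walk_prefix gM nt wv ww; exists (size v);
    first by rewrite E size_cat leq_addr.
  elim/last_ind: v e wv u E wu => [|v c IH] e; first by move=> /= <-.
  rewrite -cats1; move=> wvc u E wu.
  have [x wx sx] : exists2 x, walk M (south M).1 v x & step M x c e.
    elim: v (south M).1 {IH E wu} wvc => [|c' v IH] s /=; first by case=> x sx <-;
      exists s.
    by case=> s' ss /IH[x wx sx]; exists x => //; exists s'.
  have gx : g (size v) = x.
    apply: (IH x wx (c :: u)); first by rewrite E -catA.
    by exists e.
  have vw : size v < size w by rewrite E !size_cat /=; lia.
  have := gs _ vw; rewrite gx E -catA nth_cat ltnn subnn /=.
  by move=> /(step_fun gM sx) [_ ->]; rewrite size_cat addn1.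
move=> a b aw bw E.
have wlog_ab a' b' : a' <= size w -> b' <= size w -> g a' = g b' -> a' <= b'.
  move=> aw' bw' E'; have := gw _ aw'; rewrite E' => wa.
  have [u] := walk_prefix gM nt (gw _ bw') wa.
  by move/(congr1 size); rewrite size_cat !size_drop; lia.
by apply/eqP; rewrite eqn_leq; apply/andP; split; apply: wlog_ab.
Qed.

Lemma X_drop w a v u i : a <= size w -> drop a w = v ++ u -> i <= size v ->
  X w (a + i) = (X w a + X v i)%R.
Proof.
move=> aw E iv; rewrite -{1}(cat_take_drop a w) E X_cat size_takel //.
case: ifP => h; last by rewrite addKn X_cat iv.
have -> : i = 0 by lia.
by rewrite addn0 X0 addr0 /X -take_min minnn.
Qed.

End Explored.

Section ExploredMap.
Variables (l : nat) (M : dmap l) (w : seq letter) (g : nat -> 'I_l).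
Hypothesis ex : explored M w g.

Let gM : good M := expl_good ex.

(** Any walk starting at an explored edge is a factor of [w], so that the excursions found in the
    map become statements about the abscissas of [w]. *)
Lemma explored_walk a v f : a <= size w -> walk M (g a) v f ->
  exists b u, [/\ b = a + size v, b <= size w, f = g b & drop a w = v ++ u].
Proof.
move=> aw wv; have wd := trace_walk aw (expl_step ex).
rewrite (expl_north ex) in wd.
have [u E wu] := walk_prefix gM (fun c x => @north_terminal _ M c x gM) wv wd.
have sv : a + size v <= size w.
  by have := congr1 size E; rewrite size_drop size_cat; lia.
exists (a + size v), u; split=> //.
have [b bw Eb] := expl_surj ex f.
have wb := trace_walk bw (expl_step ex); rewrite Eb (expl_north ex) in wb.
have nt c x : ~ step M (north M).1 c x by apply: north_terminal.
have [u1 E1 _] := walk_prefix gM nt wb wu; have [u2 E2 _] := walk_prefix gM nt wu wb.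
rewrite -Eb; congr g.
have := congr1 size E1; have := congr1 size E2; have := congr1 size E.
by rewrite !size_cat !size_drop; lia.
Qed.

Lemma explored_excursion a v f : a <= size w -> walk M (g a) v f -> excursion v ->
  exists b, [/\ f = g b, a <= b <= size w, X w b = X w a &
    forall t, a <= t <= b -> (X w a <= X w t)%R].
Proof.
move=> aw wv [v0 hv]; have [b [u [Eb bw fb E]]] := explored_walk aw wv.
exists b; split=> //; first by lia.
  by rewrite Eb (X_drop aw E) // (@X_over v) // hv addr0.
move=> t tb; rewrite -(subnKC (proj1 (andP tb))) (X_drop aw E); last by lia.
by have := v0 (t - a); lia.
Qed.

Lemma explored_strict a v f : a <= size w -> walk M (g a) v f -> strict_excursion v ->
  exists b, [/\ f = g b, a < b <= size w, X w b = X w a &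
    forall t, a < t < b -> (X w a < X w t)%R].
Proof.
move=> aw wv [vn hv vs]; have [b [u [Eb bw fb E]]] := explored_walk aw wv.
have v0 : 0 < size v by rewrite lt0n size_eq0.
exists b; split=> //; first by lia.
  by rewrite Eb (X_drop aw E) // (@X_over v) // hv addr0.
move=> t tb; have at' : a <= t by lia.
rewrite -(subnKC at') (X_drop aw E); last by lia.
by have := vs (t - a); lia.
Qed.

Lemma explored_flip : explored (flip M) (rs w) (fun t => g (size w - t)).
Proof.
split.
- exact: good_flip.
- by rewrite subn0 (expl_north ex).
- by rewrite size_rs subnn (expl_south ex).
- move=> t; rewrite size_rs => tw; rewrite nth_rs //.
  have := step_flip (expl_step ex (t := size w - t.+1) _).
  by rewrite (_ : (size w - t.+1).+1 = size w - t); [apply|]; lia.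
- move=> e; have [t tw <-] := expl_surj ex e; exists (size w - t);
  rewrite ?size_rs ?leq_subr //.
  by rewrite subKn.
move=> a b; rewrite size_rs => aw bw /(expl_inj ex (leq_subr _ _) (leq_subr _ _)); lia.
Qed.

Lemma explored_nonneg : nonneg w.
Proof.
have [v [v0 wv _]] := reach gM (north M).1; rewrite -(expl_south ex) in wv.
have [b [u [Eb bw fb E]]] := explored_walk (leq0n _) wv.
suff -> : w = v by [].
move: fb E; rewrite -(expl_north ex) drop0 => /(expl_inj ex (leqnn _) bw) Ew E.
have : size u = 0 by have := congr1 size E; rewrite size_cat; lia.
by move/size0nil => u0; rewrite E u0 cats0.
Qed.

(** By [next_out_walk], turning to the next outgoing edge is a first return of the abscissa, which
    is what [cw_outP] says of the formula. For the last outgoing edge, the fan of the vertex leads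
    back to the south pole or to the up step that created the vertex. *)
Lemma explored_cw_out t : t <= size w ->
  cw M (g t, false) = (g (cw_out w t).1, (cw_out w t).2).
Proof.
move=> tw; have w0 := explored_nonneg.
have sE : south M = (g 0, false) by rewrite (expl_south ex) -south_tail.
have next f : cw M (g t, false) = (f, false) -> (f, false) <> south M ->
    exists b, [/\ f = g b, t < b <= size w, X w b = X w t & forall x,
      t < x < b -> (X w t < X w x)%R].
  by move=> h1 h2; have [v ev wv] := next_out_walk gM h1 h2; apply: explored_strict wv ev.
have tlE a b : a < b -> X w b = X w a -> (forall x,
  a < x < b -> (X w a < X w x)%R) -> tl w b = tl w a.
  move=> ab E H; have [a1 a2 a3] := tlP w a; apply: tl_uniq; rewrite ?E //; first lia.
  by move=> x xb; case: (ltngtP x a) => [xa|ax|->//]; [apply: a2|apply/ltW/H]; lia.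
case: (cw_outP w0 tw) => [[f [-> fb tf nf]]|[-> nf]] /=.
  have f1w : f.-1 < size w by lia.
  have nU : nth None w f.-1 != None.
    rewrite -tl_fixN // prednK; last lia.
    by rewrite tf; have := tl_le w t; lia.
  have sf := expl_step ex f1w; rewrite prednK in sf; last lia.
  (* The step leading to [f] is not an up step, so [g f] follows some edge [h] around its tail,
     explored at a time [a <= t]. If [a < t], then [t] would be strictly inside the first-return
     excursion from [a] to [f], yet at the level of its ends. *)
  have [h hc hs] : exists2 h, cw M (h, false) = (g f, false) & (g f, false) <> south M.
    case: (nth None w f.-1) nU sf => [[|]|] //= _ [h1 h2 [k [k1 k2 k3]]];
      last by exists k.
    by exists (g f.-1).
  have [v ev wv] := next_out_walk gM hc hs.
  have [a aw Ea] := expl_surj ex h; rewrite -Ea in wv.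
  have [b [Eb ab Xb sb]] := explored_strict aw wv ev.
  have {}Eb : b = f by apply/esym/(expl_inj ex _ _ Eb); lia.
  rewrite Eb in ab Xb sb; have Ta : tl w f = tl w a by apply: tlE => //; lia.
  have ta : a <= t by case: (leqP a t) => // lt; have := nf a; rewrite -Ta tf eqxx; lia.
  have [E|ne] := eqVneq a t; first by rewrite -E Ea.
  have [] := @tl_eq_val w t f w0 _ (esym tf); first lia.
  by have := sb t; lia.
have no_next f : cw M (g t, false) = (f, false) -> (f, false) = south M.
  move=> h; apply/eqP/negPn/negP => /eqP hs; have [b [_ tb Xb sb]] := next f h hs.
  by have := nf b; rewrite (tlE t b) ?eqxx //; lia.
have [v [v0 wv hS]] := reach gM (g t); rewrite -(expl_south ex) in wv.
case E : (cw M (g t, false)) => [f b]; case: b E => E; last first.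
  have Es := no_next f E; rewrite Es sE.
  have tS : (g t, false) \in southpole M.
    by rewrite -eq_porbit_mem -porbit_next E Es.
  have [b [Eb tb Xb _]] := explored_excursion (leq0n _) wv (conj v0 (hS tS)).
  have {}Eb : t = b by apply: (expl_inj ex) => //; lia.
  by rewrite tl_eq0 // Eb Xb X0 eqxx.
have fe : (f, true) \in porbit (cw M) (g t, false).
  by rewrite -E -eq_porbit_mem porbit_next.
have [h [o [Eo oe fo]]] := fan_inner gM fe erefl.
have [v' ev' wv'] := fan_linked fo (fun e f _ => @next_out_walk _ _ gM e f).
have [a aw Ea] := expl_surj ex f; have [a' aw' Ea'] := expl_surj ex o.
rewrite -Ea' in wv'; have [b [Eb tb Xb sb]] := explored_excursion aw' wv' ev'.
have {}Eb : t = b by apply: (expl_inj ex) => //; lia.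
have so : step M f None o.
  apply: step_up E Eo _; move: fe oe; rewrite -!eq_porbit_mem => /eqP -> /eqP ->.
  by [].
have aL : a < size w.
  rewrite ltn_neqAle aw andbT; apply/eqP => aE.
  by move: so; rewrite -Ea aE (expl_north ex); apply: north_terminal.
have [En Eg] : nth None w a = None /\ g a.+1 = o.
  by have := expl_step ex aL; rewrite Ea => /(step_fun gM so) [<- <-].
have {}Ea' : a' = a.+1 by apply: (expl_inj ex) => //; rewrite Eg.
have Xa := X_up aL En.
have -> : tl w t = a.+1.
  rewrite Eb; apply: tl_uniq; rewrite ?Xb -?Ea'; [lia| |by rewrite Ea' Xa /=; lia].
  by move=> x xb; apply: sb; lia.
by rewrite Ea.
Qed.

End ExploredMap.

Lemma explored_cw l (M : dmap l) w g t b : explored M w g -> t <= size w ->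
  cw M (g t, b) = (g (cw_word w (t, b)).1, (cw_word w (t, b)).2).
Proof.
move=> ex tw; case: b; last by rewrite (explored_cw_out ex) // cw_word_out.
have tw' : size w - t <= size (rs w) by rewrite size_rs leq_subr.
have := explored_cw_out (explored_flip ex) tw'; rewrite cw_flip subKn //.
by move/(congr1 (@oppd l)); rewrite oppdK /oppd /= /cw_word /= => ->.
Qed.

Lemma findex_conj (T T' : finType) (f : T -> T) (f' : T' -> T') (h : T -> T') x y :
  injective h -> (forall z, h (f z) = f' (h z)) -> fconnect f x y ->
  findex f' (h x) (h y) = findex f x y.
Proof.
move=> hI hf c; have E i : iter i f' (h x) = h (iter i f x) by elim: i => //= i ->.
apply: findex_iter_first => [|i lt]; first by rewrite E iter_findex.
rewrite E (inj_eq hI); apply/eqP => Ei.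
have io : i < fingraph.order f x := ltn_trans lt (findex_max c).
by have := findex_iter io; rewrite Ei => Efi; rewrite Efi ltnn in lt.
Qed.

Lemma porbit_fconnect (T : finType) (s : {perm T}) x y : (y \in porbit s x) = fconnect
  s x y.
Proof.
apply/porbitP/idP => [[i ->]|c]; first by rewrite permX fconnect_iter.
by exists (findex s x y); rewrite permX iter_findex.
Qed.

Lemma height_ge0 w : nonneg w -> exists k : nat, height w = k%:Z%R.
Proof. by move=> /(_ (size w)); rewrite X_size; case: (height w) => // k _; exists k. Qed.

Lemma relabel_inj l (p : {perm 'I_l}) : injective (relabel p).
Proof. by case=> [a b] [a' b'] [/perm_inj -> ->]. Qed.

Lemma dmap_iso_lengths l (M M' : dmap l) : dmap_iso M M' -> good M ->
  west_length M' = west_length M /\ east_length M' = east_length M.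
Proof.
case/existsP=> p /and3P[/forallP pc /eqP ps /eqP pn] gM.
have fc d : relabel p (face M d) = face M' (relabel p d) by rewrite !faceE (eqP (pc _)).
have sn := good_outer gM; rewrite /outer_face porbit_fconnect in sn.
have ns : fconnect (face M) (north M) (south M).
  by rewrite -porbit_fconnect porbit_sym porbit_fconnect.
by split; rewrite /west_length /east_length -ps -pn; apply: findex_conj => //;
  apply: relabel_inj.
Qed.

Lemma explored_iso l (M : dmap l.+1) w g : explored M w g ->
  size w = l /\ exists m n, admissible m n w /\ dmap_iso M (word_map l w).
Proof.
move=> ex; have w0 := explored_nonneg ex.
have w0' := explored_nonneg (explored_flip ex).
pose G (t : 'I_(size w).+1) := g t.
have Gi : injective G.
  move=> a b E; apply/val_inj/(expl_inj ex) => //; rewrite -ltnS; exact: ltn_ord.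
have sw : size w = l.
  have := card_codom Gi; rewrite card_ord => cG; apply: succn_inj; rewrite -cG.
  suff -> : #|codom G| = #|'I_l.+1| by rewrite card_ord.
  apply: eq_card => e; rewrite [RHS]inE; apply/codomP.
  have [t tw <-] := expl_surj ex e.
  by exists (inord t); rewrite /G inordK.
split=> //; have [n hn] := height_ge0 w0; have [m hm] := height_ge0 w0'.
exists m, n; have aw : admissible m n w by split.
split=> //.
pose G' (t : 'I_l.+1) := g t.
have G'i : injective G'.
  move=> a b E; apply/val_inj/(expl_inj ex) => //; rewrite sw -ltnS; exact: ltn_ord.
pose p := (perm G'i)^-1%g.
have pE t : t <= l -> p (g t) = inord t.
  by move=> tl'; apply: (@perm_inj _ (perm G'i)); rewrite permKV permE /G' inordK.
have rel p' : p'.1 <= l -> relabel p (g p'.1, p'.2) = odart l p'.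
  by move=> tl'; rewrite /relabel /= pE.
apply/existsP; exists p; apply/and3P; split.
- apply/forallP => -[e b]; have [t tw <-] := expl_surj ex e; rewrite sw in tw.
  have tw' : t <= size w by rewrite sw.
  rewrite (explored_cw b ex tw') !(rel (t, b)) // rel; last exact: (word_le sw aw).
  by rewrite (word_cwE sw aw).
- by rewrite (south_tail (expl_good ex)) -(expl_south ex) (rel (0, false)).
have -> : north M = (g l, true).
  have := expl_north ex; rewrite sw => ->.
  by case E : (north M) (good_north (expl_good ex) (porbit_id (cw M) (north M))) =>
    [a b] /= ->.
by rewrite (rel (l, true)).
Qed.

Lemma triangulation_word m n l (M : dmap l.+1) : bipolar_triangulation M m n ->
  exists w, [/\ size w = l, admissible m n w & dmap_iso M (word_map l w)].
Proof.
move=> bt; have gM := bipolar_triangulation_good bt.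
have [w [g ex]] := explore gM; have [sw [m' [n' [aw iso]]]] := explored_iso ex.
exists w; split=> //; have [El Er] := dmap_iso_lengths iso gM.
rewrite (word_west sw aw) (word_east sw aw) in El Er.
have /and5P[_ _ _ /eqP Ew /eqP Ee] := bt.
rewrite Ew in El; rewrite Ee in Er; case: El Er => Em [En].
by rewrite -Em -En.
Qed.

Lemma word_step m n L w t : size w = L -> admissible m n w -> t < L ->
  step (word_map L w) (inord t) (nth None w t) (inord t.+1).
Proof.
move=> sw aw tL; have [w0 w0' _ _] := aw; have tw : t < size w by rewrite sw.
have cwE p : p.1 <= L -> cw (word_map L w) (odart L p) = odart L (cw_word w p).
  exact: (word_cwE sw aw).
have nS : (inord t.+1 : 'I_L.+1, false) <> south (word_map L w).
  by case=> /(congr1 (@nat_of_ord _)); rewrite !inordK.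
have nN : (inord t : 'I_L.+1, true) <> north (word_map L w).
  by case=> /(congr1 (@nat_of_ord _)); rewrite !inordK //; lia.
have cwI p q : p.1 <= L -> cw_word w p = q -> cw (word_map L w) (inord p.1,
  p.2) = (inord q.1, q.2).
  by move=> pL <-; rewrite -[(inord p.1, _)]/(odart L p) cwE.
case E : (nth None w t) => [[|]|].
- have [k [kb ak c1 c2]] := flat_in w0' tw E; have c3 := flat_out w0 tw E.
  split=> //; exists (inord k); split.
  + by rewrite (cwI _ _ _ c3) //=; lia.
  + by rewrite (cwI _ _ _ c1).
  + by rewrite (cwI _ _ _ c2) //=; lia.
- have [k [kb ak c1 c2]] := down_out w0 tw E; have c3 := down_in w0' tw E.
  split=> //; exists (inord k); split.
  + by rewrite (cwI _ _ _ c3).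
  + by rewrite (cwI _ _ _ c1) //=; lia.
  + by rewrite (cwI _ _ _ c2) //=; lia.
have tl1 : tl w t.+1 = t.+1 by apply/eqP; rewrite tl_fix // E.
have hd0 : hd w t = t.+1.
  by have := @hd_tl w t.+1 tw; rewrite tl1 => ->.
have pre p : p.1 <= L -> exists2 q,
  q.1 <= L & cw_word w q = p /\ cw (word_map L w) (odart L q) = odart L p.
  move=> pL; pose d := (cw (word_map L w))^-1%g (odart L p).
  have Ed : cw (word_map L w) d = odart L p by rewrite permKV.
  exists (ndart d); first exact: ndart_le.
  split; last by rewrite ndartK.
  have := cwE (ndart d) (ndart_le d); rewrite ndartK Ed => /(congr1 (@ndart L)).
  by rewrite !odartK // (word_le sw aw) // ndart_le.
split.
(* No edge later than [t] enters the vertex created at [t.+1], so the dart preceding [(t, true)]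
   cannot be a head. In the same way the dart preceding [(t.+1, false)] cannot be a tail. *)
- have [[h b] /= hL [Eq Ec]] := pre (t, true) (ltnW tL).
  have hw : h <= size w by rewrite sw.
  have [_ lE] := @cw_word_lab w (h, b) w0 w0' hw; rewrite Eq {1}/lab /= hd0 in lE.
  case: b Eq Ec lE => Eq Ec; rewrite /lab /= => lE; last by exists (inord h).
  have := hd_gt hw; rewrite -lE => hb.
  case: (cw_inP w0' hw) => [[f [Ef fb _ _]]|[Ef _]]; rewrite Ef in Eq.
    by case: Eq => Eq; lia.
  by move: Eq; case: ifP => _ [] Eq; lia.
- have [[h b] /= hL [Eq Ec]] := pre (t.+1, false) tL.
  have hw : h <= size w by rewrite sw.
  have [_ lE] := @cw_word_lab w (h, b) w0 w0' hw; rewrite Eq {1}/lab /= tl1 in lE.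
  case: b Eq Ec lE => Eq Ec; rewrite /lab /= => lE; first by exists (inord h).
  have := tl_le w h => hb; rewrite cw_word_out //= in Eq.
  case: (cw_outP w0 hw) => [[f [Ef fb _ _]]|[Ef _]]; rewrite Ef in Eq.
    by case: Eq => Eq; lia.
  by move: Eq; case: ifP => _ // [] Eq; lia.
rewrite -[X in X \in _]/(odart L (t.+1, false)) -[X in porbit _ X]/(odart L (t, true)).
by rewrite -eq_porbit_mem (orb_lab sw aw) //= ?/lab /= ?tl1 ?hd0 //; lia.
Qed.

Lemma word_walk m n L w : size w = L -> admissible m n w ->
  walk (word_map L w) (inord 0) w (inord L).
Proof.
move=> sw aw; have := @trace_walk _ (word_map L w) (fun t => inord t) w 0 (leq0n _).
rewrite drop0 sw; apply=> t tw; exact: (word_step sw aw).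
Qed.

(** An isomorphism carries the exploration of one map to a walk with the same letters in the other,
    where the walk from the south edge to the north edge is unique. *)
Lemma word_map_inj m n m' n' L w w' : size w = L -> admissible m n w ->
  size w' = L -> admissible m' n' w' -> dmap_iso (word_map L w) (word_map L w') -> w = w'.
Proof.
move=> sw aw sw' aw' /existsP[p /and3P[/forallP pc /eqP ps /eqP pn]].
set M := word_map L w in pc ps pn; set M' := word_map L w' in pc ps pn.
have cE a b d : cw M (a, b) = d -> cw M' (p a, b) = relabel p d.
  by move=> <-; rewrite (eqP (pc _)).
have stepE e c f : step M e c f -> step M' (p e) c (p f).
  case: c => [[|]|] /=.
  - move=> [h1 h2 [k [h3 h4 h5]]]; split.
    + by move=> E; apply: h1; apply: (@relabel_inj _ p); apply: etrans E (esym ps).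
    + by move=> E; apply: h2; apply: (@relabel_inj _ p); apply: etrans E (esym pn).
    by exists (p k); rewrite !(cE _ _ _ h3, cE _ _ _ h4, cE _ _ _ h5).
  - move=> [h1 h2 [k [h3 h4 h5]]]; split.
    + by move=> E; apply: h1; apply: (@relabel_inj _ p); apply: etrans E (esym ps).
    + by move=> E; apply: h2; apply: (@relabel_inj _ p); apply: etrans E (esym pn).
    by exists (p k); rewrite !(cE _ _ _ h3, cE _ _ _ h4, cE _ _ _ h5).
  move=> [[h h1] [k h2] h3]; split.
  - by exists (p h); rewrite (cE _ _ _ h1).
  - by exists (p k); rewrite (cE _ _ _ h2).
  case/porbitP: h3 => i Ei; apply/porbitP; exists i.
  have conj d : relabel p ((cw M ^+ i)%g d) = (cw M' ^+ i)%g (relabel p d).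
    elim: i {Ei} => [|i IH]; first by rewrite !expg0 !perm1.
    by rewrite !expgSr !permM -IH (eqP (pc _)).
  by have := conj (e, true); rewrite -Ei.
have walkE v e f : walk M e v f -> walk M' (p e) v (p f).
  elim: v e => [|c v IH] e /=; first by move=> ->.
  by move=> [x sx wx]; exists (p x); [apply: stepE | apply: IH].
have gM' := bipolar_triangulation_good (word_bipolar_triangulation sw' aw').
have w1 := walkE _ _ _ (word_walk sw aw); have w2 := word_walk sw' aw'.
have p0 : p (inord 0) = inord 0 by case: ps.
have pL : p (inord L) = inord L by case: pn.
rewrite p0 pL in w1.
have nt c x : ~ step M' (inord L) c x by apply: (@north_terminal _ M').
have [u E _] := walk_prefix gM' nt w1 w2.
have : size u = 0 by have := congr1 size E; rewrite size_cat sw sw'; lia.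
by move/size0nil => u0; rewrite E u0 cats0.
Qed.

(** * Isomorphism classes and words *)

Section IsoInvariance.
Variables (l : nat) (M M' : dmap l) (p : {perm 'I_l}).
Hypothesis pc : forall d, relabel p (cw M d) = cw M' (relabel p d).

Lemma porbit_relabel x : porbit (cw M') (relabel p x) = relabel p @: porbit (cw M) x.
Proof.
have E i z : relabel p ((cw M ^+ i)%g z) = (cw M' ^+ i)%g (relabel p z).
  elim: i => [|i IH]; first by rewrite !expg0 !perm1.
  by rewrite !expgSr !permM -IH pc.
apply/setP => y; apply/porbitP/imsetP => [[i ->]|[z /porbitP[i ->] ->]].
  by exists ((cw M ^+ i)%g x); rewrite ?mem_porbit ?E.
by exists i; rewrite E.
Qed.


Lemma indeg_relabel (v : {set dart l}) : indeg M' (relabel p @: v) = indeg M v.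
Proof.
rewrite /indeg -[RHS](card_imset _ (@perm_inj _ p)); apply: eq_card => e.
have [x ->] : exists x, e = p x by exists (p^-1 e)%g; rewrite permKV.
rewrite (mem_imset _ _ (@perm_inj _ p)) !inE /edge_head.
by rewrite -[in RHS](inj_eq (imset_inj (@relabel_inj l p))) -porbit_relabel.
Qed.

Lemma outdeg_relabel (v : {set dart l}) : outdeg M' (relabel p @: v) = outdeg M v.
Proof.
rewrite /outdeg -[RHS](card_imset _ (@perm_inj _ p)); apply: eq_card => e.
have [x ->] : exists x, e = p x by exists (p^-1 e)%g; rewrite permKV.
rewrite (mem_imset _ _ (@perm_inj _ p)) !inE /edge_tail.
by rewrite -[in RHS](inj_eq (imset_inj (@relabel_inj l p))) -porbit_relabel.
Qed.

Lemma vertices_relabel : vertices M' = [set relabel p @: (v : {set dart l}) | v in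
  vertices M].
Proof.
apply/setP => v; apply/imsetP/imsetP => [[d _ ->]|[u /imsetP[x _ ->] ->]]; last first.
  by exists (relabel p x); rewrite ?porbit_relabel.
have [x ->] : exists x, d = relabel p x.
  by exists ((p^-1)%g d.1, d.2); rewrite /relabel /= permKV; case: (d).
by exists (porbit (cw M) x); rewrite ?porbit_relabel //; apply: imset_f.
Qed.

Lemma vertex_prob_relabel (R : fieldType) i j : vertex_prob R M' i j = vertex_prob R M
  i j.
Proof.
have sI : injective (fun v : {set dart l} =>
  relabel p @: v) := imset_inj (@relabel_inj l p).
rewrite /vertex_prob vertices_relabel (card_imset _ sI); congr (_%:R / _)%R.
rewrite -[RHS](card_imset _ sI); apply: eq_card => v; rewrite inE.
apply/andP/imsetP => [[/imsetP[u uM ->]]|[u]].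
  by rewrite indeg_relabel outdeg_relabel => h; exists u; rewrite // inE uM.
by rewrite inE => /andP[uM h] ->; rewrite indeg_relabel outdeg_relabel imset_f.
Qed.

End IsoInvariance.

Lemma vertex_prob_iso (R : fieldType) l (M M' : dmap l) i j : dmap_iso M M' ->
  vertex_prob R M i j = vertex_prob R M' i j.
Proof.
case/existsP=> p /and3P[/forallP pc _ _]; apply/esym/vertex_prob_relabel => d.
exact/eqP/pc.
Qed.

Definition nonnegb (w : seq letter) : bool := all (fun t =>
  0 <= X w t)%R (iota 0 (size w).+1).

Lemma nonnegP w : reflect (nonneg w) (nonnegb w).
Proof.
apply: (iffP allP) => [h t|h t _]; last exact: h.
case: (leqP t (size w)) => tw; first by apply: h; rewrite mem_iota.
by rewrite X_over 1?ltnW // -X_size; apply: h; rewrite mem_iota ltnSn.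
Qed.

Definition tandem_word (m n : nat) (w : seq letter) : bool :=
  [&& nonnegb w, nonnegb (rs w), height w == n%:Z%R & height (rs w) == m%:Z%R].

Lemma admissibleP m n w : reflect (admissible m n w) (tandem_word m n w).
Proof.
apply: (iffP and4P) => [[/nonnegP ? /nonnegP ? /eqP ? /eqP ?]|[? ? ? ?]] //.
by split; do ?[exact/nonnegP | exact/eqP].
Qed.

Definition tandem (m n L : nat) : {set L.-tuple letter} :=
  [set w : L.-tuple letter | tandem_word m n w].

Lemma tandemP m n L (w : L.-tuple letter) : reflect (admissible m n w) (w \in tandem m
  n L).
Proof. rewrite inE; exact: admissibleP. Qed.

Definition class_of (L : nat) (w : L.-tuple letter) : dmap_class L.+1 :=
  (\pi_(dmap_class L.+1) (word_map L w))%qT.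

Lemma class_of_inj m n L : {in tandem m n L &, injective (@class_of L)}.
Proof.
move=> w w' /tandemP aw /tandemP aw' E; apply/val_inj.
apply: (word_map_inj (size_tuple w) aw (size_tuple w') aw').
by move/eqquotP: E.
Qed.

Lemma triangulations_words m n L :
  triangulations m n L.+1 = [set class_of w | w in tandem m n L].
Proof.
apply/setP => C; apply/imsetP/imsetP => -[].
  move=> M; rewrite inE => bt ->; have [w [sw aw iso]] := triangulation_word bt.
  have sw' : size w == L by rewrite sw.
  exists (Tuple sw'); first exact/tandemP.
  exact/eqquotP.
move=> w /tandemP aw ->; exists (word_map L w) => //.
by rewrite inE; apply: word_bipolar_triangulation aw; rewrite size_tuple.
Qed.

Definition good_count (L : nat) (w : seq letter) (i j : nat) : nat :=
  #|[set a : 'I_L.+1 | (#|[set e : 'I_L.+1 | hd w e == a]| == i) &&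
                       (#|[set e : 'I_L.+1 | tl w e == a]| == j)]|.

Lemma card_tl_fix L w : size w = L ->
  #|[set e : 'I_L.+1 | tl w e == e]| = (count_mem None w).+1.
Proof.
move=> sw; rewrite -sum1_card big_mkcond /= big_ord_recl inE /=.
have := tl_le w 0; rewrite leqn0 => /eqP ->; rewrite eqxx add1n; congr _.+1.
rewrite -sum1_count (big_nth None) sw [RHS]big_mkcond [RHS]big_mkord;
  apply: eq_bigr => t _.
by rewrite inE /= tl_fix ?sw.
Qed.

Lemma height_count v :
  height v = ((count_mem None v)%:Z - (count_mem (Some false) v)%:Z)%R.
Proof.
elim: v => [|c v IH]; first by rewrite /height big_nil.
by rewrite /height big_cons -/(height v) IH; case: c => [[]|] /=; lia.
Qed.

Lemma size_count (v : seq letter) :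
  size v = count_mem None v + count_mem (Some false) v + count_mem (Some true) v.
Proof. by elim: v => // c v /= ->; case: c => [[]|] /=; lia. Qed.

Lemma count_rs (v : seq letter) c : count_mem c (rs v) = count_mem (swap c) v.
Proof.
rewrite /rs count_rev count_map; apply: eq_count => x /=.
by rewrite -[x == swap c](inj_eq (inv_inj swapK)) swapK.
Qed.

(** The length and the two endpoint conditions are three linear equations for the three letter
    counts. With the two poles, the number of vertices is therefore the same for all admissible
    words of a given length. *)
Lemma count_up m n L (w : L.-tuple letter) : w \in tandem m n L ->
  3 * count_mem None w = L + m + n.
Proof.
case/tandemP => _ _; rewrite !height_count !count_rs /= => hn hm.
by have := size_count (val w); rewrite size_tuple /=; lia.
Qed.

Lemma degree_prob_words (R : fieldType) m n L i j : 0 < i -> 0 < j ->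
  degree_prob R m n L.+1 i j =
  ((\sum_(w in tandem m n L) (good_count L w i j)%:R / ((L + m + n) %/ 3 + 2)%:R) /
   #|tandem m n L|%:R)%R.
Proof.
move=> i0 j0; rewrite /degree_prob triangulations_words card_in_imset;
  last exact: class_of_inj.
rewrite big_imset /=; last exact: class_of_inj.
congr (_ / _)%R; apply: eq_bigr => w wt; have /tandemP aw := wt.
have sw := size_tuple w.
rewrite (@vertex_prob_iso R _ _ (word_map L w)); last first.
  exact/eqquotP/(reprK (class_of w)).
rewrite /vertex_prob (word_good_vertices sw aw) //; congr (_ / _%:R)%R.
by rewrite (word_card_vertices sw aw) (card_tl_fix sw) -(count_up wt) mulKn // addn2.
Qed.

(** * Degrees read off the walk *)

(* Number of visits to level 0 of the path with steps [v] started at level [h],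
   until it goes below 0; [None] if it does not. *)
Fixpoint visits (h : nat) (v : seq letter) : option nat :=
  if v is c :: v' then
    let r := match c, h with
             | None, _ => visits h.+1 v'
             | Some true, _ => visits h v'
             | Some false, 0 => Some 0
             | Some false, h'.+1 => visits h' v'
             end in
    if h == 0 then omap succn r else r
  else None.

(** Once the path has gone below 0 the count is settled; this is what allows degrees to be certified
    by a bounded window. *)
Lemma visits_cat h u v j : visits h u = Some j -> visits h (u ++ v) = Some j.
Proof.
elim: u h j => // c u IH h j /=.
have H r r' : (forall j, r = Some j -> r' = Some j) ->
    (if h == 0 then omap succn r else r) = Some j -> (if h == 0 then omap succn r' else
      r') = Some j.
  by case: ifP => _ E; [case: r E => //= x E [<-]; rewrite (E x)|apply: E].
by apply: H; case: c => [[|]|]; case: h => [|h] // j'; apply: IH.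
Qed.

Lemma card_ord_count n (P : pred nat) : #|[set e : 'I_n | P e]| = count P (iota 0 n).
Proof.
rewrite -sum1_card -sum1_count -[in RHS](subn0 n) -/(index_iota 0 n) big_mkord.
by apply: eq_bigl => e; rewrite inE.
Qed.

Lemma visits_tl w a : 0 < a <= size w -> tl w a = a -> forall j,
  visits 0 (drop a w) = Some j -> #|[set e : 'I_(size w).+1 | tl w e == a]| = j.
Proof.
move=> /andP[a0 aw] ta.
have lowa : (X w a.-1 < X w a)%R by have [_ _ H] := tlP w a; rewrite ta in H; apply: H.
(* The induction starts at any later time [t], at height [h] above the level of [a], provided the
   abscissa has stayed above that level since [a]. Then [tl w t = a] exactly when [h = 0], and after
   a first passage below no edge has tail [a]. *)
have gen t h j : a <= t <= size w -> (forall s, a <= s <= t -> (X w a <= X w s)%R) ->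
    X w t = (X w a + h%:Z)%R -> visits h (drop t w) = Some j ->
    count (fun e => tl w e == a) (iota t ((size w).+1 - t)) = j.
  have [k] := ubnP (size w - t); elim: k t h j => // k IH t h j tk tb above Xt.
  have [tL|tw] := leqP (size w) t; first by rewrite drop_oversize.
  rewrite (drop_nth None tw) (_ : (size w).+1 - t = ((size w).+1 - t.+1).+1); last by lia.
  rewrite [iota _ _.+1]/= [count _ (_ :: _)]/=.
  have -> : (tl w t == a) = (h == 0).
    apply/eqP/eqP => [E|h0].
      by have := @tl_val w t; rewrite E Xt => H; have := H _ a0; lia.
    apply: tl_uniq; rewrite ?Xt ?h0 ?addr0 //; first lia.
    by move=> s sb; apply: above; lia.
  move=> /= V.
  have next h' j' : (X w t.+1 = X w a + h'%:Z)%R -> visits h' (drop t.+1 w) = Some j' ->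
      count (fun e => tl w e == a) (iota t.+1 ((size w).+1 - t.+1)) = j'.
    move=> Xt' V'; apply: (IH t.+1 h' j') => //; [lia|lia|].
    move=> s sb; have [->|ne] := eqVneq s t.+1; first by lia.
    by apply: above; lia.
  have XSt := XS tw.
  suff {V} main r : match nth None w t, h with
      | None, _ => visits h.+1 (drop t.+1 w)
      | Some true, _ => visits h (drop t.+1 w)
      | Some false, 0 => Some 0
      | Some false, h'.+1 => visits h' (drop t.+1 w)
      end = Some r -> count (fun e => tl w e == a) (iota t.+1 ((size w).+1 - t.+1)) = r.
    have omapE r : omap succn r = Some j -> exists2 x, r = Some x & j = x.+1.
      by case: r => //= x [<-]; exists x.
    by move: V; case: ifP => _; [move=> /omapE[x /main -> ->] | move=> /main ->].
  case E : (nth None w t) => [[|]|]; rewrite E /= in XSt.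
  - by apply: next; lia.
  - case: h {next} (@next) Xt => [|h] next Xt; last by apply: next; lia.
    move=> [<-]; apply/eqP; rewrite eqn0Ngt -has_count; apply/hasPn => e.
    rewrite mem_iota => eb; apply/eqP => Et.
    have [b1 b2 b3] := tlP w e; rewrite Et in b1 b2 b3.
    have Xe : X w a = X w e by rewrite -Et tl_val ?Et //; lia.
    have [E'|ne] := eqVneq e t.+1; first by rewrite E' in Xe; lia.
    by have := b2 t.+1; lia.
  - by apply: next; lia.
move=> j V; rewrite (card_ord_count _ (fun e =>
  tl w e == a)) -(subnKC (ltnW (aw : a < (size w).+1))) iotaD count_cat add0n.
rewrite (gen a 0 j) ?addr0 //; [|lia|].
  rewrite (_ : count _ _ = 0) //; apply/eqP; rewrite eqn0Ngt -has_count; apply/hasPn => e.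
  by rewrite mem_iota => eb; have := tl_le w e; lia.
by move=> s sb; rewrite (_ : s = a) //; lia.
Qed.

Lemma rs_cat u v : rs (u ++ v) = rs v ++ rs u.
Proof. by rewrite /rs map_cat rev_cat. Qed.

Lemma rs_take w a : a <= size w -> rs (take a w) = drop (size w - a) (rs w).
Proof. by move=> aw; rewrite /rs map_take rev_take size_map. Qed.

Lemma card_hd w a : 0 < a <= (size w).+1 ->
  #|[set e : 'I_(size w).+1 | hd w e == a]| =
  #|[set e : 'I_(size w).+1 | tl (rs w) e == (size w).+1 - a]|.
Proof.
move=> ab; rewrite -[RHS](card_imset _ (@rev_ord_inj _)); apply: eq_card => e.
rewrite -[e in RHS](rev_ordK e) (mem_imset _ _ (@rev_ord_inj _)) !inE /=.
have eL : (e : nat) <= size w by rewrite -ltnS.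
by rewrite /hd subSS; have := tl_le (rs w) (size w - e); lia.
Qed.

Definition pattern (i j : nat) (u : seq letter) (v : seq letter) : bool :=
  (visits 0 (rs u) == Some i) && (visits 0 v == Some j).

(** Only an inequality: the vertex numbered 0 is dropped, and so are the vertices whose count never
    ends within the word, for which [visits] is [None]. *)
Lemma good_count_pattern (w : seq letter) i j :
  \sum_(0 <= a < size w) ((nth None w a == None) && pattern i j (take a w) (drop a.+1 w))
    <= good_count (size w) w i j.
Proof.
rewrite big_mkord /good_count -sum1_card [X in _ <= X]big_mkcond /= big_ord_recl /=.
apply: leq_trans (leq_addl _ _); apply: leq_sum => a _; rewrite inE /=.
case: eqP => //= aU; case: (boolP (pattern _ _ _ _)) => // /andP[/eqP Vi /eqP Vj].
have aw := ltn_ord a.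
have tE : tl w a.+1 = a.+1 by apply/eqP; rewrite tl_fix // aU.
have ab : 0 < a.+1 <= size w by [].
have ab' : 0 < a.+1 <= (size w).+1 by rewrite /= ltnS ltnW.
rewrite /bump /= add1n (visits_tl ab tE Vj) (card_hd ab').
rewrite subSS.
have := @visits_tl (rs w) (size w - a); rewrite size_rs => H.
have H1 : 0 < size w - a <= size w by lia.
have H2 : tl (rs w) (size w - a) = size w - a.
  have a1 : size w - a.+1 < size (rs w) by rewrite size_rs; lia.
  have := tl_fix a1; rewrite nth_rs' // aU /= (_ : (size w - a.+1).+1 = size w - a);
    last lia.
  by move/eqP.
by rewrite (H H1 H2 i) ?eqxx // -rs_take // ltnW.
Qed.

Definition window (K i j : nat) (b : seq letter) : bool :=
  (nth None b K == None) && pattern i j (take K b) (drop K.+1 b).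

Lemma window_pattern K i j (w : seq letter) x : x + K.*2.+1 <= size w ->
  window K i j (take K.*2.+1 (drop x w)) ->
  (nth None w (x + K) == None) && pattern i j (take (x + K) w) (drop (x + K).+1 w).
Proof.
move=> xw; rewrite /window nth_take; last by lia.
rewrite nth_drop => /andP[-> /andP[/eqP Vi /eqP Vj]] /=.
apply/andP; split; apply/eqP.
  rewrite takeD rs_cat; apply: visits_cat.
  by rewrite take_takel in Vi; last lia.
have -> : drop (x + K).+1 w = drop K.+1 (take K.*2.+1 (drop x w)) ++ drop (x + K.*2.+1) w.
  have dl n (s1 s2 : seq letter) : n <= size s1 -> drop n (s1 ++ s2) = drop n s1 ++ s2.
    by rewrite drop_cat; case: ltngtP => // -> _; rewrite subnn drop0 drop_size.
  rewrite -addnS addnC -drop_drop -[in LHS](cat_take_drop K.*2.+1 (drop x w)) dl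
    ?drop_drop ?(addnC x) //.
  by rewrite size_takel ?size_drop; lia.
exact: visits_cat.
Qed.

(** The windows tile [v] without overlap, which makes them independent for uniform letters. *)
Definition windows (K i j N : nat) (v : seq letter) : nat :=
  \sum_(0 <= q < N) window K i j (take K.*2.+1 (drop (q * K.*2.+1) v)).

Lemma sum_shift (F : nat -> nat) k n :
  \sum_(k <= a < n + k) F a = \sum_(0 <= x < n) F (x + k).
Proof. by rewrite -{1}[k]add0n big_addn addnK. Qed.

Lemma sum_residues (g : nat -> nat) B N :
  \sum_(0 <= x < N * B) g x = \sum_(0 <= o < B) \sum_(0 <= q < N) g (o + q * B).
Proof.
elim: N => [|N IH].
  by rewrite mul0n big_geq // big1 // => o _; rewrite big_geq.
rewrite mulSn addnC (big_cat_nat (n := N * B)) //=; last by lia.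
rewrite [in X in _ + X]addnC sum_shift IH -big_split /=.
by apply: eq_bigr => o _; rewrite big_nat_recr.
Qed.

(** Every position below [N * K.*2.+1] is [o + q * K.*2.+1] for a single offset [o], so the sum over
    offsets sees each centre once. The largest offset is [K.*2], whence the successor in the
    hypothesis. *)
Lemma good_count_windows K i j N (w : seq letter) : K.*2.+1 + N * K.*2.+1 <= (size
  w).+1 ->
  \sum_(0 <= o < K.*2.+1) windows K i j N (drop o w) <= good_count (size w) w i j.
Proof.
move=> NL; apply: leq_trans (good_count_pattern w i j).
have -> : \sum_(0 <= o < K.*2.+1) windows K i j N (drop o w) =
    \sum_(0 <= x < N * K.*2.+1) window K i j (take K.*2.+1 (drop x w)).
  rewrite sum_residues; apply: eq_bigr => o _; apply: eq_bigr => q _.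
  by rewrite drop_drop addnC.
have [->|N0] := posnP N; first by rewrite mul0n big_geq.
apply: leq_trans (_ : \sum_(K <= a < N * K.*2.+1 + K) ((nth None w a == None) &&
    pattern i j (take a w) (drop a.+1 w)) <= _); last first.
  rewrite [X in _ <= X](big_cat_nat (n := K)) //=; last by nia.
  by rewrite [X in _ <= _ + X](big_cat_nat (n := N * K.*2.+1 + K)) //=; nia.
rewrite sum_shift !big_nat.
apply: leq_sum => x /andP[_ xN]; case: (boolP (window _ _ _ _)) => // h.
by rewrite (@window_pattern K i j w x) //; nia.
Qed.

From mathcomp Require Import ring lra.
From mathcomp Require Import all_classical all_reals all_analysis.
Import Order.TTheory GRing.Theory Num.Theory.
Import numFieldNormedType.Exports.
Local Open Scope classical_set_scope.
Local Open Scope ring_scope.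

(** * Geometric laws *)

Section Mean.
Variable R : realType.
Implicit Types (F G : seq letter -> R) (L : nat).

(** The expectation of [F] over uniform words of length [L]; with this recursion, independence of
    consecutive factors is an induction on the first letters. *)
Fixpoint mean L F : R :=
  if L is L'.+1 then
    3^-1 * (mean L' (fun v => F (None :: v)) + mean L' (fun v => F (Some false :: v))
            + mean L' (fun v => F (Some true :: v)))
  else F [::].

Lemma mean_le L F G : (forall v, size v = L -> F v <= G v) -> mean L F <= mean L G.
Proof.
elim: L F G => [|L IH] F G FG /=; first exact: FG.
rewrite ler_pM2l ?invr_gt0 //; do 2?[apply: lerD];
  by apply: IH => v vL; apply: FG; rewrite /= vL.
Qed.

Lemma eq_mean L F G : (forall v, size v = L -> F v = G v) -> mean L F = mean L G.
Proof. by move=> E; apply/le_anti; rewrite !mean_le // => v /E ->. Qed.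

Lemma mean_cst L c : mean L (fun _ => c) = c.
Proof. by elim: L => //= L ->; field. Qed.

Lemma meanD L F G : mean L (fun v => F v + G v) = mean L F + mean L G.
Proof. by elim: L F G => //= L IH F G; rewrite !IH; ring. Qed.

Lemma meanZ L a F : mean L (fun v => a * F v) = a * mean L F.
Proof. by elim: L F => //= L IH F; rewrite !IH; ring. Qed.

Lemma mean_ge0 L F : (forall v, size v = L -> 0 <= F v) -> 0 <= mean L F.
Proof. by move=> H; rewrite -[leLHS](mean_cst L); apply: mean_le. Qed.

Lemma mean_le1 L F : (forall v, size v = L -> F v <= 1) -> mean L F <= 1.
Proof. by move=> H; rewrite -[leRHS](mean_cst L); apply: mean_le. Qed.

Lemma mean_cat a b F : mean (a + b) F = mean a (fun u => mean b (fun v => F (u ++ v))).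
Proof. by elim: a F => //= a IH F; rewrite !IH. Qed.

Lemma meanM_cat a b F G :
  mean (a + b) (fun v => F (take a v) * G (drop a v)) = mean a F * mean b G.
Proof.
rewrite mean_cat mulrC -meanZ; apply: eq_mean => u ua.
rewrite mulrC -meanZ; apply: eq_mean => v _.
by rewrite take_size_cat // drop_size_cat.
Qed.

Lemma mean_sum L (I : Type) (r : seq I) (H : I -> seq letter -> R) :
  mean L (fun v => \sum_(i <- r) H i v) = \sum_(i <- r) mean L (H i).
Proof.
elim: r => [|i r IH]; first by rewrite big_nil; apply: etrans (mean_cst L 0);
  apply: eq_mean => v _; rewrite big_nil.
by rewrite big_cons -IH -meanD; apply: eq_mean => v _; rewrite big_cons.
Qed.

Lemma sum_letter (f : letter -> R) : \sum_c f c = f None + f (Some false) + f (Some true).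
Proof.
rewrite (bigD1 None) // (bigD1 (Some false)) //= (bigD1 (Some true)) //= big_pred0
  ?addr0 ?addrA //.
by case=> [[|]|].
Qed.

Lemma sum_words L F : \sum_(w : L.-tuple letter) F w = 3 ^+ L * mean L F.
Proof.
elim: L F => [|L IH] F.
  by rewrite (big_pred1 [tuple]) /= ?mul1r // => w; rewrite (tuple0 w); apply/esym/eqP.
rewrite (reindex (fun p : letter * L.-tuple letter => cons_tuple p.1 p.2)); last first.
  exists (fun w : L.+1.-tuple letter => (thead w, [tuple of behead w])) =>
    [[c w] _|w _] /=.
    by congr pair; apply/val_inj.
  by rewrite [RHS](tuple_eta w).
rewrite -(pair_bigA _ (fun c (w : L.-tuple letter) => F (c :: w))) /= sum_letter.
rewrite !(IH (fun v => F (_ :: v))) exprS.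
by field.
Qed.

Lemma mean_perm L F (s : letter -> letter) : injective s -> mean L (fun v =>
  F (map s v)) = mean L F.
Proof.
move=> sI; elim: L F => //= L IH F; congr (_ * _).
have H c : mean L (fun v => F (s c :: map s v)) = mean L (fun v => F (s c :: v)).
  exact: (IH (fun v => F (s c :: v))).
rewrite !H -(sum_letter (fun c => mean L (fun v => F (s c :: v)))).
by rewrite -(sum_letter (fun c => mean L (fun v => F (c :: v)))) [RHS](reindex_inj sI).
Qed.

Definition visit_prob (h j K : nat) : R := mean K (fun v => (visits h v == Some j)%:R).

Lemma visit_prob_up h j K : visit_prob h.+1 j K.+1 =
  3^-1 * (visit_prob h.+2 j K + visit_prob h j K + visit_prob h.+1 j K).
Proof. by []. Qed.

Lemma visit_prob0 K : visit_prob 0 0 K = 0.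
Proof.
have E (r : option nat) : (omap succn r == Some 0%N) = false by case: r.
case: K => [|K] //; apply: etrans (mean_cst K.+1 0); apply: eq_mean => -[|c v] //= _.
by rewrite E.
Qed.

Lemma visit_probS j K : visit_prob 0 j.+1 K.+1 =
  3^-1 * (visit_prob 1 j K + (j == 0)%:R + visit_prob 0 j K).
Proof.
have E (r : option nat) : (omap succn r == Some j.+1) = (r == Some j) by case: r.
rewrite /visit_prob /=; congr (_ * (_ + _ + _)).
- by apply: eq_mean => v _; rewrite E.
- by rewrite mean_cst eq_sym.
- by apply: eq_mean => v _; rewrite E.
Qed.

Lemma visit_prob_bounds h j K : 0 <= visit_prob h j K <= 1.
Proof.
apply/andP; split; first by apply: mean_ge0 => v _; case: (_ == _).
by apply: mean_le1 => v _; case: (_ == _).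
Qed.

Lemma visit_prob_mono h j : {homo visit_prob h j : K K' / (K <= K')%N >-> K <= K'}.
Proof.
move=> K K' /subnKC <-; rewrite /visit_prob mean_cat; apply: mean_le => u _.
rewrite -{1}(mean_cst (K' - K) (_%:R)); apply: mean_le => v _.
by case: eqP => [/visits_cat ->|_]; rewrite ?eqxx //; case: (_ == _).
Qed.

Definition geom3 (j : nat) : R := if j is j'.+1 then 3^-1 * (2 / 3) ^+ j' else 0.

Lemma visit_prob_cvg h j : visit_prob h j @ \oo --> lim (visit_prob h j @ \oo).
Proof.
apply: nondecreasing_is_cvgn; first by move=> K K' le; apply: visit_prob_mono.
by exists 1 => _ [K _ <-]; case/andP: (visit_prob_bounds h j K).
Qed.

(* By the recursion on the first letter, the limit is an affine function of the
   starting level; being bounded, it is constant. *)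
Lemma visit_lim_level h j : lim (visit_prob h j @ \oo) = lim (visit_prob 0 j @ \oo).
Proof.
pose g h := lim (visit_prob h j @ \oo).
have gb k : 0 <= g k <= 1.
  apply/andP; split.
    apply: limr_ge; first exact: visit_prob_cvg.
    by near=> K; case/andP: (visit_prob_bounds k j K).
  apply: limr_le; first exact: visit_prob_cvg.
  by near=> K; case/andP: (visit_prob_bounds k j K).
have rec k : g k.+1 = 3^-1 * (g k.+2 + g k + g k.+1).
  have c1 : (fun K => visit_prob k.+1 j K.+1) @ \oo --> g k.+1.
    by rewrite (cvg_shiftS (visit_prob k.+1 j)); apply: visit_prob_cvg.
  apply: (cvg_unique _ c1) => //=.
  by under eq_fun do rewrite visit_prob_up; apply: cvgMr; do 2?apply: cvgD;
    apply: visit_prob_cvg.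
have aff k : g k = g 0 + k%:R * (g 1%N - g 0) /\ g k.+1 = g 0 + k.+1%:R * (g 1%N - g 0).
  elim: k => [|k [IH1 IH2]]; first by split; ring.
  split=> //; have := rec k; rewrite IH1 IH2 => E.
  have -> : g k.+2 = 3 * (g 0 + k.+1%:R * (g 1%N - g 0)) - (g 0 + k%:R * (g 1%N - g 0))
    - (g 0 + k.+1%:R * (g 1%N - g 0)).
    by move: E; lra.
  by rewrite -[k.+2]addn2 -[k.+1]addn1 !natrD; ring.
have d0 : g 1%N - g 0 = 0.
  apply/eqP/negPn/negP => dn.
  have [k kd] : exists k : nat, 1 < k%:R * `|g 1%N - g 0|.
    exists (Num.trunc (`|g 1%N - g 0|^-1)).+1.
    rewrite -ltr_pdivrMr ?normr_gt0 // mul1r; exact: truncnS_gt.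
  move: kd; rewrite ltNge => /negP; apply; rewrite -[k%:R]normr_nat -normrM ler_norml.
  have := gb k; have := gb 0%N; have [-> _] := aff k.
  set x := _%:R * (g 1%N - g 0); move: (g 0%N) => y.
  by move=> /andP[? ?] /andP[? ?]; apply/andP; split; lra.
by have [E _] := aff h; rewrite -/(g h) E d0 mulr0 addr0.
Unshelve. all: by end_near.
Qed.

(** As the limit does not depend on the starting level, conditioning on the first letter gives
    [x_{j+1} = (2 x_j + [j = 0]) / 3] with [x_0 = 0]. *)
Lemma visit_prob_lim j : visit_prob 0 j @ \oo --> geom3 j.
Proof.
suff <- : lim (visit_prob 0 j @ \oo) = geom3 j by apply: visit_prob_cvg.
elim: j => [|j IH].
  have -> : visit_prob 0 0 = fun _ => 0 by apply/funext => K; rewrite visit_prob0.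
  by apply: cvg_lim => //; apply: cvg_cst.
have c1 : (fun K => visit_prob 0 j.+1 K.+1) @ \oo --> lim (visit_prob 0 j.+1 @ \oo).
  by rewrite (cvg_shiftS (visit_prob 0 j.+1)); apply: visit_prob_cvg.
have c2 : (fun K => visit_prob 0 j.+1 K.+1) @ \oo --> 3^-1 * (geom3 j + (j == 0)%:R +
  geom3 j).
  under eq_fun do rewrite visit_probS.
  apply: cvgMr; apply: cvgD; last by rewrite -IH; apply: visit_prob_cvg.
  by apply: cvgD; [rewrite -IH -(visit_lim_level 1);
    apply: visit_prob_cvg | apply: cvg_cst].
rewrite (cvg_unique _ c1 c2) //; case: j {IH c1 c2} => [|j] /=; first by rewrite expr0;
  field.
by rewrite exprS; field.
Qed.

End Mean.

(** * Concentration of the number of good windows *)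

Section Tail.
Variable R : realType.

Lemma mean_rs L (F : seq letter -> R) : mean L (fun v => F (rs v)) = mean L F.
Proof.
apply: (mulfI (_ : 3 ^+ L != 0)); first by rewrite expf_neq0.
rewrite -!sum_words (reindex_inj (h := fun w : L.-tuple letter =>
  [tuple of rev (map swap w)])).
  by apply: eq_bigr => w _; rewrite /= -/(rs (rs w)) rsK.
by move=> w w' /(congr1 val) /= /(inv_inj rsK) /val_inj.
Qed.

Lemma mean_window K i j : mean K.*2.+1 (fun b => (window K i j b)%:R : R) =
  3^-1 * visit_prob R 0 i K * visit_prob R 0 j K.
Proof.
rewrite (_ : K.*2.+1 = K + K.+1)%N; last by lia.
rewrite mean_cat /visit_prob -(mean_rs K (fun v => (visits 0 v == Some i)%:R)).
rewrite mulrAC -meanZ; apply: eq_mean => u uK /=.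
have E c v : window K i j (u ++ c :: v) =
    (c == None) && ((visits 0 (rs u) == Some i) && (visits 0 v == Some j)).
  rewrite /window nth_cat uK ltnn subnn /= take_size_cat //.
  by rewrite -cat_rcons drop_size_cat ?size_rcons ?uK.
under [X in mean K X + _ + _]eq_fun do rewrite E /= -mulnb natrM.
under [X in _ + mean K X + _]eq_fun do rewrite E /=.
under [X in _ + _ + mean K X]eq_fun do rewrite E /=.
by rewrite meanZ mean_cst !addr0; ring.
Qed.

Lemma windowsS K i j N v : windows K i j N.+1 v =
  (window K i j (take K.*2.+1 v) + windows K i j N (drop K.*2.+1 v))%N.
Proof.
rewrite /windows big_nat_recl // mul0n drop0; congr addn.
by apply: eq_bigr => q _; rewrite drop_drop mulSn addnC.
Qed.

Variables (K i j : nat).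
Let mu : R := 3^-1 * visit_prob R 0 i K * visit_prob R 0 j K.
Let B := K.*2.+1.

Lemma mu_bounds : 0 <= mu <= 1.
Proof.
have /andP[a0 a1] := visit_prob_bounds R 0 i K;
  have /andP[b0 b1] := visit_prob_bounds R 0 j K.
have := mulr_ge0 a0 b0; have := mulr_ile1 a0 b0 a1 b1.
by rewrite /mu -mulrA; move: (_ * visit_prob _ _ _ _) => x ? ?; apply/andP; split; lra.
Qed.

Lemma mean_exp_window (t : R) :
  mean B (fun b => expR (- t * (window K i j b)%:R)) = 1 - mu * (1 - expR (- t)).
Proof.
rewrite /mu -mean_window mulrC -mulNr -meanZ -[X in X + _](mean_cst B) -meanD.
apply: eq_mean => b _; case: window; first by rewrite !mulr1; ring.
by rewrite !mulr0 expR0 addr0.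
Qed.

Lemma mean_exp_windows (t : R) N r :
  mean (N * B + r) (fun v => expR (- t * (windows K i j N v)%:R)) =
  (1 - mu * (1 - expR (- t))) ^+ N.
Proof.
elim: N => [|N IH].
  rewrite expr0 -[RHS](mean_cst (0 * B + r)); apply: eq_mean => v _.
  by rewrite /windows big_geq // mulr0 expR0.
rewrite exprS -IH -mean_exp_window mulSn -addnA -meanM_cat; apply: eq_mean => v _.
by rewrite windowsS natrD mulrDr expRD.
Qed.

Lemma windows_tail (e : R) o N r : 0 < e <= 1 ->
  mean (o + (N * B + r)) (fun v =>
    ((windows K i j N (drop o v))%:R < (mu - e) * N%:R)%R%:R : R)
    <= expR (- (e ^+ 2 / 4) * N%:R).
Proof.
move=> /andP[e0 e1]; have /andP[m0 m1] := mu_bounds.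
rewrite mean_cat -[leRHS](mean_cst o); apply: mean_le => u uo.
under eq_fun do rewrite drop_size_cat //.
(* Chernoff parameter: the exponent per window is at most [- t * e + mu * t ^ 2], and since
   [mu <= 1] the choice [e / 2] gives at most [- e ^ 2 / 4]. *)
pose t := e / 2; have t0 : 0 < t by rewrite divr_gt0.
pose th := (mu - e) * N%:R.
apply: le_trans (_ : mean (N * B + r) (fun v =>
  expR (t * th) * expR (- t * (windows K i j N v)%:R)) <= _).
  apply: mean_le => v _; rewrite -expRD; case: ltP => h; last exact: expR_ge0.
  rewrite -[leLHS]expR0 ler_expR mulNr -mulrBr mulr_ge0 ?(ltW t0) // subr_ge0.
  exact: ltW.
rewrite meanZ mean_exp_windows.
have h1 : 1 - mu * (1 - expR (- t)) <= expR (- mu * (t - t ^+ 2)).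
  apply: le_trans (expR_ge1Dx _); rewrite lerD2l mulNr lerN2 ler_wpM2l //.
  have h : expR (- t) <= (1 + t)^-1.
    by rewrite expRN lef_pV2 ?posrE ?expR_gt0 ?expR_ge1Dx //; lra.
  suff : (1 + t)^-1 <= 1 - t + t ^+ 2 by lra.
  rewrite -[leLHS]mul1r ler_pdivrMr; last by lra.
  by have := exprn_ge0 3 (ltW t0); rewrite !exprS expr0; lra.
have h0 : 0 <= 1 - mu * (1 - expR (- t)).
  have : expR (- t) <= 1 by rewrite -expR0 ler_expR oppr_le0 ltW.
  have := expR_ge0 (- t); nra.
apply: le_trans (_ : expR (t * th) * expR (- mu * (t - t ^+ 2)) ^+ N <= _).
  by rewrite ler_wpM2l ?expR_ge0 // lerXn2r ?nnegrE // expR_ge0.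
rewrite -expRM_natr -expRD ler_expR /th /t.
have N0 : 0 <= N%:R :> R by [].
have -> : e / 2 * ((mu - e) * N%:R) + - mu * (e / 2 - (e / 2) ^+ 2) * N%:R =
  (- (e ^+ 2 / 2) + mu * (e ^+ 2 / 4)) * N%:R by field.
apply: ler_wpM2r => //.
have : mu * (e ^+ 2 / 4) <= e ^+ 2 / 4
  by rewrite ler_piMl // divr_ge0 // exprn_ge0 // ltW.
lra.
Qed.

(** The deviation event is subtracted instead of conditioned on: with [W] the windows count at an
    offset, [1_A * W >= th * (1_A - 1_{W < th})]. Summing over the offsets gives the factor [B]. *)
Lemma good_mean_lower (A : pred (seq letter)) (e : R) N L : 0 < e <= 1 -> e <= mu ->
  (B + N * B <= L.+1)%N ->
  B%:R * ((mu - e) * N%:R) * (mean L (fun w => (A w)%:R) - expR (- (e ^+ 2 / 4) * N%:R))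
    <= mean L (fun w => (A w)%:R * (good_count L w i j)%:R).
Proof.
move=> eb em NL; set th := (mu - e) * N%:R.
have th0 : 0 <= th by rewrite mulr_ge0 // subr_ge0.
apply: le_trans (_ : mean L (fun w =>
  \sum_(0 <= o < B) (A w)%:R * (windows K i j N (drop o w))%:R) <= _); last first.
  apply: mean_le => w wL; rewrite -mulr_sumr ler_wpM2l // -natr_sum ler_nat.
  by rewrite -wL; apply: good_count_windows; rewrite wL.
set x := _ - _; have -> : B%:R * th * x = \sum_(0 <= o < B) th * x.
  by rewrite sumr_const_nat subn0 -[RHS]mulr_natl mulrA.
rewrite mean_sum !big_nat; apply: ler_sum => o /andP[_ oB]; rewrite {}/x.
apply: le_trans (_ : mean L (fun w => th * (A w)%:R +
   (- th) * ((windows K i j N (drop o w))%:R < th)%R%:R) <= _).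
  rewrite meanD !meanZ mulrBr [- th * _]mulNr lerD2l lerN2 ler_wpM2l //.
  rewrite (_ : L = o + (N * B + (L - o - N * B)))%N; last by move: oB NL; rewrite /B; nia.
  exact: windows_tail.
apply: mean_le => w _; case: (A w); case: ltP => h;
  rewrite ?mul1r ?mul0r ?mulr1 ?mulr0 ?add0r ?addr0 ?subrr //.
by rewrite oppr_le0.
Qed.

End Tail.

(** * Counting tandem walks *)

Lemma size_X_ge v t : - (size v)%:Z <= X v t.
Proof.
have [k] := ubnP t; elim: k t => // k IH [|t] tk; first by rewrite X0; lia.
have [tv|vt] := ltnP t (size v); last first.
  rewrite X_over ?(leqW vt) // height_count; have := size_count v; lia.
rewrite /X height_count; have := size_count (take t.+1 v); rewrite size_takel //; lia.
Qed.

Definition low (b : nat) (v : seq letter) : Prop :=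
  height v = 0 /\ forall t, - b%:Z <= X v t.

Lemma low_cat b u v : low b u -> low b v -> low b (u ++ v).
Proof.
move=> [u0 ul] [v0 vl]; split; first by rewrite height_cat u0 v0.
by move=> t; rewrite X_cat; case: ifP => // _; rewrite u0 add0r.
Qed.

(** Equivalently, the three letters occur equally often, so the walk closes up in both
    coordinates. *)
Definition balanced (v : seq letter) : bool := (height v == 0) && (height (rs v) == 0).

Lemma balanced_low b v : (size v <= b)%N -> balanced v -> low b v /\ low b (rs v).
Proof.
move=> vb /andP[/eqP h1 /eqP h2]; split; split=> // t.
  by have := size_X_ge v t; lia.
by have := size_X_ge (rs v) t; rewrite size_rs; lia.
Qed.

(** Closing up after every [b] letters bounds the depth by [b] whatever the total length. *)
Fixpoint blocks (b q : nat) (v : seq letter) : bool :=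
  if q is q'.+1 then balanced (take b v) && blocks b q' (drop b v) else v == [::].

Lemma blocks_low b q v : blocks b q v -> low b v /\ low b (rs v).
Proof.
elim: q v => [|q IH] v /=.
  by move=> /eqP ->; apply: balanced_low => //; rewrite /balanced /rs /= /height big_nil.
move=> /andP[bt /IH [l1 l2]].
have [k1 k2] : low b (take b v) /\ low b (rs (take b v)).
  by apply: balanced_low bt; rewrite size_take_min geq_minl.
by rewrite -(cat_take_drop b v) rs_cat; split; apply: low_cat.
Qed.

Lemma height_nseq p c : height (nseq p c) = p%:Z * dx c.
Proof.
elim: p => [|p IH]; first by rewrite /height big_nil mul0r.
by rewrite /height big_cons -/(height _) IH; lia.
Qed.

Lemma X_nseq p c t : X (nseq p c) t = (minn t p)%:Z * dx c.
Proof.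
rewrite /X; have [tp|pt] := leqP t p; first by rewrite take_nseq // height_nseq.
by rewrite take_oversize ?size_nseq ?(ltnW pt) // height_nseq.
Qed.

Lemma rs_nseq p c : rs (nseq p c) = nseq p (swap c).
Proof. by rewrite /rs map_nseq rev_nseq. Qed.

(* From (0,m), a word goes up to (H,m+H), far from both axes, where excursions
   of depth at most H are harmless, and then down to (n,0). *)
Definition ascent (H : nat) : seq letter := nseq H.*2 (Some true) ++ nseq H None.
Definition descent (m n H : nat) : seq letter :=
  nseq (m + H) None ++ nseq (m + H.*2 - n) (Some false).

Lemma X_nseq2 p q c c' t : X (nseq p c ++ nseq q c') t =
  (minn t p)%:Z * dx c + (minn (t - p) q)%:Z * dx c'.
Proof.
rewrite X_cat size_nseq !X_nseq height_nseq; case: leqP => // tp.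
by rewrite (_ : t - p = 0)%N ?min0n ?mul0r ?addr0 //; lia.
Qed.

Lemma height_nseq2 p q c c' : height (nseq p c ++ nseq q c') = p%:Z * dx c + q%:Z * dx c'.
Proof. by rewrite height_cat !height_nseq. Qed.

Lemma nonneg3 (x y z : seq letter) (b : nat) : low b y -> nonneg x -> b%:Z <= height x ->
  (forall t, 0 <= height x + X z t) -> nonneg (x ++ y ++ z).
Proof.
move=> [y0 yl] x0 bx xz t; rewrite X_cat; case: ifP => // _.
rewrite X_cat; case: ifP => _; last by rewrite y0 add0r.
by have := yl (t - size x)%N; lia.
Qed.

Lemma ascent_descent_admissible m n H b v : (b <= H)%N -> (n <= m + H.*2)%N ->
  low b v -> low b (rs v) -> admissible m n (ascent H ++ v ++ descent m n H).
Proof.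
move=> bH nH lv lv'; have [v0 _] := lv; have [v0' _] := lv'.
have rA : rs (ascent H) = nseq H None ++ nseq H.*2 (Some false)
  by rewrite rs_cat !rs_nseq.
have rD : rs (descent m n H) = nseq (m + H.*2 - n) (Some true) ++ nseq (m + H) None.
  by rewrite rs_cat !rs_nseq.
have rw : rs (ascent H ++ v ++ descent m n H) = rs (descent m n H) ++ rs v ++ rs
  (ascent H).
  by rewrite !(rs_cat (ascent H), rs_cat v) catA.
split; rewrite ?rw ?rA ?rD.
- apply: (nonneg3 lv) => [t||t]; rewrite ?X_nseq2 ?height_nseq2 /=; lia.
- apply: (nonneg3 lv') => [t||t]; rewrite ?X_nseq2 ?height_nseq2 /=; lia.
- by rewrite !height_cat v0 !height_nseq /=; lia.
by rewrite !height_cat v0' !height_nseq /=; lia.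
Qed.

Definition rot (c : letter) : letter :=
  match c with None => Some false | Some false => Some true | Some true => None end.

Lemma rot_inj : injective rot.
Proof. by case=> [[|]|] [[|]|]. Qed.

Lemma count_rot c v : count_mem (rot c) (map rot v) = count_mem c v.
Proof. by rewrite count_map; apply: eq_count => x /=; rewrite (inj_eq rot_inj). Qed.

Section TandemLower.
Variable R : realType.

Lemma mean_point (u : seq letter) (F : seq letter -> R) : (forall v, 0 <= F v) ->
  (3 ^+ size u)^-1 * F u <= mean (size u) F.
Proof.
elim: u F => [|c u IH] F F0 /=; first by rewrite expr0 invr1 mul1r.
have m0 x : 0 <= mean (size u) (fun v => F (x :: v)) by apply: mean_ge0.
apply: le_trans (_ : 3^-1 * mean (size u) (fun v => F (c :: v)) <= _).
  by rewrite exprS invfM -mulrA ler_pM2l ?invr_gt0 //; apply: IH.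
rewrite ler_pM2l ?invr_gt0 //.
by have := m0 None; have := m0 (Some true); have := m0 (Some false); case: c => [[|]|];
  lra.
Qed.

Definition letter_type k (v : seq letter) : 'I_k.+1 * 'I_k.+1 :=
  (inord (count_mem None v), inord (count_mem (Some false) v)).

(** Pigeonhole: there are [k.+1 ^ 2] types, and their probabilities sum to 1. *)
Lemma popular_type k : exists ty : 'I_k.+1 * 'I_k.+1,
  (k.+1%:R ^+ 2)^-1 <= mean k (fun v => (letter_type k v == ty)%:R : R).
Proof.
set x := _^-1; pose p ty := mean k (fun v => (letter_type k v == ty)%:R : R).
apply: contrapT => nH; have H ty : p ty < x.
  by rewrite ltNge; apply/negP => h; apply: nH; exists ty.
have : \sum_ty p ty < \sum_(ty : 'I_k.+1 * 'I_k.+1) x.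
  by apply: ltr_sum => [|ty _]; [apply/hasP; exists (ord0, ord0);
    rewrite ?mem_index_enum | exact: H].
rewrite sumr_const card_prod !card_ord -[x *+ _]mulr_natr natrM /x -expr2 mulVf
  ?expf_neq0 ?pnatr_eq0 //.
rewrite /p -mean_sum (@eq_mean _ _ _ (fun _ => 1)) ?mean_cst ?ltxx // => v _.
rewrite (bigD1 (letter_type k v)) //= eqxx big1 ?addr0 // => ty.
by rewrite eq_sym => /negbTE ->.
Qed.

Lemma balanced_rot k u v w : size u = k -> size v = k -> size w = k ->
  letter_type k u = letter_type k v -> letter_type k v = letter_type k w ->
  balanced (u ++ map rot v ++ map rot (map rot w)).
Proof.
move=> su sv sw [] E1 E2 [] E3 E4.
have cb (c : letter) (x : seq letter) : size x = k -> (count_mem c x < k.+1)%N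
  by move=> <-; rewrite ltnS count_size.
have inord_eq a b : (a < k.+1)%N -> (b < k.+1)%N -> inord a = inord b :> 'I_k.+1 -> a = b.
  by move=> ha hb /(congr1 (@nat_of_ord _)); rewrite !inordK.
pose cU (x : seq letter) := count_mem (None : letter) x.
pose cR (x : seq letter) := count_mem (Some false : letter) x.
pose cS (x : seq letter) := count_mem (Some true : letter) x.
have {}E1 : cU u = cU v := inord_eq _ _ (cb _ _ su) (cb _ _ sv) E1.
have {}E2 : cR u = cR v := inord_eq _ _ (cb _ _ su) (cb _ _ sv) E2.
have {}E3 : cU v = cU w := inord_eq _ _ (cb _ _ sv) (cb _ _ sw) E3.
have {}E4 : cR v = cR w := inord_eq _ _ (cb _ _ sv) (cb _ _ sw) E4.
have sz x : size x = (cU x + cR x + cS x)%N := size_count x.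
have hE x : height x = (cU x)%:Z - (cR x)%:Z := height_count x.
have rE : (forall x, cU (rs x) = cU x) * (forall x, cR (rs x) = cS x).
  by split=> x; rewrite /cU /cR count_rs.
have cE : (forall x y, cU (x ++ y) = cU x + cU y)%N * (forall x y,
  cR (x ++ y) = cR x + cR y)%N
    * (forall x y, cS (x ++ y) = cS x + cS y)%N.
  by do !split; move=> x y; apply: count_cat.
have r0 x : cU (map rot x) = cS x := count_rot (Some true) x.
have r1 x : cR (map rot x) = cU x := count_rot None x.
have r2 x : cS (map rot x) = cR x := count_rot (Some false) x.
move: (sz u) (sz v) (sz w); rewrite su sv sw /balanced !hE !rE !cE !(r0, r1, r2).
by clearbody cU cR cS; lia.
Qed.

(* Three words of a same popular type, with letters rotated zero, one and two
   times, make up a balanced word. *)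
Lemma mean_balanced k : (k.+1%:R ^+ 6)^-1 <=
  mean (k + (k + k)) (fun v => (balanced v)%:R : R).
Proof.
have [ty hty] := popular_type k; set x := _^-1 in hty.
pose f v : R := (letter_type k v == ty)%:R.
have x0 : 0 <= x by rewrite invr_ge0 exprn_ge0.
rewrite mean_cat; apply: le_trans (_ : mean k (fun u =>
  f u * (mean k f * mean k f)) <= _).
  under eq_fun do rewrite mulrC; rewrite meanZ.
  rewrite (_ : _^-1 = x * x * x); last by rewrite /x; field; rewrite nat1r pnatr_eq0.
  by rewrite !ler_pM ?mulr_ge0.
apply: mean_le => u su; rewrite mean_cat.
(* [rot] permutes the letters, so it may be applied to the second word once and to the third one
   twice without changing the mean. *)
have -> : mean k (fun v => mean k (fun z => (balanced (u ++ v ++ z))%:R : R)) =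
    mean k (fun v => mean k (fun z =>
      (balanced (u ++ map rot v ++ map rot (map rot z)))%:R : R)).
  rewrite -(mean_perm k (fun v => mean k (fun z =>
    (balanced (u ++ v ++ z))%:R : R)) rot_inj).
  apply: eq_mean => v _.
  rewrite -(mean_perm k (fun z => (balanced (u ++ map rot v ++ z))%:R : R) rot_inj).
  by rewrite -(mean_perm k (fun z =>
    (balanced (u ++ map rot v ++ map rot z))%:R : R) rot_inj).
have -> : f u * (mean k f * mean k f) = mean k (fun v => mean k (fun z =>
  f u * f v * f z)).
  rewrite mulrA -meanZ; apply: eq_mean => v _.
  by rewrite meanZ; ring.
apply: mean_le => v sv; apply: mean_le => z sz; rewrite /f.
case: eqP => E1; last by rewrite !mul0r.
case: eqP => E2; last by rewrite mulr0 mul0r.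
case: eqP => E3; last by rewrite mulr0.
by rewrite !mul1r (balanced_rot su sv sz) // ?E1 ?E2 ?E3.
Qed.

Lemma mean_blocks b q :
  mean (q * b) (fun v => (blocks b q v)%:R : R) = mean b (fun v => (balanced v)%:R) ^+ q.
Proof.
elim: q => [|q IH] /=; first by rewrite expr0.
rewrite mulSn exprS -IH -meanM_cat; apply: eq_mean => v _.
by rewrite -mulnb natrM.
Qed.

(** A balanced filler of length 3, which adjusts the length when it is not filled exactly by long
    blocks. *)
Definition loop : seq letter := [:: Some true; None; Some false].

Lemma loops_low b r : (3 <= b)%N -> low b (flatten (nseq r loop)) /\ low b (rs (flatten
  (nseq r loop))).
Proof.
move=> b3; have [l1 l2] : low b loop /\ low b (rs loop).
  by apply: balanced_low => //; rewrite /balanced !height_count.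
elim: r => [|r [IH1 IH2]] /=; last by rewrite -[_ :: _]/(loop ++ _) rs_cat; split;
  apply: low_cat.
by apply: balanced_low => //; rewrite /balanced /rs /= /height big_nil.
Qed.

Lemma size_loops r : size (flatten (nseq r loop)) = (r * 3)%N.
Proof. by elim: r => //= r ->; rewrite mulSn. Qed.

(** The ascent, the loops and the descent are prescribed, at the price of a factor 1/3 per letter;
    only the [q] blocks are random. *)
Lemma mean_tandem_lower m n H k q r : (0 < k)%N -> (k * 3 <= H)%N -> (n <= m + H.*2)%N -> 
  (3 ^+ (size (ascent H) + r * 3 + size (descent m n H)))^-1 *
    mean (k * 3) (fun v => (balanced v)%:R : R) ^+ q <=
  mean (size (ascent H) + ((q * (k * 3) + r * 3) + size (descent m n H)))
    (fun w => (tandem_word m n w)%:R : R).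
Proof.
move=> k0 kH nH; set A := ascent H; set D := descent m n H;
  set F := flatten (nseq r loop).
have p3 p : 0 <= (3 ^+ p)^-1 :> R by rewrite invr_ge0 exprn_ge0.
have b0 (x : bool) : 0 <= x%:R :> R by case: x.
rewrite mean_cat; apply: le_trans (mean_point A _); last by move=> v; apply: mean_ge0.
rewrite !exprD !invfM -!mulrA ler_wpM2l // mean_cat mean_cat -/F.
rewrite -mean_blocks -!meanZ; apply: mean_le => v _.
rewrite -(size_loops r) -/F; apply: le_trans (mean_point F _); last by move=> u;
  apply: mean_ge0.
rewrite ler_wpM2l //; apply: le_trans (mean_point D _) => //.
rewrite ler_wpM2l //; case: (boolP (blocks _ _ _)) => // /blocks_low [l1 l2].
have [|f1 f2] := @loops_low (k * 3) r; first by lia.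
have /admissibleP -> // : admissible m n (A ++ (v ++ F) ++ D).
by apply: (ascent_descent_admissible kH nH); rewrite ?rs_cat; apply: low_cat.
Qed.

Lemma expR_dominates (eta : R) : 0 < eta -> exists2 k : nat, (0 < k)%N &
  k.+1%:R ^+ 2 <= expR (eta * k%:R).
Proof.
(* The exponential is at least [(eta * k / 3) ^ 3], and [k.+1 <= 2 * k], so
   [eta ^ 3 * k ^ 3 / 27 >= 4 * k ^ 2] is enough, and 108 is [4 * 27]. *)
move=> e0; exists (Num.trunc (108 / eta ^+ 3)).+1 => //; set k := (Num.trunc _).+1.
have kR : 108 / eta ^+ 3 < k%:R := truncnS_gt _.
have k1 : 1 <= k%:R :> R by rewrite ler1n.
have -> : eta * k%:R = 3%:R * (eta * k%:R / 3) by field.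
rewrite expRM_natl; apply: le_trans (_ : (eta * k%:R / 3) ^+ 3 <= _); last first.
  rewrite lerXn2r ?nnegrE ?expR_ge0 //; first by rewrite divr_ge0 // mulr_ge0 // ltW.
  by apply: le_trans (expR_ge1Dx _); rewrite lerDr.
apply: le_trans (_ : (2 * k%:R) ^+ 2 <= _).
  by rewrite lerXn2r ?nnegrE ?mulr_ge0 // -natr1; lra.
rewrite ltr_pdivrMr ?exprn_gt0 // in kR.
have -> : (eta * k%:R / 3) ^+ 3 = (k%:R * eta ^+ 3 / 27) * k%:R ^+ 2 by field.
rewrite exprMn ler_wpM2r ?exprn_ge0 //.
by rewrite expr2; move: kR; set y := _ * _ ^+ 3; lra.
Qed.

(** A balanced block of [3 * k] letters has probability at least [k.+1 ^ -6], hence at least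
    [exp (- 3 * eta * k)] for the chosen [k]: a rate of [eta] per letter. The rest of the word has
    bounded length and goes into [C]. *)
Lemma tandem_lower m n (eta : R) : 0 < eta -> exists C : R, exists L0 : nat, 0 < C /\
  forall L, (L0 <= L)%N -> (3 %| L + m + n)%N ->
    C * expR (- eta * L%:R) <= mean L (fun w => (tandem_word m n w)%:R).
Proof.
move=> e0; have [k k0 hk] := expR_dominates e0.
(* The term [k * 3] absorbs the depth of the blocks, and [n] makes the number of final steps in
   [descent] nonnegative. Modulo 3, [a + c] is [2 * (m + n)], so the remaining length is a multiple
   of 3. *)
pose H := (k * 3 + n)%N; set a := size (ascent H); set c := size (descent m n H).
have aE : a = (k * 9 + n * 3)%N by rewrite /a /ascent size_cat !size_nseq /H; lia.
have cE : c = (m * 2 + k * 9 + n * 2)%N by rewrite /c /descent size_cat !size_nseq /H;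
  lia.
exists (3 ^+ (a + k * 3 + c))^-1, (a + c)%N; split; first by rewrite invr_gt0 exprn_gt0.
move=> L LL d3; pose M := ((L - a - c) %/ 3)%N; pose q := (M %/ k)%N;
  pose r := (M %% k)%N.
have ME : (M * 3 = L - a - c)%N.
  by rewrite /M divnK //; move: d3 LL; rewrite aE cE; lia.
have LE : L = (a + ((q * (k * 3) + r * 3) + c))%N.
  have := divn_eq M k; rewrite -/q -/r => E; move: ME; rewrite E; lia.
have rk : (r < k)%N by rewrite ltn_mod.
have kH : (k * 3 <= H)%N by rewrite /H leq_addr.
have nH : (n <= m + H.*2)%N by rewrite /H; lia.
rewrite {2}LE; apply: le_trans (mean_tandem_lower q r k0 kH nH); rewrite -/a -/c.
apply: ler_pM; rewrite ?invr_ge0 ?exprn_ge0 ?expR_ge0 //.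
  rewrite lef_pV2 ?posrE ?exprn_gt0 // ler_eXn2l ?ltr1n //.
  by rewrite leq_add2r leq_add2l leq_mul2r /= ltnW.
have hb : expR (- eta * (k * 3)%:R) <= mean (k * 3) (fun v => (balanced v)%:R : R).
  rewrite (_ : k * 3 = k + (k + k))%N; last by lia.
  apply: le_trans (mean_balanced k);
    rewrite mulNr expRN lef_pV2 ?posrE ?expR_gt0 ?exprn_gt0 //.
  rewrite (_ : 6 = 2 * 3)%N // exprM (_ : eta * _ = eta * k%:R * 3%:R);
    last by rewrite !natrD; ring.
  by rewrite expRM_natr lerXn2r ?nnegrE ?expR_ge0 ?exprn_ge0.
apply: le_trans (_ : expR (- eta * (k * 3)%:R) ^+ q <= _); last first.
  by rewrite lerXn2r ?nnegrE ?expR_ge0 // (le_trans _ hb) ?expR_ge0.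
rewrite -expRM_natr ler_expR -mulrA !mulNr lerN2 ler_pM2l // -natrM ler_nat.
by rewrite LE; lia.
Qed.
End TandemLower.

(** * The limit *)

Section DegreeLimit.
Variable R : realType.

Lemma degree_prob_mean m n L i j : (0 < i)%N -> (0 < j)%N ->
  degree_prob R m n L.+1 i j =
  mean L (fun w => (tandem_word m n w)%:R * (good_count L w i j)%:R) /
  (((L + m + n) %/ 3 + 2)%:R * mean L (fun w => (tandem_word m n w)%:R)).
Proof.
move=> i0 j0; rewrite degree_prob_words //.
have -> : #|tandem m n L|%:R = 3 ^+ L * mean L (fun w => (tandem_word m n w)%:R) :> R.
  rewrite -sum_words -sum1_card natr_sum big_mkcond; apply: eq_bigr => w _.
  by rewrite inE; case: tandem_word.
rewrite -mulr_suml.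
have -> : \sum_(w in tandem m n L) (good_count L w i j)%:R =
    3 ^+ L * mean L (fun w => (tandem_word m n w)%:R * (good_count L w i j)%:R) :> R.
  rewrite -sum_words big_mkcond; apply: eq_bigr => w _.
  by rewrite inE; case: tandem_word; rewrite ?mul1r ?mul0r.
have h3 : 3 ^+ L != 0 :> R by rewrite expf_neq0.
rewrite !invfM; move: (3 ^+ L) h3 (mean _ _) (mean _ _)^-1 (_ %:R)^-1 => c c0 x y z.
by rewrite -[RHS]mul1r -(mulfV c0); ring.
Qed.

Lemma degree_prob_ge0 m n l i j : 0 <= degree_prob R m n l i j.
Proof.
by rewrite divr_ge0 // sumr_ge0 // => C _; rewrite divr_ge0.
Qed.

Lemma geom3_bounds j : 0 <= geom3 R j <= 1.
Proof.
case: j => [|j] /=; first by rewrite lexx ler01.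
have h : 0 <= (2 / 3 : R) ^+ j by rewrite exprn_ge0.
have : (2 / 3 : R) ^+ j <= 1 by rewrite exprn_ile1 //; lra.
by move: h; move: (_ ^+ _) => x ? ?; apply/andP; split; lra.
Qed.

Lemma window_prob_lim i j :
  (fun K => visit_prob R 0 i K * visit_prob R 0 j K) @ \oo --> geom3 R i * geom3 R j.
Proof. by apply: cvgM; apply: visit_prob_lim. Qed.

Lemma degree_prob_lower m n i j (d : R) : 0 < d -> exists L0 : nat, forall L,
  (L0 <= L)%N ->
  (3 %| L + m + n)%N -> geom3 R i * geom3 R j - d <= degree_prob R m n L.+1 i j.
Proof.
move=> d0; set q := geom3 R i * geom3 R j.
have [dq|qd] := ltP d q; last first.
  by exists 0%N => L _ _; apply: le_trans (degree_prob_ge0 m n L.+1 i j);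
    rewrite subr_le0.
have i0 : (0 < i)%N by case: i @q dq => // q; rewrite /q mul0r ltNge ltW.
have j0 : (0 < j)%N by case: j @q dq => // q; rewrite /q mulr0 ltNge ltW.
have q1 : q <= 1.
  have /andP[a0 a1] := geom3_bounds i; have /andP[b0 b1] := geom3_bounds j.
  exact: mulr_ile1.
have [K hK] : exists K, q - d / 4 <= visit_prob R 0 i K * visit_prob R 0 j K.
  have d4 : 0 < d / 4 by rewrite divr_gt0.
  have /cvgrPdist_le /(_ _ d4) [K _ /(_ K (leqnn K))] := @window_prob_lim i j.
  by rewrite ler_norml => /andP[_ h]; exists K; move: h; rewrite -/q /=; lra.
pose mu : R := 3^-1 * visit_prob R 0 i K * visit_prob R 0 j K.
have muE : mu = (visit_prob R 0 i K * visit_prob R 0 j K) / 3 by rewrite /mu; ring.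
have /andP[m0 m1] : 0 <= mu <= 1 := mu_bounds R K i j.
(* There are about [L / 3] vertices, so an error on [mu] counts three times: [3 * e = d / 4]. With
   [d / 4] from the truncation at [K], half of [d] remains for the boundary and tail terms. *)
pose e := d / 12; have eb : 0 < e <= 1 by rewrite /e; apply/andP; split; lra.
have emu : e <= mu by rewrite muE /e; lra.
pose B := K.*2.+1; have B0 : 0 < B%:R :> R by rewrite ltr0n.
(* With [N] close to [L / B], the tail bound is about [exp (- 2 * eta * L)], the square of the rate
   allowed for admissible words. *)
pose eta : R := e ^+ 2 / (8 * B%:R).
have e20 : 0 < e ^+ 2 by rewrite exprn_gt0 //; case/andP: eb.
have eta0 : 0 < eta by rewrite divr_gt0 // mulr_gt0.
have [C [L1 [C0 hC]]] := tandem_lower m n eta0.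
pose D := expR (e ^+ 2 / 2) / C; have D0 : 0 < D by rewrite divr_gt0 ?expR_gt0.
pose a : R := (2 * B + m + n + 6)%:R; pose b := D / eta.
have a0 : 0 <= a by []; have b0 : 0 <= b by rewrite divr_ge0 ?ltW.
exists (maxn (maxn L1 B) (Num.trunc (6 * (a + b) / d)).+1) => L.
rewrite !geq_max => /andP[/andP[L1L BL] L2L] d3.
have LR : 6 * (a + b) / d <= L%:R.
  by apply: le_trans (ltW (truncnS_gt _)) _; rewrite ler_nat.
have L0 : 0 < L%:R :> R by rewrite ltr0n; apply: leq_trans BL.
rewrite degree_prob_mean //; set al := mean L (fun w => (tandem_word m n w)%:R).
have halC : C * expR (- eta * L%:R) <= al by apply: hC.
have al0 : 0 < al by apply: lt_le_trans halC; rewrite mulr_gt0 ?expR_gt0.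
set V : R := (_ %/ 3 + 2)%:R; have V0 : 0 < V by rewrite ltr0n addn2.
have V3 : 3 * V <= L%:R + (m + n + 6)%:R.
  have le3 : (3 * ((L + m + n) %/ 3 + 2) <= L + (m + n + 6))%N.
    by rewrite !addnA mulnDr leq_add2r mulnC leq_trunc_div.
  by rewrite -(ler_nat R) natrM [leRHS]natrD in le3.
clearbody V.
pose N := (L %/ B).-1.
have BN : (B + N * B <= L)%N.
  rewrite -mulSn /N prednK ?divn_gt0 //; exact: leq_trunc_div.
have BN' : (L <= N * B + 2 * B)%N.
  have := ltn_ceil L (isT : (0 < B)%N); rewrite /N => h.
  have : (0 < L %/ B)%N by rewrite divn_gt0.
  by case: (L %/ B)%N h => // x h _; rewrite -mulnDl addn2 ltnW.
have BNR : L%:R - 2 * B%:R <= B%:R * N%:R :> R.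
  by rewrite lerBlDr -!natrM -natrD ler_nat; move: BN'; rewrite mulnC.
have NL : (B + N * B <= L.+1)%N by apply: leqW.
have := good_mean_lower (tandem_word m n) eb emu NL; rewrite -/al.
set E := expR _; set f : R := mu - e; set Mn := mean _ _ => G.
pose t := b / L%:R; have t0 : 0 <= t by rewrite divr_ge0 // ltW.
pose s := a / L%:R; have s0 : 0 <= s by rewrite divr_ge0 // ltW.
have st : s + t <= d / 6.
  rewrite /s /t -mulrDl ler_pdivrMr //; move: LR; rewrite ler_pdivrMr //; lra.
(* One factor [x] is compared with the probability [al] of admissible words, the other with
   [1 / (eta * L)]; [exp (e ^ 2 / 2)] accounts for the at most two blocks lost in [N]. *)
have Et : E <= t * al.
  pose x := expR (- eta * L%:R); have x0 : 0 < x := expR_gt0 _.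
  have xL : x <= (eta * L%:R)^-1.
    rewrite /x mulNr expRN lef_pV2 ?posrE ?expR_gt0 ?(mulr_gt0 eta0 L0) //.
    by apply: le_trans (expR_ge1Dx _); rewrite lerDr.
  have EL : E <= expR (e ^+ 2 / 2) * x * x.
    rewrite /E /x -!expRD ler_expR.
    have -> : e ^+ 2 / 2 + - eta * L%:R + - eta * L%:R = e ^+ 2 / 4 * ((2 * B%:R -
      L%:R) / B%:R).
      by rewrite /eta; field; rewrite ?pnatr_eq0 // gt_eqF.
    rewrite mulNr -mulrN ler_pM2l ?divr_gt0 // ler_pdivlMr //; lra.
  apply: (le_trans EL); rewrite (_ : t * al = D * al * (eta * L%:R)^-1); last first.
    by rewrite /t /b [(eta * _)^-1]invfM; move: (eta^-1) (L%:R^-1) => y z; ring.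
  apply: ler_pM => //; rewrite ?mulr_ge0 ?expR_ge0 ?(ltW x0) //.
  rewrite (_ : expR (e ^+ 2 / 2) = D * C); last by rewrite /D divfK // gt_eqF.
  by rewrite -mulrA ler_pM2l.
have f0 : 0 <= f by rewrite subr_ge0.
have f1 : f <= 1 by rewrite /f; case/andP: eb; lra.
have fq : q - d / 2 <= 3 * f by rewrite /f muE /e; lra.
have sV : 3 * V * (1 - s) <= B%:R * N%:R.
  have aL : a <= L%:R.
    apply: le_trans LR; rewrite ler_pdivlMr //.
    have : a * d <= a * 1 by rewrite ler_wpM2l //; lra.
    lra.
  have s1 : 0 <= 1 - s by rewrite subr_ge0 ler_pdivrMr // mul1r.
  have VB := ler_wpM2r s1 V3; apply: (le_trans VB); apply: (le_trans _ BNR).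
  have sL : s * L%:R = a by rewrite /s divfK // gt_eqF.
  have aE : a = 2 * B%:R + (m + n + 6)%:R by rewrite /a -!addnA natrD natrM.
  have : 0 <= (m + n + 6)%:R * s by rewrite mulr_ge0.
  by move: sL; rewrite aE; set c := (m + n + 6)%:R; lra.
rewrite ler_pdivlMr ?mulr_gt0 //; apply: le_trans G; rewrite -/f.
apply: le_trans (_ : B%:R * (f * N%:R) * (al - t * al) <= _); last first.
  by rewrite ler_wpM2l ?mulr_ge0 // lerD2l lerN2.
have t1 : 0 <= 1 - t by have := st; have := s0; lra.
rewrite (_ : _ * (al - _) = B%:R * N%:R * (f * (1 - t)) * al); last by ring.
rewrite [leLHS]mulrA ler_pM2r //; apply: le_trans (ler_wpM2r (mulr_ge0 f0 t1) sV).
rewrite (_ : 3 * V * _ * _ = 3 * f * ((1 - s) * (1 - t)) * V); last by ring.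
rewrite ler_pM2r //.
have : 1 - d / 6 <= (1 - s) * (1 - t) by have := mulr_ge0 s0 t0; lra.
have : 0 <= 3 * f by rewrite mulr_ge0.
move=> h1 h2; apply: le_trans (ler_wpM2l h1 h2).
have : f * d <= 1 * d by rewrite ler_wpM2r // ltW.
lra.
Qed.
End DegreeLimit.

(** * Upper bounds from the total mass *)

Section DegreeSum.
Variable R : realType.

Lemma sum_pair_count (T : finType) (A : {set T}) (f g : T -> nat) k :
  (\sum_(i < k) \sum_(j < k) #|[set v in A | (f v == i) && (g v == j)]| <= #|A|)%N.
Proof.
have one (x : nat) : (\sum_(i < k) (x == i) <= 1)%N.
  have [xk|kx] := ltnP x k; last by rewrite big1 // => i _; have := ltn_ord i;
    case: eqP => //; lia.
  rewrite (bigD1 (Ordinal xk)) //= eqxx big1 // => i; rewrite -val_eqE /= eq_sym.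
  by move=> /negbTE ->.
rewrite (eq_bigr (fun i : 'I_k =>
  \sum_(v in A) \sum_(j < k) ((f v == i) * (g v == j))%N)%N); last first.
  move=> i _; rewrite exchange_big; apply: eq_bigr => j _.
  rewrite -sum1_card big_mkcond [RHS]big_mkcond /=; apply: eq_bigr => v _.
  by rewrite !inE; case: (v \in A); case: (f v == i); case: (g v == j).
rewrite exchange_big -sum1_card; apply: leq_sum => v _.
by rewrite -big_distrlr /= (leq_mul (one _) (one _)).
Qed.

Lemma sum_degree_prob m n l k :
  \sum_(i < k) \sum_(j < k) degree_prob R m n l i j <= 1.
Proof.
rewrite (eq_bigr (fun i : 'I_k => (\sum_(C in triangulations m n l) \sum_(j < k)
    vertex_prob R (generic_quotient.repr C) i j) / #|triangulations m n l|%:R));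
      last first.
  by move=> i _; rewrite exchange_big mulr_suml.
rewrite -mulr_suml exchange_big.
have [T0|T0] := posnP #|triangulations m n l|; first by rewrite T0 invr0 mulr0 ler01.
rewrite ler_pdivrMr ?ltr0n // mul1r -sumr_const; apply: ler_sum => C _.
rewrite (eq_bigr (fun i : 'I_k =>
  (\sum_(j < k) #|[set v in vertices (generic_quotient.repr C) |
    (indeg (generic_quotient.repr C) v == i) && (outdeg (generic_quotient.repr C) v ==
      j)]|)%:R /
   #|vertices (generic_quotient.repr C)|%:R)); last first.
  by move=> i _; rewrite natr_sum mulr_suml.
rewrite -mulr_suml -natr_sum;
  have := @sum_pair_count _ (vertices (generic_quotient.repr C))
  (indeg (generic_quotient.repr C)) (outdeg (generic_quotient.repr C)) k.
have [->|V0] := posnP #|vertices (generic_quotient.repr C)|;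
  first by rewrite invr0 mulr0 ler01.
by rewrite ler_pdivrMr ?ltr0n // mul1r ler_nat.
Qed.

Lemma sum_geom3 k : \sum_(i < k.+1) geom3 R i = 1 - (2 / 3) ^+ k.
Proof.
elim: k => [|k IH]; first by rewrite big_ord1 /= expr0 subrr.
by rewrite big_ord_recr IH /= exprS; field.
Qed.

Let D m n := [set l : nat | (l + m + n = 1 %[mod 3])%N].

(** A map with [l] edges is encoded by [L = l - 1] letters, so the congruence to 1 becomes
    divisibility of [L + m + n] by 3. *)
Lemma degree_prob_lower_near m n i j (d : R) : 0 < d ->
  \forall l \near within (D m n) \oo,
    geom3 R i * geom3 R j - d <= degree_prob R m n l i j.
Proof.
move=> d0; have [L0 H] := degree_prob_lower m n i j d0.
exists L0.+1 => // -[|L] //= LL; rewrite /D /= => El; apply: H => //.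
by rewrite /dvdn; move: El; rewrite !addSn; lia.
Qed.

(** The mass at [(i, j)] is at most 1 minus the lower bounds at the other pairs up to [k]. The limit
    law has mass [(1 - (2 / 3) ^ k) ^ 2] on these pairs, which costs at most
    [2 * (2 / 3) ^ k <= d / 2]. *)
Lemma degree_prob_upper_near m n i j (d : R) : 0 < d ->
  \forall l \near within (D m n) \oo,
    degree_prob R m n l i j <= geom3 R i * geom3 R j + d.
Proof.
move=> d0.
have [k [ik jk hk]] : exists k, [/\ (i < k.+1)%N,
  (j < k.+1)%N & (2 / 3 : R) ^+ k <= d / 4].
  have c : (fun k => (2 / 3 : R) ^+ k) @ \oo --> (0 : R).
    by apply: cvg_expr; rewrite ger0_norm; lra.
  have d4 : 0 < d / 4 by rewrite divr_gt0.
  have /cvgrPdist_le /(_ _ d4) [K _ HK] := c.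
  exists (maxn K (maxn i j)); split; rewrite ?ltnS ?leq_max ?leqnn ?orbT //.
  have := HK (maxn K (maxn i j)) (leq_maxl _ _).
  by rewrite sub0r normrN; apply: le_trans; rewrite ler_norm.
(* The [k.+1 ^ 2] lower bounds are used together, and their errors add up to [d / 2]. *)
pose e := d / 2 / k.+1%:R ^+ 2; have e0 : 0 < e by rewrite !divr_gt0 ?exprn_gt0.
have low : \forall l \near within (D m n) \oo, forall p : 'I_k.+1 * 'I_k.+1,
    geom3 R p.1 * geom3 R p.2 - e <= degree_prob R m n l p.1 p.2.
  by apply: filter_forall => p; apply: degree_prob_lower_near.
apply: filterS low => l low.
pose p0 : 'I_k.+1 * 'I_k.+1 := (Ordinal ik, Ordinal jk).
have H := sum_degree_prob m n l k.+1.
rewrite pair_bigA (bigD1 p0) //= in H.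
have HS : \sum_(p : 'I_k.+1 * 'I_k.+1 | p != p0) (geom3 R p.1 * geom3 R p.2 - e) <=
    \sum_(p : 'I_k.+1 * 'I_k.+1 | p != p0) degree_prob R m n l p.1 p.2.
  by apply: ler_sum => p _; apply: low.
have ET : \sum_(p : 'I_k.+1 * 'I_k.+1) (geom3 R p.1 * geom3 R p.2 - e) =
    (1 - (2 / 3) ^+ k) ^+ 2 - d / 2.
  rewrite sumrB sumr_const card_prod !card_ord; congr (_ - _).
    by rewrite -(pair_bigA _ (fun i j : 'I_k.+1 =>
      geom3 R i * geom3 R j)) /= -big_distrlr /= sum_geom3 expr2.
  by rewrite -[LHS]mulr_natr natrM -expr2 /e divfK // expf_neq0 // pnatr_eq0.
rewrite (bigD1 p0) //= in ET.
have x0 : 0 <= (2 / 3 : R) ^+ k by rewrite exprn_ge0.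
move: ET HS H hk x0; rewrite expr2;
  move: (\sum_(p | _) _) (\sum_(p | _) _) (_ ^+ k) => a b x.
have := sqr_ge0 x; rewrite expr2; lra.
Qed.

End DegreeSum.

Theorem proposition8 (R : realType) (m n i j : nat)
    (hi : (1 <= i)%N) (hj : (1 <= j)%N) :
  (fun l : nat => degree_prob R m n l i j)
    @ within [set l : nat | (l + m + n = 1 %[mod 3])%N] \oo -->
  (3^-1 * (2 / 3) ^+ (i - 1)%N * (3^-1 * (2 / 3) ^+ (j - 1)%N) : R).
Proof.
have -> : 3^-1 * (2 / 3) ^+ (i - 1)%N * (3^-1 * (2 / 3) ^+ (j - 1)%N) = geom3 R i *
  geom3 R j.
  by case: i j hi hj => [|i] [|j] // _ _; rewrite !subn1.
apply/cvgrPdist_le => e e0.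
have lo := degree_prob_lower_near m n i j e0;
  have hi' := degree_prob_upper_near m n i j e0.
by apply: filterS2 lo hi' => l h1 h2; rewrite ler_norml; apply/andP; split; lra.
Qed.
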